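(* Consider a $q$-periodic CMV matrix $\mathcal C$ on $\ell^2(\mathbb N)$ with $q$ even. Let $\Delta(z)=\mathrm{tr}\,\Phi(z)$ and $\Phi(z)=Z(q,0;z)$ be its discriminant and monodromy matrix, respectively, and denote by $d\nu(\tau)$ its density of states measure, parameterized in the usual way by $\tau\in[0,2\pi)$ (the point of $\partial\mathbb D$ being $e^{i\tau}$). For each $j\ge0$, let $s_j(z)$ be the Schur function corresponding to the $q$-periodic Verblunsky coefficient sequence starting with $\alpha_j,\alpha_{j+1},\dots,\alpha_{q-1},\alpha_0,\dots,\alpha_{j-1}$. Then $$\frac{d\nu(\tau)}{d\tau}\ \ge\ \frac1{\pi q}\sum_{j=0}^{(q-2)/2}\frac1{1-|s_{2j}(e^{i\tau})|^2}$$ whenever $\Delta(e^{i\tau})\in(-2,2)$.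
   Context: Let $\mathbb D=\{z\in\mathbb C:|z|<1\}$ and $\mathbb N=\{0,1,2,\dots\}$. For $\alpha\in\mathbb D$, $\lambda\in\partial\mathbb D$ put $\rho=\rho_\alpha=\sqrt{1-|\alpha|^2}$ and $\Theta(\alpha,\lambda)=\lambda\begin{bmatrix}\overline\alpha&\rho\\ \rho&-\alpha\end{bmatrix}$. Given Verblunsky coefficients $\alpha_n\in\mathbb D$ and phases $\lambda_n\in\partial\mathbb D$, $n\ge0$, the CMV matrix on $\ell^2(\mathbb N)$ is $\mathcal C=\mathcal L_+\mathcal M_+$, with $\mathcal L_+=\bigoplus_{j\ge0}\Theta(\alpha_{2j},\lambda_{2j})$ and $\mathcal M_+=1\oplus\bigoplus_{j\ge0}\Theta(\alpha_{2j+1},\lambda_{2j+1})$, where $\Theta(\alpha_k,\lambda_k)$ acts on $\ell^2(\{k,k+1\})$ and $1$ is the identity on the $0$th coordinate. (The case $\lambda_n\equiv1$ is the standard CMV matrix of the theory of orthogonal polynomials on the unit circle.) It is $q$-periodic if $\alpha_{n+q}=\alpha_n$ and $\lambda_{n+q}=\lambda_n$ for all $n\ge0$. Transfer matrices: for $z\ne0$, $$P(\alpha,\lambda;z)=\frac1\rho\begin{bmatrix}-\overline\alpha&\lambda^{-1}\\ \lambda&-\alpha\end{bmatrix},\qquad Q(\alpha,\lambda;z)=\frac1\rho\begin{bmatrix}-\alpha&\lambda z^{-1}\\ \lambda^{-1}z&-\overline\alpha\end{bmatrix},$$ $Y(n;z)=P(\alpha_n,\lambda_n;z)$ for $n$ odd,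 $Y(n;z)=Q(\alpha_n,\lambda_n;z)$ for $n$ even, and $Z(q,0;z)=Y(q-1;z)Y(q-2;z)\cdots Y(0;z)$. Schur function: for a CMV matrix $\mathcal C$ on $\ell^2(\mathbb N)$ let $\mu$ be its spectral measure, $\int_{\partial\mathbb D}z^n\,d\mu(z)=\langle\delta_0,\mathcal C^n\delta_0\rangle$ for $n\in\mathbb Z$ (inner product linear in the second argument), and let $F(z)=\int\frac{e^{i\theta}+z}{e^{i\theta}-z}\,d\mu(\theta)$, $z\in\mathbb D$, be the Carathéodory function. The Schur function is $s(z)=\frac1z\,\frac{F(z)-1}{F(z)+1}$, $z\in\mathbb D$, an analytic function on $\mathbb D$ (removable singularity at $0$). The function $s_j$ is the Schur function of the CMV matrix whose coefficients are shifted by $j$ (Verblunsky coefficients $(\alpha_{j+n})_{n\ge0}$, with phases $(\lambda_{j+n})_{n\ge0}$ shifted along with them), and $s_{2j}(e^{i\tau})$ denotes its boundary value at $e^{i\tau}$. Density of states measure: restrict $\mathcal C$ to finite boxes with Dirichlet boundary conditions, $\chi_n\mathcal C\chi_n^*$, where $\chi_n:\ell^2(\mathbb N)\to\ell^2([0,n]\cap\mathbb Z)$ is the canonical projection, and let $\nu_n$ be the normalized counting measure of the eigenvalues (with multiplicity) of this restriction. The density of states measure $\nu$ is the weak$^*$ limit of $\nu_n$ as $n\to\infty$, when it exists. In the periodic case the paper takes $\nu$ to exist and to be absolutely continuous, and $d\nu/d\tau$ is its density with respect to arc length $d\tau$ on $\partial\mathbb D$. *)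

(* Defs.v *)
From HB Require Import structures.
From mathcomp Require Export all_boot all_order all_algebra.
From mathcomp Require Export complex.
From mathcomp Require Export all_classical all_reals all_analysis.
Export Order.TTheory GRing.Theory Num.Theory numFieldNormedType.Exports.
Export ComplexField.Normc.

Set Implicit Arguments.
Unset Strict Implicit.
Unset Printing Implicit Defensive.

Local Open Scope classical_set_scope.
Local Open Scope ring_scope.
Local Open Scope complex_scope.

Section CMV.
Variable R : realType.
Local Notation C := R[i].
Implicit Types (a l z : C) (alpha lambda : nat -> C).

Definition rho a : C := (Num.sqrt (1 - normc a ^+ 2))%:C.

Definition mx2 (a b c d : C) : 'M[C]_2 :=
  \matrix_(i < 2, j < 2)
    (if i == 0 then (if j == 0 then a else b) else (if j == 0 then c else d)).

Definition Theta a l : 'M[C]_2 := l *: mx2 (a^*) (rho a) (rho a) (- a).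

(* Infinite matrices are functions nat -> nat -> C.  Theta (alpha_k) (lambda_k)
   occupies rows and columns k and k + 1: row i of Lmx lies in the block
   k = 2 (i %/ 2), row i' + 1 of Mmx in the block k = 2 (i' %/ 2) + 1. *)
Definition Lmx alpha lambda (i j : nat) : C :=
  if (i %/ 2 == j %/ 2)%N then
    let k := (2 * (i %/ 2))%N in
    Theta (alpha k) (lambda k) (inord (i %% 2)) (inord (j %% 2))
  else 0.

Definition Mmx alpha lambda (i j : nat) : C :=
  match i, j with
  | 0%N, 0%N => 1
  | i'.+1, j'.+1 =>
      if (i' %/ 2 == j' %/ 2)%N then
        let k := (2 * (i' %/ 2)).+1 in
        Theta (alpha k) (lambda k) (inord (i' %% 2)) (inord (j' %% 2))
      else 0
  | _, _ => 0
  end.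

Definition conj_trmx (A : nat -> nat -> C) (i j : nat) : C := (A j i)^*.

(* The truncation of the sum is exact for a tridiagonal A, in particular for
   Lmx, Mmx and their adjoints. *)
Definition apply_mx (A : nat -> nat -> C) (u : nat -> C) (i : nat) : C :=
  \sum_(j < i.+2) A i j * u j.

Definition cmv alpha lambda (u : nat -> C) : nat -> C :=
  apply_mx (Lmx alpha lambda) (apply_mx (Mmx alpha lambda) u).

(* The inverse: Lmx and Mmx are unitary. *)
Definition cmv_inv alpha lambda (u : nat -> C) : nat -> C :=
  apply_mx (conj_trmx (Mmx alpha lambda))
    (apply_mx (conj_trmx (Lmx alpha lambda)) u).

Definition cmv_pow alpha lambda (n : int) (u : nat -> C) : nat -> C :=
  match n with
  | Posz m => iter m (cmv alpha lambda) u
  | Negz m => iter m.+1 (cmv_inv alpha lambda) u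
  end.

Definition delta (k : nat) : nat -> C := fun i => (i == k)%:R.

Definition cmv_periodic (q : nat) alpha lambda : Prop :=
  forall n : nat, alpha (n + q)%N = alpha n /\ lambda (n + q)%N = lambda n.

Definition shift (j : nat) (u : nat -> C) : nat -> C := fun n => u (j + n)%N.

Definition Pmx a l : 'M[C]_2 := (rho a)^-1 *: mx2 (- a^*) l^-1 l (- a).

Definition Qmx a l z : 'M[C]_2 :=
  (rho a)^-1 *: mx2 (- a) (l * z^-1) (l^-1 * z) (- a^*).

Definition Ymx alpha lambda (n : nat) z : 'M[C]_2 :=
  if odd n then Pmx (alpha n) (lambda n) else Qmx (alpha n) (lambda n) z.

Fixpoint Zmx alpha lambda (n : nat) z : 'M[C]_2 :=
  match n with
  | 0%N => 1%:M
  | m.+1 => Ymx alpha lambda m z *m Zmx alpha lambda m z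
  end.

Definition discriminant (q : nat) alpha lambda z : C :=
  \tr (Zmx alpha lambda q z).

Definition cis (t : R) : C := cos t +i* sin t.

(* The unit circle is parameterized by the angle in [0, 2 pi[; a probability
   measure on the circle is a probability measure on R carried by that set. *)
Definition angles : set R := `[0, 2 * pi[.

Definition on_circle (m : probability (measurableTypeR R) R) : Prop :=
  m angles = 1%E.

Definition cintegral (m : probability (measurableTypeR R) R) (f : R -> C) : C :=
  Rintegral m angles (fun t => complex.Re (f t)) +i*
  Rintegral m angles (fun t => complex.Im (f t)).

(* <delta_0, v> is the coordinate v 0. *)
Definition is_spectral_measure alpha lambda
    (m : probability (measurableTypeR R) R) : Prop :=
  on_circle m /\
  forall n : int,
    cintegral m (fun t => cis t ^ n) = cmv_pow alpha lambda n (delta 0) 0%N.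

Definition caratheodory (m : probability (measurableTypeR R) R) z : C :=
  cintegral m (fun t => (cis t + z) / (cis t - z)).

Definition schur_quotient (m : probability (measurableTypeR R) R) z : C :=
  z^-1 * ((caratheodory m z - 1) / (caratheodory m z + 1)).

Definition schur (m : probability (measurableTypeR R) R) z : C :=
  if z == 0 then lim ((schur_quotient m w : C^o) @[w --> (0 : C^o)^'])
  else schur_quotient m z.

Definition radial (s : C -> C) (t : R) : R -> C^o := fun r => s (r%:C * cis t).

Definition boundary_value (s : C -> C) (t : R) : C :=
  lim (radial s t r @[r --> 1^'-]).

(* chi_n C chi_n^*, with entries <delta_i, C delta_j> for 0 <= i, j <= n. *)
Definition cmv_trunc alpha lambda (n : nat) : 'M[C]_n.+1 :=
  \matrix_(i, j) cmv alpha lambda (delta j) i.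

(* Listed with algebraic multiplicity. *)
Definition eigenvalues (n : nat) (A : 'M[C]_n) : seq C :=
  sval (closed_field_poly_normal (char_poly A)).

(* The integral of f against the normalized eigenvalue counting measure. *)
Definition eigen_average alpha lambda (n : nat) (f : C -> R) : R :=
  (\sum_(z <- eigenvalues (cmv_trunc alpha lambda n)) f z) / n.+1%:R.

(* Weak* convergence is tested on the complex plane, because the truncations
   are not unitary and their eigenvalues lie in the closed unit disk. *)
Definition is_dos alpha lambda (m : probability (measurableTypeR R) R) : Prop :=
  on_circle m /\
  forall f : C^o -> R, continuous f ->
    eigen_average alpha lambda n f @[n --> \oo] -->
      Rintegral m angles (fun t => f (cis t)).

Definition is_density (m : probability (measurableTypeR R) R) (g : R -> R)
    : Prop :=
  [/\ measurable_fun angles g,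
      (forall t, angles t -> 0 <= g t) &
      forall A : set R, measurable A -> A `<=` angles ->
        m A = (\int[lebesgue_measure]_(t in A) (g t)%:E)%E].

End CMV.

Arguments angles : clear implicits.

(* Main.v *)
(* Write [U] = |U_0|^2 - |U_1|^2 and Phi = Z(q, 0; z).  On the unit circle every
   transfer matrix maps [.] to its opposite, while off the circle Phi strictly
   changes [.]; so for |z| <> 1 its eigenvalues are w and 1/w with |w| > 1.
   - For |z| < 1 the resolvent vector of delta_0 is a bounded orbit of the
     transfer matrices, hence the contracting eigenvector of Phi, and it is
     proportional to (1, z s(z)).
   - For |z| > 1 the characteristic polynomials of the truncations are entries
     of products of transfer matrices; their logarithmic derivatives turn weak*
     convergence of the eigenvalue measures into the identity
       int (|z|^2 - 1) / |z - e^it|^2 dnu(t) = (2/q) Re tr (P R),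
     P being the spectral projection of Phi for w and R the sum over even n < q
     of Z(n+1)^-1 diag(0,1) Z(n+1) - Z(n)^-1 diag(0,1) Z(n).
   Where Delta lies in (-2, 2), the eigenvector (1, m) of Phi with |m| < 1 is
   stable, so both sides extend continuously to the circle, and Lebesgue
   differentiation identifies dnu/dtau with (1/(pi q)) Re tr (P R).  With
   u_n = Z(n) (1, m), tr (P Z(n)^-1 diag(0,1) Z(n)) = - |u_{n,1}|^2 / [u_n],
   which is 1 - 1 / (1 - |s_n|^2) for n even and at least 1 for n odd. *)
Require Import Defs.
From mathcomp Require Import ring lra zify measurable_realfun.

Set Implicit Arguments.
Unset Strict Implicit.
Unset Printing Implicit Defensive.

Local Open Scope classical_set_scope.
Local Open Scope ring_scope.

(** * Transfer matrices *)

Section TransferMatrices.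
Variable R : realType.
Local Notation C := R[i].
Implicit Types (a l z w : C) (alpha lambda : nat -> C) (U V : 'cV[C]_2)
  (A B : 'M[C]_2).

(** The inequality compares objects from opposite sides of the circle: the Schur functions live in
    |z| < 1, while the truncations have their eigenvalues in the closed disk, so that the
    logarithmic derivatives of their characteristic polynomials are under control only for |z| > 1.
    The sides are joined by the sign of [.]: the contracting eigenvector inside and the expanding
    one outside both have [U] > 0, hence a slope of modulus below 1, and on a band exactly one
    eigendirection has this property. Slopes of modulus at most 1 therefore converge to the same m
    from either side, with an explicit rate; neither analytic continuation nor a choice of branch of
    w is involved. Evenness of q makes the sign changes of [.] cancel over a period. The matrix
    diag(0,1) in R arises because Q(z) is Q(1) conjugated by diag(1, z). Since a density is
    determined only almost everywhere, the version exhibited is the one given on the bands by the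
    limit formula, where it is continuous. *)

Lemma lift01 : lift ord0 ord0 = 1 :> 'I_2.
Proof. by apply: val_inj. Qed.

Lemma ord2P (i : 'I_2) : i = 0 \/ i = 1.
Proof. by case: i => [[|[|//]] hi]; [left|right]; apply: val_inj. Qed.

Lemma mulmx2E n A (B : 'M[C]_(2, n)) i j :
  (A *m B) i j = A i 0 * B 0 j + A i 1 * B 1 j.
Proof. by rewrite !mxE !big_ord_recl big_ord0 /= addr0 lift01. Qed.

Lemma mx2P n (A B : 'M[C]_(2, n)) :
  (forall j, A 0 j = B 0 j) -> (forall j, A 1 j = B 1 j) -> A = B.
Proof.
by move=> h0 h1; apply/matrixP => i j; case: (ord2P i) => ->.
Qed.

Lemma mx2_mulv a b c d U :
  (mx2 a b c d *m U) 0 0 = a * U 0 0 + b * U 1 0 /\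
  (mx2 a b c d *m U) 1 0 = c * U 0 0 + d * U 1 0.
Proof. by rewrite !mulmx2E !mxE. Qed.

Lemma det2E A : \det A = A 0 0 * A 1 1 - A 0 1 * A 1 0.
Proof.
rewrite (expand_det_row _ 0) !big_ord_recl big_ord0 addr0 /cofactor !lift01.
rewrite !det_mx11 !mxE /= expr0 expr1 mul1r mulN1r mulrN.
by congr (A _ _ * A _ _ - A _ _ * A _ _); apply: val_inj.
Qed.

Lemma tr2E A : \tr A = A 0 0 + A 1 1.
Proof. by rewrite /mxtrace !big_ord_recl big_ord0 addr0 lift01. Qed.

Lemma conjcC (x : C) : conjc x = x^*.
Proof. by []. Qed.

Lemma conjM (x y : C) : (x * y)^* = x^* * y^*.
Proof. exact: rmorphM. Qed.

Lemma conjD (x y : C) : (x + y)^* = x^* + y^*.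
Proof. exact: rmorphD. Qed.

Lemma conjN (x : C) : (- x)^* = - x^*.
Proof. exact: rmorphN. Qed.

Lemma conjV (x : C) : (x^-1)^* = (x^*)^-1.
Proof. exact: fmorphV. Qed.

Definition conjE := (conjM, conjD, conjN, conjV, (@conjCK C), conjcC).

Lemma rho_facts a : `|a| < 1 ->
  [/\ rho a != 0, rho a ^+ 2 = 1 - a * a^* & (rho a)^* = rho a].
Proof.
move=> ha.
have h1 : 0 < 1 - normc a ^+ 2.
  rewrite subr_gt0 expr_lt1//; last by case: (a) => x y /=; exact: sqrtr_ge0.
  by move: ha; rewrite normc_def ltcR; case: (a).
split; last by rewrite -conjcC /rho conjc_real.
- by rewrite /rho eq_complex /= eqxx andbT sqrtr_eq0 -ltNge.
- rewrite /rho -rmorphXn /= sqr_sqrtr ?ltW// -normCK rmorphB rmorph1.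
  by rewrite rmorphXn /= normc_def; case: (a).
Qed.

Definition jform U : C := `|U 0 0| ^+ 2 - `|U 1 0| ^+ 2.

Lemma unitcJ l : `|l| = 1 -> l != 0 /\ l^* = l^-1.
Proof.
move=> hl; have l0 : l != 0 by rewrite -normr_eq0 hl oner_eq0.
by split=> //; apply: (mulfI l0); rewrite -normCK hl expr1n divff.
Qed.

Lemma jform_P a l U : `|a| < 1 -> `|l| = 1 ->
  jform (Pmx a l *m U) = - jform U.
Proof.
move=> /rho_facts[r0 r2 rJ] /unitcJ[l0 lJ].
rewrite /jform /Pmx -scalemxAl ![(_ *: (_ *m _)) _ _]mxE.
have [-> ->] := mx2_mulv (- conjc a) l^-1 l (- a) U.
rewrite !normCK !conjE rJ lJ.
have e : a * a^* = 1 - rho a ^+ 2 by rewrite r2; ring.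
by move: (rho a) r0 e {r2 rJ} => r r0 e; field: e; rewrite ?r0 ?l0.
Qed.

(** The two terms are |U_1 / z|^2 and |(Q U)_1 / z|^2. Dividing the second coordinates of U and of Q
    U by z turns Q(z) into Q(1), which reverses [.]; this sum is what remains. *)
Definition qdefect a l z U : C :=
  `|z^-1 * U 1 0| ^+ 2 +
  `|(rho a)^-1 * (l^-1 * U 0 0 - a^* * z^-1 * U 1 0)| ^+ 2.

Lemma jform_Q a l z U : `|a| < 1 -> `|l| = 1 -> z != 0 ->
  jform (Qmx a l z *m U) = - jform U + (1 - `|z| ^+ 2) * qdefect a l z U.
Proof.
move=> /rho_facts[r0 r2 rJ] /unitcJ[l0 lJ] z0.
rewrite /jform /qdefect /Qmx -scalemxAl ![(_ *: (_ *m _)) _ _]mxE.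
have [-> ->] := mx2_mulv (- a) (l * z^-1) (l^-1 * z) (- conjc a) U.
rewrite !normCK !conjE rJ lJ.
have e : a * a^* = 1 - rho a ^+ 2 by rewrite r2; ring.
have z1 : z^* != 0 by rewrite conjC_eq0.
move: (rho a) r0 e {r2 rJ} => r r0 e.
by field: e; rewrite ?r0 ?l0 ?z0 ?z1.
Qed.

Lemma qdefect_ge0 a l z U : 0 <= qdefect a l z U.
Proof. by rewrite addr_ge0// exprn_ge0. Qed.

Lemma qdefect_gt0 a l z U : `|a| < 1 -> `|l| = 1 -> z != 0 -> U != 0 ->
  0 < qdefect a l z U.
Proof.
move=> /rho_facts[r0 _ _] /unitcJ[l0 _] z0 U0.
rewrite lt_neqAle qdefect_ge0 andbT eq_sym.
apply: contra U0; rewrite paddr_eq0 ?exprn_ge0// !sqrf_eq0 !normr_eq0.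
rewrite !mulf_eq0 !invr_eq0 (negbTE z0) (negbTE r0) /= => /andP[/eqP h1].
rewrite h1 mulr0 subr0 mulf_eq0 invr_eq0 (negbTE l0) /= => /eqP h0.
by apply/eqP/mx2P => j; rewrite (ord1 j) mxE.
Qed.

Lemma det_P a l : `|a| < 1 -> `|l| = 1 -> \det (Pmx a l) = -1.
Proof.
move=> /rho_facts[r0 r2 rJ] /unitcJ[l0 lJ].
rewrite det2E !mxE /=.
have e : a * a^* = 1 - rho a ^+ 2 by rewrite r2; ring.
by field: e; rewrite ?r0 ?l0.
Qed.

Lemma det_Q a l z : `|a| < 1 -> `|l| = 1 -> z != 0 -> \det (Qmx a l z) = -1.
Proof.
move=> /rho_facts[r0 r2 rJ] /unitcJ[l0 lJ] z0.
rewrite det2E !mxE /=.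
have e : a * a^* = 1 - rho a ^+ 2 by rewrite r2; ring.
by field: e; rewrite ?r0 ?l0.
Qed.

Lemma unit_trace_roots A : \det A = 1 ->
  exists2 w, w != 0 & \tr A = w + w^-1.
Proof.
move=> hd; set t := \tr A.
pose w := (t + sqrtC (t ^+ 2 - 4)) / 2.
have e : w * (t - w) = 1.
  rewrite /w; have := sqrtCK (t ^+ 2 - 4); set s := sqrtC _ => hs.
  by field: hs.
have w0 : w != 0.
  by apply/eqP => h; move/eqP: e; rewrite h mul0r eq_sym oner_eq0.
exists w => //; apply: (mulfI w0).
by rewrite mulrDr divff// -e; ring.
Qed.

Lemma eigvec_exists A w w' : \det A = w * w' -> \tr A = w + w' ->
  exists2 U : 'cV[C]_2, U != 0 & A *m U = w *: U.
Proof.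
move=> hd ht.
have : \det (A - w%:M)^T == 0.
  rewrite det_tr det2E !mxE /= mulr1n !mulr0n !subr0.
  move: hd ht; rewrite det2E tr2E => hd ht.
  apply/eqP; transitivity
    (A 0 0 * A 1 1 - A 0 1 * A 1 0 - w * (A 0 0 + A 1 1) + w * w); first ring.
  by rewrite hd ht; ring.
case/det0P => v v0 hv; exists v^T.
  by apply: contra v0 => /eqP h; rewrite -[v]trmxK h trmx0.
apply/eqP; rewrite -subr_eq0 -mul_scalar_mx -mulmxBl -[_ - _]trmxK -trmx_mul.
by rewrite hv trmx0.
Qed.

Lemma jformZ w U : jform (w *: U) = `|w| ^+ 2 * jform U.
Proof. by rewrite /jform !mxE !normrM !exprMn mulrBr. Qed.

Lemma jform_real U : jform U \is Num.real.
Proof. by rewrite rpredB// rpredX// normr_real. Qed.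

(** These are the matrices that commute with the antilinear map [sigma] below; on the unit circle
    every transfer matrix is one. *)
Definition conjsym A := A 1 1 = (A 0 0)^* /\ A 1 0 = (A 0 1)^*.

Lemma conjsymM A B : conjsym A -> conjsym B -> conjsym (A *m B).
Proof.
move=> [a1 a2] [b1 b2]; split; rewrite !mulmx2E a1 a2 b1 b2 !conjE; ring.
Qed.

Definition adj2 A : 'M[C]_2 := mx2 (A 1 1) (- A 0 1) (- A 1 0) (A 0 0).

Lemma conjsym_adj2 A : conjsym A -> conjsym (adj2 A).
Proof.
move=> [a1 a2]; split; rewrite !mxE /= ?conjN; first by rewrite a1 conjCK.
by rewrite a2 -conjN.
Qed.

Lemma mul_adj2 A : A *m adj2 A = (\det A)%:M.
Proof.
apply: mx2P => j; case: (ord2P j) => ->; rewrite mulmx2E det2E !mxE /= ?mulr1n ?mulr0n; ring.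
Qed.

(** The other eigenvalue being conj w, the spectral projection on [U] is A - conj w divided by w -
    conj w, and it is orthogonal for the indefinite form. Its lower right entry is thus -|U_1|^2 /
    [U]; the statement clears denominators. *)
Lemma conjsym_entry A w U : conjsym A -> \tr A = w + w^* -> A *m U = w *: U ->
  (A 1 1 - w^*) * jform U = - (w - w^*) * `|U 1 0| ^+ 2.
Proof.
move=> [a1 a2] ht hU.
have h0 : (A *m U) 0 0 = w * U 0 0 by rewrite hU mxE.
have h1 : (A *m U) 1 0 = w * U 1 0 by rewrite hU mxE.
move: h0 h1 ht; rewrite !mulmx2E tr2E a1 a2 /jform !normCK.
move: (A 0 0) (A 0 1) (U 0 0) (U 1 0) => a b u v h0 h1 ht.
have hac : a^* = w + w^* - a by rewrite -ht; ring.
have e0 : b * v = (w - a) * u by move/(canRL (addKr _)): h0 => ->; ring.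
have e1 : b * u^* = (w^* - a) * v^*.
  have := congr1 Num.conj h1; rewrite !conjE => /(canRL (addrK _)) ->.
  ring.
have e : (w - a) * u * u^* = (w^* - a) * v^* * v by rewrite -e0 -e1; ring.
apply/eqP; rewrite -subr_eq0 hac; apply/eqP.
by transitivity ((w - a) * u * u^* - (w^* - a) * v^* * v);
  [ring|rewrite e subrr].
Qed.

(** On slopes this is the reflection m -> 1 / conj m in the unit circle. It exchanges the
    eigenspaces of w and conj w and the two signs of [.]. *)
Definition sigma U : 'cV[C]_2 := \col_i (if i == 0 then (U 1 0)^* else (U 0 0)^*).

Lemma conjsym_sigma A w U : conjsym A -> A *m U = w *: U ->
  A *m sigma U = w^* *: sigma U.
Proof.
move=> [a1 a2] hU.
have h0 : (A *m U) 0 0 = w * U 0 0 by rewrite hU mxE.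
have h1 : (A *m U) 1 0 = w * U 1 0 by rewrite hU mxE.
apply: mx2P => j; rewrite (ord1 j) mulmx2E !mxE /= ?a1 ?a2 -conjM.
- by rewrite -h1 mulmx2E a1 a2 !conjE addrC.
- by rewrite -h0 mulmx2E !conjE addrC.
Qed.

Lemma jform_sigma U : jform (sigma U) = - jform U.
Proof. by rewrite /jform !mxE /= !norm_conjC opprB. Qed.

Lemma jform_unit_eig A w U : conjsym A -> \tr A = w + w^* -> w != w^* ->
  A *m U = w *: U -> U != 0 -> jform U != 0.
Proof.
move=> hA ht hw hU; apply: contra => /eqP h.
have /eqP := conjsym_entry hA ht hU.
rewrite h mulr0 eq_sym mulf_eq0 oppr_eq0 subr_eq0 (negbTE hw) /= sqrf_eq0.
rewrite normr_eq0 => /eqP h1.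
move/eqP: h; rewrite /jform h1 normr0 expr0n subr0 sqrf_eq0 normr_eq0 => /eqP h0.
by apply/eqP/mx2P => j; rewrite (ord1 j) mxE.
Qed.

(** Which of the two conjugate eigenvalues is returned is dictated by the sign of [.]: if the first
    eigenvector has [U] < 0, then [sigma U] and the conjugate eigenvalue replace it. *)
Lemma elliptic_eig A : conjsym A -> \det A = 1 -> -2 < \tr A < 2 ->
  exists w, [/\ w^* = w^-1, w != w^*, \tr A = w + w^* &
    exists2 U : 'cV[C]_2, 0 < jform U & A *m U = w *: U].
Proof.
move=> hA hd /andP[h1 h2]; set t := \tr A in h1 h2 *.
have tr : t^* = t.
  by apply: conj_Creal; rewrite (ler_real (ltW h2)) realn.
have h4 : 0 < 4 - t ^+ 2.
  have -> : 4 - t ^+ 2 = (2 - t) * (t - - 2) by ring.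
  by rewrite mulr_gt0 ?subr_gt0.
pose s := sqrtC (4 - t ^+ 2).
have s0 : 0 < s by rewrite sqrtC_gt0.
have sJ : s^* = s by apply: conj_Creal; exact: gtr0_real.
pose w : C := (t + 'i * s) / 2.
have wJ : w^* = (t - 'i * s) / 2.
  by rewrite /w !conjE tr sJ conjCi conj_Creal ?realn// mulNr.
have ht : t = w + w^* by rewrite wJ /w; field.
have e : w * w^* = 1.
  rewrite wJ /w; have := sqrtCK (4 - t ^+ 2); rewrite -/s => hs.
  have hi : ('i : C) ^+ 2 = -1 := sqrCi _.
  by field: hs hi.
have w0 : w != 0.
  by apply/eqP => h; move/eqP: e; rewrite h mul0r eq_sym oner_eq0.
have wne : w != w^*.
  rewrite -subr_eq0 (_ : w - w^* = 'i * s); last by rewrite wJ /w; field.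
  by rewrite mulf_neq0 ?neq0Ci ?gt_eqF.
have [|U U0 hU] := @eigvec_exists A w w^* _ ht; first by rewrite hd e.
have hJ := jform_unit_eig hA ht wne hU U0.
have wV : w^* = w^-1 by apply: (mulfI w0); rewrite e divff.
have := jform_real U; rewrite realE !le_eqVlt (eq_sym 0) (negbTE hJ) /=.
case/orP => hU0.
- by exists w; split => //; exists U.
- exists w^*; split => //; rewrite ?conjCK ?wV ?invrK// -?wV.
  + by rewrite eq_sym.
  + by rewrite addrC.
  + by exists (sigma U); [rewrite jform_sigma oppr_gt0|exact: conjsym_sigma].
Qed.

End TransferMatrices.

(** * Monodromy matrices and the sign of their eigenvectors *)

Section Monodromy.
Variable R : realType.
Local Notation C := R[i].
Implicit Types (a l z w : C) (alpha lambda : nat -> C) (U V : 'cV[C]_2)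
  (A B : 'M[C]_2).

(* With q0(x) = b x^2 + (a - d) x - c vanishing at the eigendirections (1, x)
   of A0, one has (1 - |m0|^2) q0(x) = (x - m0) (w - w^* ) (1 - m0^* x). *)
Lemma eigendirection_stable A0 A w v m0 m :
  conjsym A0 -> \tr A0 = w + w^* ->
  A0 0 0 + A0 0 1 * m0 = w -> A0 1 0 + A0 1 1 * m0 = w * m0 -> `|m0| < 1 ->
  A 0 0 + A 0 1 * m = v -> A 1 0 + A 1 1 * m = v * m -> `|m| <= 1 ->
  `|m - m0| * `|w - w^*| <=
    2 * (`|A 0 0 - A0 0 0| + `|A 0 1 - A0 0 1| + `|A 1 0 - A0 1 0| +
         `|A 1 1 - A0 1 1|).
Proof.
move=> [a1 a2] ht h0 h1 hm0 g0 g1 hm; set E := _ + _ + _ + _.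
move: ht h0 h1; rewrite tr2E a1 a2 => ht h0 h1.
pose f := A0 0 1 * m ^+ 2 + (A0 0 0 - (A0 0 0)^*) * m - (A0 0 1)^*.
have hb : A0 0 1 * (1 - m0 * m0^*) = - (w - w^*) * m0^*.
  have := congr1 Num.conj h1; rewrite !conjE => h1c.
  transitivity (A0 0 1 + A0 0 0 * m0^* - (A0 0 0 + A0 0 1 * m0) * m0^*).
    by ring.
  by rewrite h1c h0; ring.
have hf : f * (1 - m0 * m0^*) = (m - m0) * (w - w^*) * (1 - m0^* * m).
  have e : f = (m - m0) * (A0 0 1 * (m - m0) + (w - w^*)).
    have ea : (A0 0 0)^* = w + w^* - A0 0 0 by rewrite -ht; ring.
    have ec : (A0 0 1)^* = w * m0 - (A0 0 0)^* * m0 by rewrite -h1; ring.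
    by rewrite /f ec ea -h0; ring.
  rewrite e; transitivity ((m - m0) * (A0 0 1 * (1 - m0 * m0^*) * (m - m0) +
    (w - w^*) * (1 - m0 * m0^*))); first by ring.
  by rewrite hb; ring.
(* Since [m] is an exact root of the quadratic of [A], the value at [m] of the quadratic of [A0]
   involves only differences of entries. *)
have hE : `|f| <= E.
  have -> : f = - (A 0 1 - A0 0 1) * m ^+ 2 - (A 0 0 - A0 0 0) * m
      + (A 1 1 - A0 1 1) * m + (A 1 0 - A0 1 0).
    rewrite a1 a2 /f.
    have -> : A 1 0 = v * m - A 1 1 * m by rewrite -g1; ring.
    by rewrite -g0; ring.
  have hle (x y : C) : `|y| <= 1 -> `|x * y| <= `|x|.
    by move=> hy; rewrite normrM ler_piMr.
  have hm2 : `|m ^+ 2| <= 1 by rewrite normrX exprn_ile1.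
  rewrite /E addrAC (addrC `|A 0 0 - _|).
  do ![apply: le_trans (ler_normD _ _) _; apply: lerD => //];
  rewrite ?mulNr ?normrN; exact: hle.
(* The factor |1 - conj m0 * m| is at least 1 - |m0|, which cancels against 1 - |m0|^2; the
   remaining 1 + |m0| is the source of the constant 2. *)
have p0 : 0 < 1 - `|m0| by rewrite subr_gt0.
have : `|f| * (1 - `|m0| ^+ 2) = `|m - m0| * `|w - w^*| * `|1 - m0^* * m|.
  rewrite -!normrM -hf normrM -normCK; congr (_ * _).
  by rewrite ger0_norm// subr_ge0 expr_le1// ltW.
have -> : 1 - `|m0| ^+ 2 = (1 + `|m0|) * (1 - `|m0|) by ring.
have hd : 1 - `|m0| <= `|1 - m0^* * m|.
  apply: le_trans (lerB_normD _ _); rewrite normr1 normrN normrM norm_conjC.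
  by rewrite lerD2l lerN2 ler_piMr.
move=> e; rewrite -(ler_pM2r p0).
apply: (@le_trans _ _ (`|m - m0| * `|w - w^*| * `|1 - m0^* * m|)).
  by rewrite ler_wpM2l// mulr_ge0.
rewrite -e mulrA (ler_pM2r p0) mulrC ler_pM// ?addr_ge0//.
by rewrite -[2]/(1 + 1) lerD2l ltW.
Qed.

Section Coefficients.
Variables alpha lambda : nat -> C.
Hypothesis Ha : forall n, `|alpha n| < 1.
Hypothesis Hl : forall n, `|lambda n| = 1.
Local Notation Z := (Zmx alpha lambda).

(** In each pair of a Q step and a P step the two sign changes cancel and the defect of the Q step
    remains; [S] adds these defects. The very first one is already positive, because it is taken at
    U itself. *)
Lemma jform_Z2 k z U : z != 0 -> exists S, [/\ 0 <= S,
  (0 < k)%N -> U != 0 -> 0 < S &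
  jform (Z k.*2 z *m U) = jform U - (1 - `|z| ^+ 2) * S].
Proof.
move=> z0; elim: k => [|k [S [S0 Sp e]]].
  by exists 0; split=> //; rewrite mulr0 subr0 mul1mx.
exists (S + qdefect (alpha k.*2) (lambda k.*2) z (Z k.*2 z *m U)); split.
- by rewrite addr_ge0// qdefect_ge0.
- move=> _ U0; case: k S0 Sp e => [|k] S0 Sp _.
    by rewrite ltr_wpDl// mul1mx qdefect_gt0.
  by rewrite ltr_wpDr ?qdefect_ge0 ?Sp.
- rewrite doubleS /= /Ymx /= odd_double /= -!mulmxA.
  by rewrite jform_P// jform_Q// e; ring.
Qed.

Lemma jform_Z_unit n z U : `|z| = 1 -> jform (Z n z *m U) = (-1) ^+ n * jform U.
Proof.
move=> hz; have [z0 _] := unitcJ hz.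
elim: n => [|n IH]; first by rewrite expr0 mul1r mul1mx.
rewrite /= -mulmxA exprS -mulrA -IH mulN1r /Ymx; case: ifP => _.
- by rewrite jform_P.
- by rewrite jform_Q// hz expr1n subrr mul0r addr0.
Qed.

Lemma det_Z n z : z != 0 -> \det (Z n z) = (-1) ^+ n.
Proof.
move=> z0; elim: n => [|n IH] /=; first by rewrite det1.
rewrite det_mulmx IH exprS /Ymx; case: ifP => _; rewrite ?det_P// ?det_Q//.
Qed.

Lemma conjsym_Z n z : `|z| = 1 -> conjsym (Z n z).
Proof.
move=> /unitcJ[z0 zJ]; elim: n => [|n IH] /=.
  by split; rewrite !mxE /= ?mulr1n ?mulr0n ?rmorph1 ?rmorph0.
apply: conjsymM IH; have [r0 _ rJ] := rho_facts (Ha n).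
have [l0 lJ] := unitcJ (Hl n).
rewrite /Ymx; case: ifP => _; split; rewrite !mxE /= !conjE rJ ?lJ ?zJ ?invrK//.
Qed.

(** The parity of the site decides between P and Q, so only even shifts are compatible with the
    transfer matrices. *)
Lemma Zmx_shift n m z : ~~ odd n ->
  Zmx (shift n alpha) (shift n lambda) m z *m Z n z = Z (n + m) z.
Proof.
move=> hn; elim: m => [|m IH]; first by rewrite mul1mx addn0.
rewrite addnS /= -mulmxA IH; congr (_ *m _).
by rewrite /Ymx oddD (negbTE hn).
Qed.

(** This one identity both forbids |w| = 1 off the circle and fixes the sign of [U]. *)
Lemma Z_eig_jform h z w U : (0 < h)%N -> z != 0 -> U != 0 ->
  Z h.*2 z *m U = w *: U ->
  exists2 S, 0 < S & (1 - `|w| ^+ 2) * jform U = (1 - `|z| ^+ 2) * S.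
Proof.
move=> h0 z0 U0 hU; have [S [_ Sp]] := jform_Z2 h U z0.
rewrite hU jformZ => e; exists S; first exact: Sp.
by rewrite mulrBl mul1r e; ring.
Qed.

Lemma Z_eig_norm h z w U : (0 < h)%N -> z != 0 -> `|z| != 1 -> U != 0 ->
  Z h.*2 z *m U = w *: U -> `|w| != 1.
Proof.
move=> h0 z0 z1 U0 /(Z_eig_jform h0 z0 U0)[S S0]; apply: contra_eqN => /eqP ->.
rewrite expr1n subrr mul0r eq_sym mulf_neq0//; last by rewrite gt_eqF.
by rewrite subr_eq0 eq_sym sqrp_eq1.
Qed.

Lemma monodromy_eigenvalues h z : (0 < h)%N -> z != 0 -> `|z| != 1 ->
  exists2 w, 1 < `|w| & \tr (Z h.*2 z) = w + w^-1.
Proof.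
move=> h0 z0 z1; have hd : \det (Z h.*2 z) = 1.
  by rewrite det_Z// -signr_odd odd_double.
have [w w0 ht] := unit_trace_roots hd.
have [|U U0 hU] := @eigvec_exists _ (Z h.*2 z) w w^-1 _ ht.
  by rewrite hd divff.
have w1 := Z_eig_norm h0 z0 z1 U0 hU.
have : `|w| \is Num.real by exact: normr_real.
move=> /(real_ltgtP (real1 _)) [] hw; last by rewrite hw eqxx in w1.
- by exists w.
- exists w^-1; last by rewrite invrK addrC.
  by rewrite normfV invf_gt1// normr_gt0.
Qed.

(** Both factors 1 - |w|^2 and 1 - |z|^2 change sign together when the contracting eigenvector
    inside is traded for the expanding one outside; this selects the same direction on the two sides
    of the circle. *)
Lemma eig_jform_gt0 h z w U : (0 < h)%N -> z != 0 -> U != 0 ->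
  Z h.*2 z *m U = w *: U ->
  (`|z| < 1 /\ `|w| < 1) \/ (1 < `|z| /\ 1 < `|w|) -> 0 < jform U.
Proof.
move=> h0 z0 U0 /(Z_eig_jform h0 z0 U0)[S S0 e] [[hz hw]|[hz hw]].
- have hw' : 0 < 1 - `|w| ^+ 2 by rewrite subr_gt0 expr_lt1.
  by rewrite -(pmulr_rgt0 _ hw') e mulr_gt0// subr_gt0 expr_lt1.
- have hw' : 1 - `|w| ^+ 2 < 0 by rewrite subr_lt0 expr_gt1.
  by rewrite -(nmulr_rlt0 _ hw') e nmulr_rlt0// subr_lt0 expr_gt1.
Qed.

End Coefficients.

Lemma jform_gt0_slope A w U : 0 < jform U -> A *m U = w *: U ->
  let m := U 1 0 / U 0 0 in
  [/\ U 0 0 != 0, `|m| < 1, A 0 0 + A 0 1 * m = w & A 1 0 + A 1 1 * m = w * m].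
Proof.
move=> hU e; have hlt : `|U 1 0| < `|U 0 0|.
  by move: hU; rewrite /jform subr_gt0 ltr_pXn2r// nnegrE.
have u0 : U 0 0 != 0 by rewrite -normr_gt0 (le_lt_trans _ hlt).
have h0 : (A *m U) 0 0 = w * U 0 0 by rewrite e mxE.
have h1 : (A *m U) 1 0 = w * U 1 0 by rewrite e mxE.
move: h0 h1; rewrite !mulmx2E => h0 h1; split=> //.
- by rewrite normf_div ltr_pdivrMr ?normr_gt0// mul1r.
- by apply: (mulIf u0); rewrite -h0; field.
- by apply: (mulIf u0); rewrite -mulrA divfK// -h1; field.
Qed.

End Monodromy.

(** * Limits of complex numbers and of matrices with two rows *)

Section ComplexTopology.
Variable R : realType.
Local Notation C := R[i].
Local Notation "x %:C" := (real_complex R x).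

Lemma normC_normc (x : C) : `|x| = (normc x)%:C.
Proof. by rewrite normc_def; case: x. Qed.

Lemma normc_ge0 (x : C) : 0 <= normc x.
Proof. by rewrite -ler0c -normC_normc. Qed.

Lemma normc_Re (x : C) : `|complex.Re x| <= normc x.
Proof. by rewrite -lecR -normC_normc normc_ge_Re. Qed.

Lemma normc_Im (x : C) : `|complex.Im x| <= normc x.
Proof.
have := normc_Re (x * 'i%C); rewrite ReiNIm normrN normcM.
by rewrite (_ : normc 'i%C = 1) ?mulr1//= expr0n add0r expr1n sqrtr1.
Qed.

Lemma normc_le_ReIm (x : C) : normc x <= `|complex.Re x| + `|complex.Im x|.
Proof.
case: x => a b /=; rewrite -(@ler_pXn2r _ 2)// ?nnegrE ?sqrtr_ge0 ?addr_ge0//.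
rewrite sqr_sqrtr ?addr_ge0 ?sqr_ge0// -(real_normK (num_real a)).
by rewrite -(real_normK (num_real b)) sqrrD; have := mulr_ge0 (normr_ge0 a) (normr_ge0 b); lra.
Qed.

(** The norm of [C] takes values in [C], so the radii of its balls are positive complex numbers;
    being real, they can be replaced by elements of [R]. *)
Lemma cvgcP {T : Type} {F : set_system T} {FF : Filter F} (f : T -> C^o) (l : C) :
  f @ F --> (l : C^o) <->
  forall e : R, 0 < e -> \forall x \near F, normc (f x - l) < e.
Proof.
split=> [/cvgrPdist_lt h e e0|h].
  have e0' : 0 < (e%:C : C) by rewrite ltcR.
  near=> x; rewrite -ltcR -normC_normc distrC.
  by near: x; exact: h.
apply/cvgrPdist_lt => e e0.
have ee : e = (complex.Re e)%:C by rewrite RRe_real// gtr0_real.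
have e1 : 0 < complex.Re e by rewrite -ltcR -ee.
near=> x; rewrite distrC normC_normc ee ltcR.
by near: x; exact: h.
Unshelve. all: by end_near.
Qed.

Lemma cvg_Re {T : Type} {F : set_system T} {FF : Filter F} (f : T -> C^o) (l : C) :
  f @ F --> (l : C^o) -> complex.Re (f x) @[x --> F] --> complex.Re l.
Proof.
move=> /cvgcP h; apply/cvgrPdist_lt => e e0; near=> x.
rewrite distrC -raddfB; apply: le_lt_trans (normc_Re _) _.
by near: x; exact: h.
Unshelve. all: by end_near.
Qed.

Lemma cvg_Im {T : Type} {F : set_system T} {FF : Filter F} (f : T -> C^o) (l : C) :
  f @ F --> (l : C^o) -> complex.Im (f x) @[x --> F] --> complex.Im l.
Proof.
move=> /cvgcP h; apply/cvgrPdist_lt => e e0; near=> x.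
rewrite distrC -raddfB; apply: le_lt_trans (normc_Im _) _.
by near: x; exact: h.
Unshelve. all: by end_near.
Qed.

Lemma cvg_ReIm {T : Type} {F : set_system T} {FF : Filter F} (f : T -> C^o) (l : C) :
  complex.Re (f x) @[x --> F] --> complex.Re l ->
  complex.Im (f x) @[x --> F] --> complex.Im l -> f @ F --> (l : C^o).
Proof.
move=> /cvgrPdist_lt hr /cvgrPdist_lt hi; apply/cvgcP => e e0.
have e2 : 0 < e / 2 by rewrite divr_gt0.
near=> x; apply: le_lt_trans (normc_le_ReIm _) _.
rewrite (splitr e) !raddfB/= ltrD// distrC; near: x; [exact: hr|exact: hi].
Unshelve. all: by end_near.
Qed.

Lemma normc_cis (t : R) : normc (cis t) = 1.
Proof. by rewrite /cis /= cos2Dsin2 sqrtr1. Qed.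

Lemma norm_cis (t : R) : `|cis t| = 1.
Proof. by rewrite normC_normc normc_cis. Qed.

Lemma cis_neq0 (t : R) : cis t != 0.
Proof. by have [] := unitcJ (norm_cis t). Qed.

Lemma cvg_cis {T : Type} {F : set_system T} {FF : Filter F} (f : T -> R) (l : R) :
  f @ F --> l -> cis (f x) @[x --> F] --> (cis l : C^o).
Proof.
move=> h; apply: cvg_ReIm => /=.
- by apply: continuous_cvg => //; exact: continuous_cos.
- by apply: continuous_cvg => //; exact: continuous_sin.
Qed.

Lemma cvg_realC {T : Type} {F : set_system T} {FF : Filter F} (f : T -> R) (l : R) :
  f @ F --> l -> (f x)%:C @[x --> F] --> (l%:C : C^o).
Proof. by move=> h; apply: cvg_ReIm => //=; exact: cvg_cst. Qed.

Lemma cvgC_cst {T : Type} {F : set_system T} {FF : Filter F} (c : C) :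
  (fun=> c : C^o) @ F --> (c : C^o).
Proof. exact: cvg_cst. Qed.

Lemma cvgC_D {T : Type} {F : set_system T} {FF : Filter F} (f g : T -> C^o) (a b : C) :
  f @ F --> (a : C^o) -> g @ F --> (b : C^o) ->
  f x + g x @[x --> F] --> (a + b : C^o).
Proof. by move=> h1 h2; exact: (@cvgD C C^o _ F _ _ _ _ _ h1 h2). Qed.

Lemma cvgC_N {T : Type} {F : set_system T} {FF : Filter F} (f : T -> C^o) (a : C) :
  f @ F --> (a : C^o) -> - f x @[x --> F] --> (- a : C^o).
Proof. by move=> h1; exact: (@cvgN C C^o _ F _ _ _ h1). Qed.

Lemma cvgC_M {T : Type} {F : set_system T} {FF : Filter F} (f g : T -> C^o) (a b : C) :
  f @ F --> (a : C^o) -> g @ F --> (b : C^o) ->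
  f x * g x @[x --> F] --> (a * b : C^o).
Proof. by move=> h1 h2; exact: (cvgM h1 h2). Qed.

Lemma cvgC_V {T : Type} {F : set_system T} {FF : Filter F} (f : T -> C^o) (a : C) :
  a != 0 -> f @ F --> (a : C^o) -> (f x)^-1 @[x --> F] --> (a^-1 : C^o).
Proof. by move=> a0 h; exact: (cvgV a0 h). Qed.

Lemma cvgC_X {T : Type} {F : set_system T} {FF : Filter F} (f : T -> C^o) (l : C) n :
  f @ F --> (l : C^o) -> f x ^+ n @[x --> F] --> (l ^+ n : C^o).
Proof.
move=> h; elim: n => [|n IH]; first exact: cvg_cst.
rewrite exprS (_ : (fun x => _) = fun x => f x * f x ^+ n).
  exact: (cvgC_M h IH).
by apply/funext => x; rewrite exprS.
Qed.

Lemma cvgC_shift (u : nat -> C^o) (l : C) :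
  (u n.+1 @[n --> \oo] --> (l : C^o)) <-> (u n @[n --> \oo] --> (l : C^o)).
Proof. by rewrite -(cvg_shiftS u). Qed.

Lemma expr_cvg0 (r : R) : 0 <= r < 1 -> r ^+ n @[n --> \oo] --> 0.
Proof. by move=> /andP[r0 r1]; apply: cvg_expr; rewrite ger0_norm. Qed.

Definition mxcvg {T : Type} (F : set_system T) n (f : T -> 'M[C]_(2, n))
    (B : 'M[C]_(2, n)) :=
  forall i j, f x i j @[x --> F] --> (B i j : C^o).

Section MatrixFilter.
Context {T : Type} {F : set_system T} {FF : Filter F}.

Lemma mxcvg_cst n (B : 'M[C]_(2, n)) : mxcvg F (fun=> B) B.
Proof. by move=> i j; exact: cvgC_cst. Qed.

Lemma mxcvgM n (f : T -> 'M[C]_2) (g : T -> 'M[C]_(2, n)) B D :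
  mxcvg F f B -> mxcvg F g D -> mxcvg F (fun x => f x *m g x) (B *m D).
Proof.
move=> hf hg i j; rewrite mulmx2E.
have -> : (fun x => (f x *m g x) i j) =
    fun x => f x i 0 * g x 0 j + f x i 1 * g x 1 j.
  by apply/funext => x; rewrite mulmx2E.
by apply: cvgC_D; apply: cvgC_M; [exact: hf|exact: hg|exact: hf|exact: hg].
Qed.

Lemma mxcvgD n (f g : T -> 'M[C]_(2, n)) B D :
  mxcvg F f B -> mxcvg F g D -> mxcvg F (fun x => f x + g x) (B + D).
Proof.
move=> hf hg i j; rewrite mxE.
have -> : (fun x => (f x + g x) i j) = fun x => f x i j + g x i j.
  by apply/funext => x; rewrite !mxE.
by apply: cvgC_D; [exact: hf|exact: hg].
Qed.

Lemma mxcvgB n (f g : T -> 'M[C]_(2, n)) B D :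
  mxcvg F f B -> mxcvg F g D -> mxcvg F (fun x => f x - g x) (B - D).
Proof.
move=> hf hg; apply: mxcvgD; first exact: hf.
move=> i j; rewrite mxE (_ : (fun x => _) = fun x => - g x i j).
  by apply: cvgC_N; exact: hg.
by apply/funext => x; rewrite mxE.
Qed.

End MatrixFilter.

End ComplexTopology.

(** * The Schur function inside the disk *)

Section CMVOperator.
Variable R : realType.
Local Notation C := R[i].
Local Notation "x %:C" := (real_complex R x).
Implicit Types (alpha lambda u : nat -> C).

Lemma Lmx_block alpha lambda j (a b : 'I_2) :
  Lmx alpha lambda (2 * j + a) (2 * j + b) =
  Theta (alpha (2 * j)%N) (lambda (2 * j)%N) a b.
Proof.
rewrite /Lmx; have h (c : 'I_2) : ((2 * j + c) %/ 2 = j)%N.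
  by case: (ord2P c) => -> /=; lia.
have h' (c : 'I_2) : inord ((2 * j + c) %% 2) = c.
  by case: (ord2P c) => ->; apply: val_inj; rewrite /= inordK; lia.
by rewrite !h eqxx !h'.
Qed.

Lemma Lmx_off alpha lambda i j : (i %/ 2 != j %/ 2)%N -> Lmx alpha lambda i j = 0.
Proof. by rewrite /Lmx => /negbTE ->. Qed.

Lemma Mmx_succ alpha lambda i j :
  Mmx alpha lambda i.+1 j.+1 = Lmx (shift 1 alpha) (shift 1 lambda) i j.
Proof. by []. Qed.

Lemma apply_adjL_even alpha lambda u j (k := (2 * j)%N) :
  `|alpha k| < 1 ->
  apply_mx (conj_trmx (Lmx alpha lambda)) u k =
  (lambda k)^* * (alpha k * u k + rho (alpha k) * u k.+1).
Proof.
move=> /rho_facts[_ _ rJ]; rewrite /apply_mx !big_ord_recr /= big1 => [|i _].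
  have := Lmx_block alpha lambda j 0 0; have := Lmx_block alpha lambda j 1 0.
  rewrite /= addn0 addn1 -/k /conj_trmx => -> ->.
  by rewrite !mxE /= !conjE rJ; ring.
rewrite /conj_trmx Lmx_off ?conjcC ?rmorph0 ?mul0r//.
by have := ltn_ord i; rewrite /k => ?; apply/eqP; lia.
Qed.

Lemma apply_adjL_odd alpha lambda u j (k := (2 * j)%N) :
  `|alpha k| < 1 ->
  apply_mx (conj_trmx (Lmx alpha lambda)) u k.+1 =
  (lambda k)^* * (rho (alpha k) * u k - (alpha k)^* * u k.+1).
Proof.
move=> /rho_facts[_ _ rJ]; rewrite /apply_mx !big_ord_recr /= big1 => [|i _].
  have := Lmx_block alpha lambda j 0 1; have := Lmx_block alpha lambda j 1 1.
  rewrite /= addn0 addn1 -/k /conj_trmx => -> ->.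
  rewrite Lmx_off; last by rewrite /k; apply/eqP; lia.
  rewrite conjcC rmorph0 mul0r addr0.
  by rewrite !mxE /= !conjE rJ; ring.
rewrite /conj_trmx Lmx_off ?conjcC ?rmorph0 ?mul0r//.
by have := ltn_ord i; rewrite /k => ?; apply/eqP; lia.
Qed.

Lemma apply_adjM_0 alpha lambda u :
  apply_mx (conj_trmx (Mmx alpha lambda)) u 0 = u 0%N.
Proof.
transitivity (0 + (1 : C)^* * u 0%N + (0 : C)^* * u 1%N).
  by rewrite /apply_mx !big_ord_recr big_ord0.
by rewrite rmorph1 rmorph0 mul1r mul0r addr0 add0r.
Qed.

Lemma apply_adjM_succ alpha lambda u i :
  apply_mx (conj_trmx (Mmx alpha lambda)) u i.+1 =
  apply_mx (conj_trmx (Lmx (shift 1 alpha) (shift 1 lambda))) (shift 1 u) i.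
Proof.
rewrite /apply_mx big_ord_recl.
transitivity ((0 : C)^* * u 0%N +
  apply_mx (conj_trmx (Lmx (shift 1 alpha) (shift 1 lambda))) (shift 1 u) i).
  by congr (_ + _).
by rewrite rmorph0 mul0r add0r.
Qed.

(** Membership in the unit ball of l^2, phrased by partial sums so that no sequence space is
    required. *)
Definition contractive u := forall n, \sum_(i < n) `|u i| ^+ 2 <= 1.

Lemma theta_isometry a l (x y : C) : `|a| < 1 -> `|l| = 1 ->
  `|l^* * (a * x + rho a * y)| ^+ 2 + `|l^* * (rho a * x - a^* * y)| ^+ 2 =
  `|x| ^+ 2 + `|y| ^+ 2.
Proof.
move=> /rho_facts[r0 r2 rJ] /unitcJ[l0 lJ].
rewrite !normCK !conjE rJ lJ.
have e : a * a^* = 1 - rho a ^+ 2 by rewrite r2; ring.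
by move: (rho a) r0 e {r2 rJ} => r r0 e; field: e.
Qed.

(** An even cutoff does not split a block of L, whence an equality. Other cutoffs are rounded up;
    for M the cutoffs that respect the blocks are the odd ones. *)
Lemma adjL_isometry alpha lambda u n :
  (forall n, `|alpha n| < 1) -> (forall n, `|lambda n| = 1) ->
  \sum_(i < (2 * n)%N) `|apply_mx (conj_trmx (Lmx alpha lambda)) u i| ^+ 2 =
  \sum_(i < (2 * n)%N) `|u i| ^+ 2.
Proof.
move=> Ha Hl; elim: n => [|n IH]; first by rewrite !big_ord0.
rewrite mulnS !big_ord_recr /= IH -!addrA; congr (_ + _).
by rewrite apply_adjL_even// apply_adjL_odd// theta_isometry.
Qed.

Lemma sum_norm_le u m n : (m <= n)%N ->
  \sum_(i < m) `|u i| ^+ 2 <= \sum_(i < n) `|u i| ^+ 2.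
Proof.
move=> /subnKC <-; elim: (n - m)%N => [|k IH]; first by rewrite addn0.
by rewrite addnS big_ord_recr /= (le_trans IH)// lerDl exprn_ge0.
Qed.

Lemma contractive_adjL alpha lambda u :
  (forall n, `|alpha n| < 1) -> (forall n, `|lambda n| = 1) ->
  contractive u -> contractive (apply_mx (conj_trmx (Lmx alpha lambda)) u).
Proof.
move=> Ha Hl hu n; have /le_trans := @sum_norm_le
  (apply_mx (conj_trmx (Lmx alpha lambda)) u) n (2 * n) ltac:(lia).
by apply; rewrite adjL_isometry.
Qed.

Lemma contractive_adjM alpha lambda u :
  (forall n, `|alpha n| < 1) -> (forall n, `|lambda n| = 1) ->
  contractive u -> contractive (apply_mx (conj_trmx (Mmx alpha lambda)) u).
Proof.
move=> Ha Hl hu n; have /le_trans := @sum_norm_le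
  (apply_mx (conj_trmx (Mmx alpha lambda)) u) n (2 * n).+1 ltac:(lia).
apply; rewrite big_ord_recl apply_adjM_0; under eq_bigr do rewrite apply_adjM_succ.
rewrite adjL_isometry => [|k|k]; rewrite /shift//.
by have := hu (2 * n).+1; rewrite big_ord_recl.
Qed.

Lemma contractive_le u i : contractive u -> `|u i| <= 1.
Proof.
move=> hu; rewrite -(@expr_le1 _ 2)//; apply: le_trans (hu i.+1).
by rewrite big_ord_recr /= lerDr sumr_ge0// => j _; rewrite exprn_ge0.
Qed.

Lemma contractive_delta0 : contractive (delta R 0).
Proof.
move=> n; apply: (@le_trans _ _ (\sum_(i < n.+1) `|delta R 0 i| ^+ 2)).
  exact: sum_norm_le.
rewrite big_ord_recl big1 => [|i _]; last by rewrite /delta /= normr0 expr0n.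
by rewrite /delta /= normr1 expr1n addr0.
Qed.

Section Schur.
Variables alpha lambda : nat -> C.
Hypothesis Ha : forall n, `|alpha n| < 1.
Hypothesis Hl : forall n, `|lambda n| = 1.
Local Notation Z := (Zmx alpha lambda).

(** Negative powers occur because e^(it) / (e^(it) - z) expands for |z| < 1 in powers of z e^(-it).
    With v k = L^* w k, the next vector is w (k+1) = M^* v k, so each half step is block
    diagonal. *)
Definition backward_orbit k := iter k (cmv_inv alpha lambda) (delta R 0).
Local Notation w := backward_orbit.
Definition backward_orbit_half k :=
  apply_mx (conj_trmx (Lmx alpha lambda)) (backward_orbit k).
Local Notation v := backward_orbit_half.

Lemma contractive_backward_orbit k : contractive (w k).
Proof.
elim: k => [|k IH]; first exact: contractive_delta0.
by apply: contractive_adjM => //; exact: contractive_adjL.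
Qed.

Lemma contractive_backward_orbit_half k : contractive (v k).
Proof. by apply: contractive_adjL => //; exact: contractive_backward_orbit. Qed.

(** A block gives the outputs (p, r) in terms of the inputs (x, y). Solving instead for the
    right-hand data (y, r) in terms of the left-hand data (x, p) produces the transfer matrix. *)
Lemma theta_transfer a l (x y p r : C) : `|a| < 1 -> `|l| = 1 ->
  p = l^* * (a * x + rho a * y) -> r = l^* * (rho a * x - a^* * y) ->
  y = (rho a)^-1 * (- a * x + l * p) /\ r = (rho a)^-1 * (l^-1 * x - a^* * p).
Proof.
move=> /rho_facts[r0 r2 rJ] /unitcJ[l0 lJ] -> ->; rewrite lJ.
have e : a * a^* = 1 - rho a ^+ 2 by rewrite r2; ring.
move: (rho a) r0 e {r2 rJ} => t t0 e.
by split; field: e; rewrite ?t0 ?l0.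
Qed.

Lemma orbit_Q k j (n := (2 * j)%N) (a := alpha n) (l := lambda n) :
  w k n.+1 = (rho a)^-1 * (- a * w k n + l * v k n) /\
  v k n.+1 = (rho a)^-1 * (l^-1 * w k n - a^* * v k n).
Proof.
apply: theta_transfer; [exact: Ha|exact: Hl| |].
- by rewrite /v apply_adjL_even.
- by rewrite /v apply_adjL_odd.
Qed.

Lemma orbit_P k j (n := (2 * j).+1) (a := alpha n) (l := lambda n) :
  w k.+1 n.+1 = (rho a)^-1 * (- a^* * w k.+1 n + l^-1 * v k n) /\
  v k n.+1 = (rho a)^-1 * (l * w k.+1 n - a * v k n).
Proof.
have e1 : w k.+1 n = l^* * (a * v k n + rho a * v k n.+1).
  by rewrite /w iterS /cmv_inv /n apply_adjM_succ apply_adjL_even //; exact: Ha.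
have e2 : w k.+1 n.+1 = l^* * (rho a * v k n - a^* * v k n.+1).
  by rewrite /w iterS /cmv_inv /n apply_adjM_succ apply_adjL_odd //; exact: Ha.
have [-> ->] := theta_transfer (Ha n) (Hl n) e1 e2.
by split; rewrite -/a -/l; ring.
Qed.

Lemma orbit_0 k : w k.+1 0%N = v k 0%N.
Proof. by rewrite /w iterS /cmv_inv apply_adjM_0. Qed.

Variable z : C.

(** Partial sums of u = (1 - z C^(-1))^(-1) delta_0 and of z L^* u. The extra factor z in the second
    confines the spectral parameter to the even steps, as in [Ymx]. *)
Definition resolvent N i := \sum_(k < N) z ^+ k * w k i.
Definition resolvent_half N i := z * \sum_(k < N) z ^+ k * v k i.

Lemma resolvent_Q N j (n := (2 * j)%N) (a := alpha n) (l := lambda n) : z != 0 ->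
  resolvent N n.+1 =
    (rho a)^-1 * (- a * resolvent N n + l * z^-1 * resolvent_half N n) /\
  resolvent_half N n.+1 =
    (rho a)^-1 * (l^-1 * z * resolvent N n - a^* * resolvent_half N n).
Proof.
move=> z0; rewrite /resolvent /resolvent_half; split.
- rewrite mulrA divfK// !mulr_sumr -big_split mulr_sumr /=; apply: eq_bigr => k _.
  by have [-> _] := orbit_Q k j; rewrite -/n -/a -/l; ring.
- rewrite mulrA !mulr_sumr -sumrB mulr_sumr /=; apply: eq_bigr => k _.
  by have [_ ->] := orbit_Q k j; rewrite -/n -/a -/l; ring.
Qed.

Lemma resolvent_succ N i :
  resolvent N.+1 i = (i == 0%N)%:R + z * \sum_(k < N) z ^+ k * w k.+1 i.
Proof.
rewrite /resolvent big_ord_recl expr0 mul1r mulr_sumr; congr (_ + _).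
by apply: eq_bigr => k _; rewrite exprS mulrA.
Qed.

(** The offset between [N.+1] and [N] reflects w (k+1) = M^* v k. The term k = 0 of the longer sum
    is delta_0, which vanishes at the sites in question. *)
Lemma resolvent_P N j (n := (2 * j).+1) (a := alpha n) (l := lambda n) :
  resolvent N.+1 n.+1 =
    (rho a)^-1 * (- a^* * resolvent N.+1 n + l^-1 * resolvent_half N n) /\
  resolvent_half N n.+1 =
    (rho a)^-1 * (l * resolvent N.+1 n - a * resolvent_half N n).
Proof.
rewrite !resolvent_succ !add0r /resolvent_half; split.
- rewrite !mulr_sumr -big_split mulr_sumr /=; apply: eq_bigr => k _.
  have [e _] := orbit_P k j.
  change (cmv_inv alpha lambda (w k)) with (w k.+1); rewrite e -/n -/a -/l; ring.
- rewrite !mulr_sumr -sumrB mulr_sumr /=; apply: eq_bigr => k _.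
  have [_ e] := orbit_P k j.
  change (cmv_inv alpha lambda (w k)) with (w k.+1); rewrite e -/n -/a -/l; ring.
Qed.

Lemma resolvent_0 N : resolvent_half N 0 = resolvent N.+1 0 - 1.
Proof.
rewrite resolvent_succ addrAC subrr add0r /resolvent_half; congr (_ * _).
by apply: eq_bigr => k _; congr (_ * _); rewrite -orbit_0.
Qed.

End Schur.
End CMVOperator.

(** * Complex integrals against a probability measure on the circle *)

Section CircleIntegral.
Variable R : realType.
Local Notation C := R[i].
Local Notation "x %:C" := (real_complex R x).
Variable m : probability (measurableTypeR R) R.
Hypothesis Hm : on_circle m.

Definition bounded_continuous (f : R -> C) :=
  continuous (f : R -> C^o) /\ exists B, forall t, normc (f t) <= B.

Lemma measurable_angles : measurable (angles R : set (measurableTypeR R)).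
Proof. exact: measurable_itv. Qed.

Lemma Rintegrable_bounded (f : R -> R) (B : R) :
  continuous f -> (forall t, `|f t| <= B) -> m.-integrable (angles R) (EFin \o f).
Proof.
move=> cf hB; apply: measurable_bounded_integrable.
- exact: measurable_angles.
- by rewrite (le_lt_trans (probability_le1 _ _)) ?ltry//; exact: measurable_angles.
- by apply: measurable_funS (continuous_measurable_fun cf).
- by exists B; split; rewrite ?num_real// => M hM t _; exact: le_trans (hB t) (ltW hM).
Qed.

Lemma integrable_Re f : bounded_continuous f ->
  m.-integrable (angles R) (EFin \o (fun t => complex.Re (f t))).
Proof.
move=> [cf [B hB]]; apply: (@Rintegrable_bounded _ B).
- by move=> t; apply: cvg_Re; exact: cf.
- by move=> t; exact: le_trans (normc_Re _) (hB t).
Qed.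

Lemma integrable_Im f : bounded_continuous f ->
  m.-integrable (angles R) (EFin \o (fun t => complex.Im (f t))).
Proof.
move=> [cf [B hB]]; apply: (@Rintegrable_bounded _ B).
- by move=> t; apply: cvg_Im; exact: cf.
- by move=> t; exact: le_trans (normc_Im _) (hB t).
Qed.

Lemma cintegralB f g : bounded_continuous f -> bounded_continuous g ->
  cintegral m (fun t => f t - g t) = cintegral m f - cintegral m g.
Proof.
move=> hf hg; rewrite /cintegral.
have := RintegralB measurable_angles (integrable_Re hf) (integrable_Re hg).
have := RintegralB measurable_angles (integrable_Im hf) (integrable_Im hg).
under eq_Rintegral do rewrite -raddfB.
by move=> ->; under eq_Rintegral do rewrite -raddfB; move=> ->.
Qed.

Lemma cintegralZ (c : C) f : bounded_continuous f ->
  cintegral m (fun t => c * f t) = c * cintegral m f.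
Proof.
move=> hf; rewrite /cintegral; case: c => a b.
have e1 : Rintegral m (angles R) (fun t => complex.Re ((Complex a b) * f t)) =
  Rintegral m (angles R) (fun t => a * complex.Re (f t) - b * complex.Im (f t)).
  by apply: eq_Rintegral => t _; case: (f t).
have e2 : Rintegral m (angles R) (fun t => complex.Im ((Complex a b) * f t)) =
  Rintegral m (angles R) (fun t => a * complex.Im (f t) + b * complex.Re (f t)).
  by apply: eq_Rintegral => t _; case: (f t).
have iZ (d : R) (g : R -> R) : m.-integrable (angles R) (EFin \o g) ->
    m.-integrable (angles R) (EFin \o (fun t => d * g t)).
  by move=> hg; have := integrableZl measurable_angles d hg.
have hr := integrable_Re hf; have hi := integrable_Im hf.
rewrite e1 e2 RintegralB; [|exact: measurable_angles|exact: iZ|exact: iZ].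
rewrite RintegralD; [|exact: measurable_angles|exact: iZ|exact: iZ].
by rewrite !RintegralZl//; exact: measurable_angles.
Qed.

Lemma cintegral1 : cintegral m (fun=> 1) = 1.
Proof.
rewrite /cintegral /= !Rintegral_cst; [|exact: measurable_angles..].
by rewrite [X in fine X](_ : _ = 1%E) ?mul0r ?mul1r//; exact: Hm.
Qed.

Lemma Rintegral_bound (f : R -> R) (B : R) : continuous f ->
  (forall t, `|f t| <= B) -> `|Rintegral m (angles R) f| <= B.
Proof.
move=> cf hB; have hi := Rintegrable_bounded cf hB.
apply: le_trans (le_normr_Rintegral measurable_angles hi) _.
have -> : B = Rintegral m (angles R) (fun=> B).
  rewrite Rintegral_cst; last exact: measurable_angles.
  by rewrite [X in fine X](_ : _ = 1%E) ?mulr1//; exact: Hm.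
apply: le_Rintegral => //; first exact: measurable_angles.
- by apply: integrable_norm hi.
- apply: (@Rintegrable_bounded _ `|B|) => [t|t]; [exact: cvg_cst|by []].
Qed.

Lemma cintegral_bound f (B : R) : continuous (f : R -> C^o) ->
  (forall t, normc (f t) <= B) -> normc (cintegral m f) <= B + B.
Proof.
move=> cf hB; apply: le_trans (normc_le_ReIm _) _; apply: lerD => /=.
- apply: Rintegral_bound => [t|t]; first by apply: cvg_Re; exact: cf.
  exact: le_trans (normc_Re _) (hB t).
- apply: Rintegral_bound => [t|t]; first by apply: cvg_Im; exact: cf.
  exact: le_trans (normc_Im _) (hB t).
Qed.

End CircleIntegral.

(** * The resolvent vector as an orbit of the transfer matrices *)

Section SchurEigenvector.
Variable R : realType.
Local Notation C := R[i].
Local Notation "x %:C" := (real_complex R x).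
Variables alpha lambda : nat -> C.
Hypothesis Ha : forall n, `|alpha n| < 1.
Hypothesis Hl : forall n, `|lambda n| = 1.
Variable m : probability (measurableTypeR R) R.
Hypothesis Hm : is_spectral_measure alpha lambda m.
Variable z : C.
Hypothesis z1 : `|z| < 1.
Hypothesis z0 : z != 0.
Local Notation Z := (Zmx alpha lambda).
Local Notation w := (backward_orbit alpha lambda).

Lemma cis_sub_neq0 (t : R) : cis t - z != 0.
Proof. by rewrite subr_eq0; apply: contraTneq z1 => <-; rewrite norm_cis ltxx. Qed.

Lemma normc_cis_sub (t : R) : 1 - normc z <= normc (cis t - z).
Proof.
have e : (1 - normc z)%:C = 1 - `|z| by rewrite normC_normc rmorphB rmorph1.
rewrite -lecR e -normC_normc -(norm_cis t) -(normrN z).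
exact: lerB_normD.
Qed.

(** The tail from k = N on of the geometric series of z^k e^(-ikt); [e_ 0] is the whole sum. *)
Let e_ N (t : R) : C := (z / cis t) ^+ N * (cis t / (cis t - z)).

Lemma poisson_gap : 0 < 1 - normc z.
Proof. by rewrite subr_gt0 -ltcR -normC_normc. Qed.

Lemma normc_e N t : normc (e_ N t) <= normc z ^+ N / (1 - normc z).
Proof.
have hX (x : C) n : normc (x ^+ n) = normc x ^+ n.
  by elim: n => [|n IH]; rewrite ?expr0 ?normc1// !exprS normcM IH.
rewrite /e_ normcM hX !normcM !normcV normc_cis invr1 mulr1 mul1r.
rewrite ler_wpM2l ?exprn_ge0 ?normc_ge0// lef_pV2 ?normc_cis_sub//.
  by rewrite posrE (lt_le_trans poisson_gap (normc_cis_sub t)).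
by rewrite posrE poisson_gap.
Qed.

Lemma cont_cis : continuous (@cis R : R -> C^o).
Proof. by move=> t; exact: cvg_cis. Qed.

Lemma cont_e N : continuous (e_ N : R -> C^o).
Proof.
move=> t; rewrite /e_.
apply: cvgM; first apply: cvgC_X.
- apply: cvgM; first exact: cvg_cst.
  by apply: cvgV; [exact: cis_neq0|exact: cont_cis].
- apply: cvgM; first exact: cont_cis.
  apply: cvgV; first exact: cis_sub_neq0.
  by apply: cvgB; [exact: cont_cis|exact: cvg_cst].
Qed.

Lemma bc_e N : bounded_continuous (e_ N).
Proof. by split; [exact: cont_e|exists (normc z ^+ N / (1 - normc z)); exact: normc_e]. Qed.

Lemma moment k : cintegral m (fun t => (cis t)^-1 ^+ k) = w k 0%N.
Proof.
case: Hm => _ h; case: k => [|k].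
  have := h 0; rewrite /= => <-; congr cintegral.
by have := h (Negz k) => /= <-; congr cintegral; apply/funext => t; rewrite exprVn.
Qed.

Lemma bc_cis k : bounded_continuous (fun t : R => (cis t)^-1 ^+ k).
Proof.
split.
  move=> t; apply: cvgC_X.
  by apply: cvgV; [exact: cis_neq0|exact: cont_cis].
exists 1 => t; elim: k => [|n IH]; first by rewrite expr0 normc1.
by rewrite exprS normcM normcV normc_cis invr1 mul1r.
Qed.

Lemma resolvent_remainder N :
  resolvent alpha lambda z N 0 + cintegral m (e_ N) = cintegral m (e_ 0).
Proof.
elim: N => [|N IH]; first by rewrite /resolvent big_ord0 add0r.
rewrite -IH /resolvent big_ord_recr /= -addrA; congr (_ + _).
rewrite -moment -cintegralZ; last exact: bc_cis.
have -> : cintegral m (e_ N.+1) = cintegral m (fun t => e_ N t - z ^+ N * (cis t)^-1 ^+ N).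
  congr cintegral; apply/funext => t; rewrite /e_ exprS exprMn.
  have h1 := cis_neq0 t; have h2 := cis_sub_neq0 t.
  move: (z ^+ N) ((cis t)^-1 ^+ N) => a b; field; rewrite ?h1 ?h2//.
rewrite (@cintegralB _ m (e_ N)) ?subrKC//; first exact: bc_e.
have [h [B hB]] := bc_cis N; split.
  by move=> t; apply: cvgM; [exact: cvg_cst|exact: h].
by exists (normc (z ^+ N) * B) => t; rewrite normcM ler_wpM2l// normc_ge0.
Qed.

Lemma caratheodoryE : caratheodory m z = 2 * cintegral m (e_ 0) - 1.
Proof.
rewrite /caratheodory.
have -> : 2 * cintegral m (e_ 0) - 1 = 2 * cintegral m (e_ 0) - cintegral m (fun=> 1).
  by rewrite cintegral1//; exact: Hm.1.
rewrite -cintegralZ; last exact: bc_e.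
rewrite -cintegralB.
- congr cintegral; apply/funext => t; rewrite /e_ expr0.
  have := cis_sub_neq0 t; move: (cis t) => c h2. by field.
- have [h [B hB]] := bc_e 0; split.
    by move=> t; apply: cvgM; [exact: cvg_cst|exact: h].
  by exists (normc 2 * B) => t; rewrite normcM ler_wpM2l// normc_ge0.
- by split; [move=> t; exact: cvg_cst|exists 1 => t; rewrite normc1].
Qed.

(** The quotient of the entries is (F - 1) / (F + 1) = z s(z). With this normalization the entries
    are the limits of [resolvent] and [resolvent_half] at site 0, and they differ by 1, which makes
    the vector nonzero. *)
Definition schur_vector : 'cV[C]_2 :=
  \col_i (if i == 0 then (caratheodory m z + 1) / 2 else (caratheodory m z - 1) / 2).

Lemma resolvent_cvg0 :
  resolvent alpha lambda z N 0 @[N --> \oo] --> (schur_vector 0 0 : C^o).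
Proof.
rewrite mxE /= caratheodoryE subrK mulrC mulKf ?pnatr_eq0//.
apply/cvgcP => e e0.
have hx : normc z ^+ N @[N --> \oo] --> (0 : R).
  by apply: expr_cvg0; rewrite normc_ge0 -subr_gt0 poisson_gap.
pose c := 2 / (1 - normc z).
have : c * normc z ^+ N @[N --> \oo] --> c * 0 by apply: cvgM hx; exact: cvg_cst.
rewrite mulr0 => /cvgrPdist_lt/(_ e e0); apply: filterS => N.
rewrite sub0r normrN => hN.
rewrite -(resolvent_remainder N) opprD addrA subrr sub0r normcN.
apply: le_lt_trans (cintegral_bound Hm.1 (@cont_e N) (@normc_e N)) _.
apply: le_lt_trans hN; apply: le_trans (ler_norm _).
by rewrite /c le_eqVlt; apply/orP; left; apply/eqP; field; rewrite gt_eqF// poisson_gap.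
Qed.

Lemma cvg_lin (f g : nat -> C^o) (a b c lf lg : C) :
  f n @[n --> \oo] --> (lf : C^o) -> g n @[n --> \oo] --> (lg : C^o) ->
  a * (b * f n + c * g n) @[n --> \oo] --> (a * (b * lf + c * lg) : C^o).
Proof.
move=> hf hg; apply: cvgC_M; first exact: cvg_cst.
by apply: cvgC_D; (apply: cvgC_M; first exact: cvg_cst); [exact: hf|exact: hg].
Qed.

Lemma resolvent_cvg n :
  resolvent alpha lambda z N n @[N --> \oo] --> ((Z n z *m schur_vector) 0 0 : C^o) /\
  resolvent_half alpha lambda z N n @[N --> \oo] -->
    ((Z n z *m schur_vector) 1 0 : C^o).
Proof.
elim: n => [|n [IHu IHv]].
  rewrite mul1mx; split; first exact: resolvent_cvg0.
  under eq_fun do rewrite resolvent_0.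
  have -> : schur_vector 1 0 = schur_vector 0 0 - 1 by rewrite !mxE /=; field.
  apply: cvgC_D; last exact: cvg_cst.
  exact: ((cvgC_shift _ _).2 resolvent_cvg0).
rewrite /= -mulmxA; move: (Z n z *m _) IHu IHv => U IHu IHv.
rewrite !mulmx2E /Ymx.
have [j hj] : exists j, n = (2 * j)%N \/ n = (2 * j).+1.
  by exists n./2; have := odd_double_half n; rewrite -mul2n; case: (odd n); lia.
case: hj => hj.
- have -> : odd n = false by lia.
  rewrite !mxE /= -!mulrA -!mulrDr; split.
  + rewrite (_ : (fun N => _) = fun N => (rho (alpha n))^-1 *
      (- alpha n * resolvent alpha lambda z N n +
       lambda n * z^-1 * resolvent_half alpha lambda z N n)); last first.
      by apply/funext => N; rewrite hj (resolvent_Q Ha Hl N j z0).1.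
    by rewrite (mulrA (lambda n)); exact: (cvg_lin IHu IHv).
  + rewrite (_ : (fun N => _) = fun N => (rho (alpha n))^-1 *
      ((lambda n)^-1 * z * resolvent alpha lambda z N n +
       - (alpha n)^* * resolvent_half alpha lambda z N n)); last first.
      by apply/funext => N; rewrite hj (resolvent_Q Ha Hl N j z0).2 mulNr.
    by rewrite (mulrA (lambda n)^-1); exact: (cvg_lin IHu IHv).
- have -> : odd n by lia.
  have IHu' := (cvgC_shift _ _).2 IHu.
  rewrite !mxE /= -!mulrA -!mulrDr; split.
  + apply: ((cvgC_shift _ _).1).
    rewrite (_ : (fun N => _) = fun N => (rho (alpha n))^-1 *
      (- (alpha n)^* * resolvent alpha lambda z N.+1 n +
       (lambda n)^-1 * resolvent_half alpha lambda z N n)); last first.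
      by apply/funext => N; rewrite hj (resolvent_P Ha Hl z N j).1.
    exact: (cvg_lin IHu' IHv).
  + rewrite (_ : (fun N => _) = fun N => (rho (alpha n))^-1 *
      (lambda n * resolvent alpha lambda z N.+1 n +
       - alpha n * resolvent_half alpha lambda z N n)); last first.
      by apply/funext => N; rewrite hj (resolvent_P Ha Hl z N j).2 mulNr.
    exact: (cvg_lin IHu' IHv).
Qed.

End SchurEigenvector.

(** * Bounded orbits and the boundary values of the Schur function *)

Section Bounded.
Variable R : realType.
Local Notation C := R[i].
Local Notation "x %:C" := (real_complex R x).

Lemma cvg_norm_le (f : nat -> C^o) (l B : C) :
  f n @[n --> \oo] --> (l : C^o) -> (forall n, `|f n| <= B) -> `|l| <= B + 1.
Proof.
move=> /cvgrPdist_lt/(_ 1 ltr01)/filter_ex[n hn] hB.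
rewrite -[l](subrK (f n)) addrC.
by apply: le_trans (ler_normD _ _) _; apply: lerD => //; exact: ltW.
Qed.

Lemma geometric_unbounded (r y K : R) : 1 < r -> (forall n, r ^+ n * y <= K) ->
  y <= 0.
Proof.
move=> r1 hK; rewrite leNgt; apply/negP => y0.
have r0 : 0 < r by exact: lt_trans r1.
have K0 : 0 < K by have := hK 0%N; rewrite expr0 mul1r; exact: lt_le_trans.
have hx : r^-1 ^+ n @[n --> \oo] --> 0.
  by apply: expr_cvg0; rewrite invr_ge0 ltW//= invf_lt1.
have yK : 0 < y / K by rewrite divr_gt0.
move/cvgrPdist_lt: hx => /(_ _ yK)/filter_ex[n].
rewrite sub0r normrN ger0_norm ?exprn_ge0 ?invr_ge0 ?ltW//.
rewrite ltr_pdivlMr// exprVn mulrC ltr_pdivrMr ?exprn_gt0// mulrC.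
by rewrite ltNge hK.
Qed.

Lemma geometric_unboundedC (w y K : C) : 1 < `|w| -> (forall n, `|w ^+ n * y| <= K) ->
  y = 0.
Proof.
move=> w1 hK.
have KR : K = (complex.Re K)%:C.
  by rewrite RRe_real// -(ler_real (hK 0%N)) normr_real.
have : normc y <= 0.
  apply: (@geometric_unbounded (normc w) _ (complex.Re K)) => [|n].
    by rewrite -ltcR -normC_normc.
  rewrite -lecR -KR rmorphM rmorphXn /= -!normC_normc -normrX -normrM; exact: hK.
move=> h; apply: eq0_normc; apply/eqP.
by rewrite eq_le h normc_ge0.
Qed.

Lemma cayley2 (A : 'M[C]_2) : A *m A = \tr A *: A - (\det A)%:M.
Proof.
by apply: mx2P => j; case: (ord2P j) => ->;
  rewrite mulmx2E det2E tr2E !mxE /= ?mulr1n ?mulr0n; ring.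
Qed.

(** By Cayley-Hamilton A - w annihilates the range of A - 1/w. *)
Lemma expanding_part (A : 'M[C]_2) (w : C) (U : 'cV[C]_2) :
  w != 0 -> \det A = 1 -> \tr A = w + w^-1 ->
  A *m (A *m U - w^-1 *: U) = w *: (A *m U - w^-1 *: U).
Proof.
move=> w0 hd ht.
have hAA : A *m (A *m U) = (w + w^-1) *: (A *m U) - U.
  by rewrite mulmxA cayley2 hd ht mulmxBl mul1mx -scalemxAl.
rewrite mulmxBr hAA -scalemxAr; move: (A *m U) => V.
apply/matrixP => i j; rewrite !mxE; by field.
Qed.

Lemma QmxE (a l z : C) : [/\ Qmx a l z 0 0 = (rho a)^-1 * - a,
  Qmx a l z 0 1 = (rho a)^-1 * (l * z^-1),
  Qmx a l z 1 0 = (rho a)^-1 * (l^-1 * z) & Qmx a l z 1 1 = (rho a)^-1 * - a^*].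
Proof. by split; rewrite !mxE. Qed.

Lemma cvg_Ymx {T : Type} {F : set_system T} {FF : Filter F} (f : T -> C^o)
    (z : C) alpha lambda n i k : z != 0 -> f @ F --> (z : C^o) ->
  Ymx alpha lambda n (f x) i k @[x --> F] --> (Ymx alpha lambda n z i k : C^o).
Proof.
move=> z0 hf; rewrite /Ymx; case: ifP => _; first exact: cvgC_cst.
have hfV := cvgC_V z0 hf.
have QE (x : C) := QmxE (alpha n) (lambda n) x.
case: (ord2P i) => ->; case: (ord2P k) => ->.
- have -> : (fun x => Qmx (alpha n) (lambda n) (f x) 0 0) =
      fun=> (rho (alpha n))^-1 * - alpha n.
    by apply/funext => x; have [] := QE (f x).
  by have [-> _ _ _] := QE z; exact: cvgC_cst.
- have -> : (fun x => Qmx (alpha n) (lambda n) (f x) 0 1) =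
      fun x => (rho (alpha n))^-1 * (lambda n * (f x)^-1).
    by apply/funext => x; have [] := QE (f x).
  have [_ -> _ _] := QE z; apply: cvgC_M; first exact: cvgC_cst.
  by apply: cvgC_M; [exact: cvgC_cst|exact: hfV].
- have -> : (fun x => Qmx (alpha n) (lambda n) (f x) 1 0) =
      fun x => (rho (alpha n))^-1 * ((lambda n)^-1 * f x).
    by apply/funext => x; have [] := QE (f x).
  have [_ _ -> _] := QE z; apply: cvgC_M; first exact: cvgC_cst.
  by apply: cvgC_M; [exact: cvgC_cst|exact: hf].
- have -> : (fun x => Qmx (alpha n) (lambda n) (f x) 1 1) =
      fun=> (rho (alpha n))^-1 * - (alpha n)^*.
    by apply/funext => x; have [] := QE (f x).
  by have [_ _ _ ->] := QE z; exact: cvgC_cst.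
Qed.

Lemma cvg_Zmx {T : Type} {F : set_system T} {FF : Filter F} (f : T -> C^o)
    (z : C) alpha lambda n i j : z != 0 -> f @ F --> (z : C^o) ->
  Zmx alpha lambda n (f x) i j @[x --> F] --> (Zmx alpha lambda n z i j : C^o).
Proof.
move=> z0 hf; elim: n i j => [|n IH] i j; first exact: cvgC_cst.
rewrite (_ : (fun x => _) = (fun x =>
  Ymx alpha lambda n (f x) i 0 * Zmx alpha lambda n (f x) 0 j +
  Ymx alpha lambda n (f x) i 1 * Zmx alpha lambda n (f x) 1 j)); last first.
  by apply/funext => x; rewrite /= mulmx2E.
rewrite /= mulmx2E; apply: cvgC_D; apply: cvgC_M.
- exact: cvg_Ymx.
- exact: IH.
- exact: cvg_Ymx.
- exact: IH.
Qed.

Section Periodic.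
Variables alpha lambda : nat -> C.
Hypothesis Ha : forall n, `|alpha n| < 1.
Hypothesis Hl : forall n, `|lambda n| = 1.
Variable h : nat.
Hypothesis h0 : (0 < h)%N.
Hypothesis Hp : cmv_periodic h.*2 alpha lambda.
Local Notation q := h.*2.
Local Notation Z := (Zmx alpha lambda).

Lemma Z_period n z : Z n z *m Z q z = Z (q + n) z.
Proof.
have e u : (forall n, u (n + q)%N = u n) -> shift q u = u.
  by move=> hu; apply/funext => k; rewrite /shift addnC hu.
rewrite -(Zmx_shift alpha lambda) ?odd_double// !e// => k; first exact: (Hp k).2.
exact: (Hp k).1.
Qed.

(** The eigenvalue of the eigenvector (1, m) is left free: the stability estimate asks only for |m|
    <= 1, so one predicate serves inside, outside and on the circle. *)
Definition is_slope (A : 'M[C]_2) (m : C) := `|m| <= 1 /\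
  exists2 v, A 0 0 + A 0 1 * m = v & A 1 0 + A 1 1 * m = v * m.

Lemma slope_cvg {T : Type} {F : set_system T} {FF : Filter F} (f : T -> C^o)
    (m : T -> C^o) z0 m0 w : `|z0| = 1 -> f @ F --> (z0 : C^o) ->
  \tr (Z q z0) = w + w^* -> w != w^* -> Z q z0 0 0 + Z q z0 0 1 * m0 = w ->
  Z q z0 1 0 + Z q z0 1 1 * m0 = w * m0 -> `|m0| < 1 ->
  (\forall x \near F, is_slope (Z q (f x)) (m x)) -> m @ F --> (m0 : C^o).
Proof.
move=> hz hf ht hw e0 e1 hm0 hm.
have [z00 _] := unitcJ hz.
have wp : 0 < normc (w - w^*).
  by rewrite -ltcR -normC_normc normr_gt0 subr_eq0.
(* The 8 is the factor 2 of [eigendirection_stable] times its four entries. *)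
apply/cvgcP => e ep; pose d := e * normc (w - w^*) / 8.
have d0 : 0 < d by rewrite !mulr_gt0.
have hE i j := (cvgcP _ _).1 (cvg_Zmx (alpha := alpha) (lambda := lambda) (n := q) (i := i) (j := j) z00 hf) d d0.
near=> x.
have [hm1 [v v0 v1]] : is_slope (Z q (f x)) (m x) by near: x; exact: hm.
have := eigendirection_stable (conjsym_Z Ha Hl q hz) ht e0 e1 hm0 v0 v1 hm1.
have k00 : normc (Z q (f x) 0 0 - Z q z0 0 0) < d by near: x; exact: hE.
have k01 : normc (Z q (f x) 0 1 - Z q z0 0 1) < d by near: x; exact: hE.
have k10 : normc (Z q (f x) 1 0 - Z q z0 1 0) < d by near: x; exact: hE.
have k11 : normc (Z q (f x) 1 1 - Z q z0 1 1) < d by near: x; exact: hE.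
rewrite !normC_normc -!rmorphD /= -[2 in X in _ <= X -> _](rmorph_nat (real_complex R) 2).
rewrite -!rmorphM /= lecR => hle.
rewrite -(ltr_pM2r wp); apply: le_lt_trans hle _.
have -> : e * normc (w - w^*) = 2 * (d + d + d + d) by rewrite /d; field.
by rewrite ltr_pM2l// !ltrD.
Unshelve. all: by end_near.
Qed.

Section Schur.
Variable m : probability (measurableTypeR R) R.
Hypothesis Hm : is_spectral_measure alpha lambda m.
Local Notation X := (schur_vector m).

Lemma sum_geom_le (x : C) N : 0 <= x -> x < 1 ->
  \sum_(k < N) x ^+ k <= (1 - x)^-1.
Proof.
move=> x0 x1; have p : 0 < 1 - x by rewrite subr_gt0.
rewrite -[leRHS]mul1r ler_pdivlMr//.
have -> : (\sum_(k < N) x ^+ k) * (1 - x) = 1 - x ^+ N.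
  elim: N => [|N IH]; first by rewrite big_ord0 mul0r expr0 subrr.
  by rewrite big_ord_recr /= mulrDl IH exprS; ring.
by rewrite gerBl exprn_ge0.
Qed.

Lemma resolvent_le z N n : `|z| < 1 ->
  `|resolvent alpha lambda z N n| <= (1 - `|z|)^-1 /\
  `|resolvent_half alpha lambda z N n| <= (1 - `|z|)^-1.
Proof.
move=> z1.
have hs (u : nat -> C) : (forall k, `|u k| <= 1) ->
    `|\sum_(k < N) z ^+ k * u k| <= (1 - `|z|)^-1.
  move=> hu; apply: le_trans (ler_norm_sum _ _ _) _.
  apply: le_trans (sum_geom_le N (normr_ge0 z) z1); apply: ler_sum => k _.
  by rewrite normrM normrX ler_piMr ?exprn_ge0.
split; first by apply: (hs (fun k => backward_orbit alpha lambda k n)) => k; apply: contractive_le; exact: contractive_backward_orbit.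
rewrite /resolvent_half normrM.
apply: le_trans (hs (fun k => backward_orbit_half alpha lambda k n) _).
  by rewrite ler_piMl// ltW.
by move=> k; apply: contractive_le; exact: contractive_backward_orbit_half.
Qed.

Lemma schur_orbit_bounded z n i : `|z| < 1 -> z != 0 ->
  `|(Z n z *m X z) i 0| <= (1 - `|z|)^-1 + 1.
Proof.
move=> z1 z0; have [hu hv] := resolvent_cvg Ha Hl Hm z1 z0 n.
case: (ord2P i) => ->; [apply: (cvg_norm_le hu)|apply: (cvg_norm_le hv)] => N.
- exact: (resolvent_le N n z1).1.
- exact: (resolvent_le N n z1).2.
Qed.

Lemma schur_vector_neq0 z : X z != 0.
Proof.
apply/eqP => e; have : X z 0 0 - X z 1 0 = 1 by rewrite !mxE /=; field.
by rewrite e !mxE subrr => /eqP; rewrite eq_sym oner_eq0.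
Qed.

(* The component of the bounded orbit Z n X along the expanding eigenvector
   of the monodromy matrix must vanish. *)
Lemma schur_vector_eig z : `|z| < 1 -> z != 0 ->
  exists2 w, 0 < jform (X z) & Z q z *m X z = w *: X z.
Proof.
move=> z1 z0.
have zn : `|z| != 1 by rewrite lt_eqF.
have [w w1 ht] := monodromy_eigenvalues Ha Hl h0 z0 zn.
have hd : \det (Z q z) = 1 by rewrite det_Z// -signr_odd odd_double.
have w0 : w != 0 by rewrite -normr_gt0 (lt_trans ltr01).
pose Y := Z q z *m X z - w^-1 *: X z.
have hY : Z q z *m Y = w *: Y := expanding_part (X z) w0 hd ht.
have hYn n : Z (n * q) z *m Y = w ^+ n *: Y.
  elim: n => [|n IH]; first by rewrite mul0n mul1mx expr0 scale1r.
  by rewrite mulSn -Z_period -mulmxA hY -scalemxAr IH scalerA -exprS.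
have Y0 : Y = 0.
  pose K := ((1 - `|z|)^-1 + 1) + `|w^-1| * ((1 - `|z|)^-1 + 1).
  have hK i n : `|w ^+ n * Y i 0| <= K.
    have -> : w ^+ n * Y i 0 = (w ^+ n *: Y) i 0 by rewrite [RHS]mxE.
    rewrite -hYn /Y mulmxBr mulmxA Z_period -scalemxAr.
    have -> (A B : 'cV[C]_2) : (A - w^-1 *: B) i 0 = A i 0 - w^-1 * B i 0.
      by rewrite !mxE.
    apply: le_trans (ler_normB _ _) _; apply: lerD; first exact: schur_orbit_bounded.
    by rewrite normrM ler_wpM2l//; exact: schur_orbit_bounded.
  by apply: mx2P => j; rewrite (ord1 j) [RHS]mxE; apply: (geometric_unboundedC w1 (hK _)).
have hX : Z q z *m X z = w^-1 *: X z by apply/eqP; rewrite -subr_eq0 -/Y Y0.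
exists w^-1 => //; apply: (eig_jform_gt0 Ha Hl h0 z0 (schur_vector_neq0 z) hX).
by left; split=> //; rewrite normfV invf_lt1 ?normr_gt0.
Qed.

(** The slope of [schur_vector] is z s(z), not s(z), whence the division by [cis tau]. *)
Lemma schur_radial tau w m0 : \tr (Z q (cis tau)) = w + w^* -> w != w^* ->
  Z q (cis tau) 0 0 + Z q (cis tau) 0 1 * m0 = w ->
  Z q (cis tau) 1 0 + Z q (cis tau) 1 1 * m0 = w * m0 -> `|m0| < 1 ->
  radial (schur m) tau r @[r --> 1^'-] --> (m0 / cis tau : C^o).
Proof.
move=> ht wne e0 e1 hm0; have zu := norm_cis tau; have z0 := cis_neq0 tau.
pose f (r : R) : C^o := r%:C * cis tau.
have hf : f r @[r --> 1^'-] --> (cis tau : C^o).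
  rewrite -[X in _ --> X]mul1r; apply: cvgC_M; last exact: cvgC_cst.
  by apply: (@cvg_realC _ _ _ _ (fun r : R => r) 1); exact/cvg_at_left_filter/cvg_id.
pose mm (r : R) : C^o := X (f r) 1 0 / X (f r) 0 0.
have hnear : \forall r \near 1^'-, 0 < r < (1 : R).
  near=> r; apply/andP; split; near: r; [exact: nbhs_left_gt|exact: nbhs_left_lt].
have fn r : 0 < r -> `|f r| = r%:C.
  by move=> r0; rewrite normrM zu mulr1 ger0_norm// ler0c ltW.
have hfr r : 0 < r < 1 -> `|f r| < 1 /\ f r != 0.
  move=> /andP[r0 r1]; rewrite -normr_gt0 fn//; split; last by rewrite -[0]/(0%:C) ltcR.
  by rewrite -[1]/(1%:C) ltcR.
have hmm : mm @ 1^'- --> (m0 : C^o).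
  apply: (slope_cvg zu hf ht wne e0 e1 hm0).
  apply: filterS hnear => r /hfr[fr1 fr0].
  have [v vJ hv] := schur_vector_eig fr1 fr0.
  have [_ k1 k2 k3] := jform_gt0_slope vJ hv.
  by split; [exact: ltW|exists v].
have hq : mm r / f r @[r --> 1^'-] --> (m0 / cis tau : C^o).
  by exact: (cvgC_M hmm (cvgC_V z0 hf)).
apply/cvgcP => e ep; move/cvgcP: hq => /(_ e ep); apply: (filterS2 _ _ hnear) => r hr.
have [fr1 fr0] := hfr r hr; congr (normc (_ - _) < _).
rewrite /radial /schur -/(f r) (negbTE fr0) /schur_quotient /mm !mxE /=.
rewrite mulrC; congr (_ * _); rewrite invfM invrK mulrACA.
by rewrite mulVf ?mulr1// pnatr_eq0.
Unshelve. all: by end_near.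
Qed.

End Schur.
End Periodic.
End Bounded.

(** * Characteristic polynomials of the truncations *)

Section Tridiagonal.
Variable F : comNzRingType.
Variable T : nat -> nat -> F.
Hypothesis Toff : forall i j, (i.+1 < j)%N || (j.+1 < i)%N -> T i j = 0.

Definition leading_minor n := \det (\matrix_(i < n, j < n) T i j).

Lemma tridiag_det n : leading_minor n.+2 =
  T n.+1 n.+1 * leading_minor n.+1 - T n.+1 n * T n n.+1 * leading_minor n.
Proof.
rewrite {1}/leading_minor (expand_det_row _ ord_max) !big_ord_recr /= big1; last first.
  move=> i _; rewrite mxE Toff ?mul0r//=; have := ltn_ord i; lia.
rewrite add0r !mxE /= addrC; congr (_ + _).
  rewrite /cofactor /= -signr_odd oddD addbb expr0 mul1r; congr (_ * _).
  congr (\det _); apply/matrixP => i j; rewrite !mxE /=.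
  by congr (T _ _); rewrite /bump /=; have := ltn_ord i; have := ltn_ord j; lia.
rewrite -mulrA -mulrN; congr (_ * _).
rewrite /cofactor /= -signr_odd addSn oddS oddD addbb expr1 mulN1r.
congr (- _).
rewrite (expand_det_col _ ord_max) big_ord_recr /= big1 ?add0r.
  rewrite !mxE /=; congr (_ * _).
    by congr (T _ _); rewrite /bump; lia.
  rewrite /cofactor /= -signr_odd oddD addbb expr0 mul1r.
  congr (\det _); apply/matrixP => i j; rewrite !mxE /=.
  by congr (T _ _); rewrite /bump /=; have := ltn_ord i; have := ltn_ord j; lia.
move=> i _; rewrite !mxE Toff ?mul0r// /bump /=.
by rewrite /bump; have := ltn_ord i; lia.
Qed.

(** Row k + 1 of T phi = 0 turns into the three-term recursion of the leading minors once phi n is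
    multiplied by the signed product of the superdiagonal entries. *)
Lemma tridiag_det_sol (phi : nat -> F) : phi 0%N = 1 ->
  T 0 0 * phi 0%N + T 0 1 * phi 1%N = 0 ->
  (forall k, T k.+1 k * phi k + T k.+1 k.+1 * phi k.+1 +
             T k.+1 k.+2 * phi k.+2 = 0) ->
  forall n, leading_minor n = (-1) ^+ n * (\prod_(i < n) T i i.+1) * phi n.
Proof.
move=> p0 p1 pS n.
suff : leading_minor n = (-1) ^+ n * (\prod_(i < n) T i i.+1) * phi n /\
  leading_minor n.+1 = (-1) ^+ n.+1 * (\prod_(i < n.+1) T i i.+1) * phi n.+1 by case.
elim: n => [|n [IH1 IH2]].
  split; first by rewrite /leading_minor det_mx00 big_ord0 p0 !mulr1.
  rewrite /leading_minor det_mx11 mxE /= big_ord_recr big_ord0 /= mul1r expr1.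
  by move: p1; rewrite p0 mulr1 mulN1r mulNr => /eqP; rewrite addr_eq0 => /eqP.
split=> //; rewrite tridiag_det IH1 IH2 !big_ord_recr /= !exprS.
have e : T n.+1 n.+2 * phi n.+2 = - (T n.+1 n * phi n + T n.+1 n.+1 * phi n.+1).
  by apply/eqP; rewrite -addr_eq0 addrC pS.
transitivity ((-1) ^+ n * (\prod_(i < n) T i i.+1) * T n n.+1 *
  (T n.+1 n.+2 * phi n.+2)); last by ring.
by rewrite e; ring.
Qed.

End Tridiagonal.

Section CharPoly.
Variable R : realType.
Local Notation C := R[i].
Local Notation "x %:C" := (real_complex R x).

(** The transfer matrices make sense only for nonzero z, so polynomial identities are tested there;
    the points 1, 2, 3, ... are numerous enough. *)
Lemma poly_eq_nz (p q : {poly C}) :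
  (forall z, z != 0 -> p.[z] = q.[z]) -> p = q.
Proof.
move=> hpq; apply/eqP; rewrite -subr_eq0; apply/eqP.
pose rs := [seq (i.+1)%:R : C | i <- iota 0 (size (p - q))].
apply: (@roots_geq_poly_eq0 _ _ rs).
- apply/allP => _ /mapP[i _ ->]; rewrite /root hornerD hornerN hpq ?subrr ?pnatr_eq0//.
- rewrite /rs map_inj_uniq ?iota_uniq// => i j /eqP.
  by rewrite (eqr_nat C) eqSS => /eqP.
- by rewrite size_map size_iota.
Qed.

Lemma horner_char_poly n (A : 'M[C]_n) z : (char_poly A).[z] = \det (z%:M - A).
Proof.
rewrite -horner_evalE -det_map_mx; congr (\det _); apply/matrixP => i j.
rewrite !mxE /=; rewrite /horner_eval hornerD hornerN hornerC.
by case: (i == j); rewrite ?mulr1n ?mulr0n ?hornerX ?horner0.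
Qed.

Variables alpha lambda : nat -> C.
Hypothesis Ha : forall n, `|alpha n| < 1.
Hypothesis Hl : forall n, `|lambda n| = 1.
Local Notation Z := (Zmx alpha lambda).
Local Notation L := (Lmx alpha lambda).
Local Notation M := (Mmx alpha lambda).

Lemma M_diag_even j : M (2 * j.+1) (2 * j.+1) =
  - (lambda (2 * j).+1 * alpha (2 * j).+1).
Proof.
rewrite mulnS add2n Mmx_succ; have := Lmx_block (shift 1 alpha) (shift 1 lambda) j 1 1.
by rewrite /= addn1 => ->; rewrite !mxE /= mulrN /shift.
Qed.

Lemma M_diag_odd j : M (2 * j).+1 (2 * j).+1 =
  lambda (2 * j).+1 * (alpha (2 * j).+1)^*.
Proof.
rewrite Mmx_succ; have := Lmx_block (shift 1 alpha) (shift 1 lambda) j 0 0.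
by rewrite /= addn0 => ->; rewrite !mxE /= /shift.
Qed.

Lemma M_off_odd j : M (2 * j).+1 (2 * j).+2 = lambda (2 * j).+1 * rho (alpha (2 * j).+1) /\
  M (2 * j).+2 (2 * j).+1 = lambda (2 * j).+1 * rho (alpha (2 * j).+1).
Proof.
rewrite !Mmx_succ; have := Lmx_block (shift 1 alpha) (shift 1 lambda) j 0 1.
have := Lmx_block (shift 1 alpha) (shift 1 lambda) j 1 0.
by rewrite /= addn0 addn1 => -> ->; rewrite !mxE /= /shift.
Qed.

Lemma M_off i j : (0 < i)%N || (0 < j)%N -> (i.+1 %/ 2 != j.+1 %/ 2)%N -> M i j = 0.
Proof.
case: i j => [|i] [|j] // _ h; rewrite Mmx_succ Lmx_off//.
by apply: contra h => /eqP; lia.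
Qed.

(** Since L is unitary, z - L M = L (z L^* - M). Passing to the second factor replaces a
    five-diagonal matrix by a tridiagonal one. *)
Definition pencil z (i j : nat) : C := z * (L j i)^* - M i j.

Lemma pencil_off z i j : (i.+1 < j)%N || (j.+1 < i)%N -> pencil z i j = 0.
Proof.
move=> h; rewrite /pencil Lmx_off ?M_off ?rmorph0 ?mulr0 ?subr0//; lia.
Qed.

Lemma pencil_even z j (k := (2 * j)%N) :
  [/\ pencil z k k = z * (lambda k)^* * alpha k - M k k,
      pencil z k k.+1 = z * (lambda k)^* * rho (alpha k),
      pencil z k.+1 k = z * (lambda k)^* * rho (alpha k) &
      pencil z k.+1 k.+1 = - z * (lambda k)^* * (alpha k)^* - M k.+1 k.+1].
Proof.
have [_ _ rJ] := rho_facts (Ha k).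
have h00 := Lmx_block alpha lambda j 0 0; have h01 := Lmx_block alpha lambda j 0 1.
have h10 := Lmx_block alpha lambda j 1 0; have h11 := Lmx_block alpha lambda j 1 1.
move: h00 h01 h10 h11; rewrite /= addn0 addn1 -/k => h00 h01 h10 h11.
have m01 : M k k.+1 = 0 by rewrite M_off//; rewrite /k; lia.
have m10 : M k.+1 k = 0 by rewrite M_off//; rewrite /k; lia.
have TE : [/\ Theta (alpha k) (lambda k) 0 0 = lambda k * (alpha k)^*,
    Theta (alpha k) (lambda k) 0 1 = lambda k * rho (alpha k),
    Theta (alpha k) (lambda k) 1 0 = lambda k * rho (alpha k) &
    Theta (alpha k) (lambda k) 1 1 = lambda k * - alpha k].
  by split; rewrite !mxE.
have [t00 t01 t10 t11] := TE; split; rewrite /pencil.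
- by rewrite h00 t00 !conjE; ring.
- by rewrite h10 t10 m01 !conjE rJ; ring.
- by rewrite h01 t01 m10 !conjE rJ; ring.
- by rewrite h11 t11 !conjE; congr (_ - _); ring.
Qed.

Lemma pencil_odd z j (k := (2 * j).+1) :
   pencil z k k.+1 = - (lambda k * rho (alpha k)) /\
   pencil z k.+1 k = - (lambda k * rho (alpha k)).
Proof.
have [h1 h2] := M_off_odd j.
rewrite /pencil /k h1 h2 !Lmx_off ?rmorph0 ?mulr0 ?sub0r//; lia.
Qed.

Definition ones : 'cV[C]_2 := \col_i 1.

(** The initial vector (1, 1) encodes the identity block of M at coordinate 0: without the source
    delta_0, the two components of the orbit agree at site 0. *)
Lemma pencil_sol z (phi := fun n => (Z n z *m ones) 0 0) : z != 0 ->
  [/\ phi 0%N = 1, pencil z 0 0 * phi 0%N + pencil z 0 1 * phi 1%N = 0 &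
  forall k, pencil z k.+1 k * phi k + pencil z k.+1 k.+1 * phi k.+1 +
             pencil z k.+1 k.+2 * phi k.+2 = 0].
Proof.
move=> z0.
have phi0 : phi 0%N = 1 by rewrite /phi mul1mx mxE.
pose psi n := (Z n z *m ones) 1 0.
have psi0 : psi 0%N = 1 by rewrite /psi mul1mx mxE.
have stepQ j (k := (2 * j)%N) :
    phi k.+1 = (rho (alpha k))^-1 * (- alpha k * phi k + lambda k * z^-1 * psi k) /\
    psi k.+1 = (rho (alpha k))^-1 * ((lambda k)^-1 * z * phi k - (alpha k)^* * psi k).
  rewrite /phi /psi /= -mulmxA /Ymx (_ : odd k = false); last by rewrite /k; lia.
  by rewrite !mulmx2E; have [-> -> -> ->] := QmxE (alpha k) (lambda k) z; split; ring.
have stepP j (k := (2 * j).+1) :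
    phi k.+1 = (rho (alpha k))^-1 * (- (alpha k)^* * phi k + (lambda k)^-1 * psi k) /\
    psi k.+1 = (rho (alpha k))^-1 * (lambda k * phi k - alpha k * psi k).
  rewrite /phi /psi [Z k.+1 z]/= -mulmxA /Ymx (_ : odd k = true); last by rewrite /k; lia.
  by rewrite !mulmx2E ![Pmx _ _ _ _]mxE ![mx2 _ _ _ _ _ _]mxE /=; split; ring.
split=> //.
  have [e00 e01 _ _] := pencil_even z 0; have [e _] := stepQ 0%N.
  move: e00 e01 e; rewrite muln0 => -> -> ->; rewrite phi0 psi0.
  have [r0 _ _] := rho_facts (Ha 0); have [l0 lJ] := unitcJ (Hl 0).
  by rewrite /= lJ; field; rewrite l0 r0 z0.
move=> k; have [j [hj|hj]] : exists j, k = (2 * j)%N \/ k = (2 * j).+1.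
  by exists k./2; have := odd_double_half k; rewrite -mul2n; case: (odd k); lia.
- have [_ _ e10 e11] := pencil_even z j; have [e12 _] := pencil_odd z j.
  have [f1 g1] := stepQ j; have [f2 _] := stepP j.
  rewrite hj e10 e11 e12 f2 f1 g1 M_diag_odd.
  have [r0 r2 _] := rho_facts (Ha (2 * j)); have [r0' r2' _] := rho_facts (Ha (2 * j).+1).
  have [l0 lJ] := unitcJ (Hl (2 * j)); have [l0' lJ'] := unitcJ (Hl (2 * j).+1).
  have e : alpha (2 * j) * (alpha (2 * j))^* = 1 - rho (alpha (2 * j)) ^+ 2 by rewrite r2; ring.
  rewrite lJ; move: (rho (alpha (2 * j))) (rho (alpha (2 * j).+1)) r0 r0' e {r2 r2'} => r r' r0 r0' e.
  by field: e; rewrite ?r0 ?r0' ?l0 ?l0' ?z0.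
- have [e00 e01 _ _] := pencil_even z j.+1; have [_ e10] := pencil_odd z j.
  have [f1 g1] := stepP j; have [f2 _] := stepQ j.+1.
  rewrite M_diag_even in e00.
  move: e00 e01 f2; rewrite mulnS add2n => e00 e01 f2.
  rewrite hj e10 e00 e01 f2 g1 f1.
  have [r0 r2 _] := rho_facts (Ha (2 * j).+1); have [r0' r2' _] := rho_facts (Ha (2 * j).+2).
  have [l0 lJ] := unitcJ (Hl (2 * j).+1); have [l0' lJ'] := unitcJ (Hl (2 * j).+2).
  have e : alpha (2 * j).+1 * (alpha (2 * j).+1)^* = 1 - rho (alpha (2 * j).+1) ^+ 2 by rewrite r2; ring.
  rewrite lJ'; move: (rho (alpha (2 * j).+1)) (rho (alpha (2 * j).+2)) r0 r0' e {r2 r2'} => r r' r0 r0' e.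
  by field: e; rewrite ?r0 ?r0' ?l0 ?l0' ?z0.
Qed.

End CharPoly.

(** * Polynomial transfer matrices and their derivatives *)

Section PolyMatrix.
Variable R : realType.
Local Notation C := R[i].
Implicit Types (A B : 'M[{poly C}]_2).

Definition hmx A (z : C) : 'M[C]_2 := \matrix_(i, j) (A i j).[z].
Definition dmx A (z : C) : 'M[C]_2 := \matrix_(i, j) ((A i j)^`()).[z].

Lemma mulmx2pE A B i j : (A *m B) i j = A i 0 * B 0 j + A i 1 * B 1 j.
Proof. by rewrite !mxE !big_ord_recl big_ord0 /= addr0 lift01. Qed.

Lemma hmxM A B z : hmx (A *m B) z = hmx A z *m hmx B z.
Proof.
by apply/matrixP => i j; rewrite [LHS]mxE mulmx2pE mulmx2E !mxE hornerD !hornerM.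
Qed.

Lemma dmxM A B z : dmx (A *m B) z = dmx A z *m hmx B z + hmx A z *m dmx B z.
Proof.
apply/matrixP => i j; rewrite [LHS]mxE mulmx2pE derivD !derivM !hornerD !hornerM.
by rewrite [RHS]mxE !mulmx2E !mxE; ring.
Qed.

(** This is z Q(z), the extra factor z clearing the entry with 1/z. *)
Definition Qpoly (a l : C) : 'M[{poly C}]_2 := \matrix_(i, j)
  (if i == 0 then (if j == 0 then ((rho a)^-1 * - a) *: 'X else ((rho a)^-1 * l)%:P)
   else (if j == 0 then ((rho a)^-1 * l^-1) *: 'X^2 else ((rho a)^-1 * - a^*) *: 'X)).

Definition Pi2 : 'M[C]_2 := mx2 0 0 0 1.

Lemma hmx_Qpoly a l z : z != 0 -> hmx (Qpoly a l) z = z *: Qmx a l z.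
Proof.
move=> z0; have [e00 e01 e10 e11] := QmxE a l z.
apply: mx2P => j; case: (ord2P j) => ->; rewrite [RHS]mxE ?e00 ?e01 ?e10 ?e11;
  rewrite !mxE /= ?hornerZ ?hornerX ?hornerXn ?hornerC.
- by move: (rho a)^-1 => r; ring.
- move: (rho a)^-1 => r; by field.
- move: (rho a)^-1 (l^-1) => r k; ring.
- by move: (rho a)^-1 => r; ring.
Qed.

Lemma comm_Pi2 (Q : 'M[C]_2) :
  Pi2 *m Q - Q *m Pi2 = mx2 0 (- Q 0 1) (Q 1 0) 0.
Proof.
apply: mx2P => j; case: (ord2P j) => ->; rewrite mxE [(- (Q *m _)) _ _]mxE;
  by rewrite !mulmx2E !mxE /=; ring.
Qed.

(** Q(z) is Q(1) conjugated by diag(1, z), which is z to the power [Pi2]; hence z dQ/dz is the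
    commutator of [Pi2] with Q(z). The first summand comes from the factor z in [Qpoly]. *)
Lemma dmx_Qpoly a l z : z != 0 -> z *: dmx (Qpoly a l) z =
  z *: Qmx a l z + z *: (Pi2 *m Qmx a l z - Qmx a l z *m Pi2).
Proof.
move=> z0; have [e00 e01 e10 e11] := QmxE a l z.
rewrite comm_Pi2 e01 e10 -scalerDr; congr (_ *: _).
apply: mx2P => j; case: (ord2P j) => ->; rewrite [RHS]mxE ?e00 ?e01 ?e10 ?e11;
  rewrite !mxE /= ?derivZ ?derivX ?derivC ?derivXn ?hornerZ ?hornerMn ?hornerX
    ?hornerXn ?hornerC ?horner0.
- by move: (rho a)^-1 => r; ring.
- by move: (rho a)^-1 => r; ring.
- by move: (rho a)^-1 (l^-1) => r k; rewrite /= ?expr1; ring.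
- by move: (rho a)^-1 => r; ring.
Qed.

Variables alpha lambda : nat -> C.
Local Notation Z := (Zmx alpha lambda).

Fixpoint Wpoly (n : nat) : 'M[{poly C}]_2 :=
  match n with
  | 0%N => 1%:M
  | k.+1 => (if odd k then map_mx polyC (Pmx (alpha k) (lambda k))
            else Qpoly (alpha k) (lambda k)) *m Wpoly k
  end.

Lemma hmx1 z : hmx 1%:M z = 1%:M.
Proof.
by apply/matrixP => i j; rewrite !mxE; case: (i == j); rewrite ?mulr1n ?mulr0n ?hornerE.
Qed.

Lemma hmx_polyC (A : 'M[C]_2) z : hmx (map_mx polyC A) z = A.
Proof. by apply/matrixP => i j; rewrite !mxE hornerC. Qed.

Lemma dmx_polyC (A : 'M[C]_2) z : dmx (map_mx polyC A) z = 0.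
Proof. by apply/matrixP => i j; rewrite !mxE derivC horner0. Qed.

Lemma hmx_Wpoly n z : z != 0 -> hmx (Wpoly n) z = z ^+ uphalf n *: Z n z.
Proof.
move=> z0; elim: n => [|n IH]; first by rewrite hmx1 expr0 scale1r.
rewrite /= hmxM IH /Ymx; case: ifP => hn.
- rewrite hmx_polyC -scalemxAr uphalf_half hn add1n; congr (_ ^+ _ *: _).
- rewrite hmx_Qpoly// -scalemxAr -scalemxAl scalerA; congr (_ *: _).
  by rewrite -exprSr uphalf_half hn.
Qed.

Hypothesis Ha : forall n, `|alpha n| < 1.
Hypothesis Hl : forall n, `|lambda n| = 1.

Definition Zinv n z : 'M[C]_2 := (-1) ^+ n *: adj2 (Z n z).

Lemma mulZV n z : z != 0 -> Z n z *m Zinv n z = 1%:M.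
Proof.
move=> z0; rewrite -scalemxAr mul_adj2 (det_Z Ha Hl n z0).
by rewrite scale_scalar_mx -exprMn mulrNN mulr1 expr1n.
Qed.

Lemma mulVZ n z : z != 0 -> Zinv n z *m Z n z = 1%:M.
Proof. by move=> /(mulZV n)/mulmx1C. Qed.

(** For an even step this is the commutator of [Pi2] with Q, pulled back to site 0. Odd steps do not
    depend on z, so [Rsum n z] is Z^(-1) z dZ/dz at site n. *)
Definition Rstep n z : 'M[C]_2 :=
  Zinv n.+1 z *m Pi2 *m Z n.+1 z - Zinv n z *m Pi2 *m Z n z.

Definition Rsum n z : 'M[C]_2 := \sum_(k < n) (if odd k then 0 else Rstep k z).

Lemma mul_conj_step (Q A A' B B' P : 'M[C]_2) :
  A *m A' = 1%:M -> B *m B' = 1%:M -> B = Q *m A ->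
  B *m (B' *m P *m B - A' *m P *m A) = P *m B - Q *m P *m A.
Proof.
move=> hA hB hQ; rewrite mulmxBr !mulmxA hB mul1mx; congr (_ - _).
by rewrite hQ -(mulmxA Q A) hA mulmx1.
Qed.

Lemma mul_step_sum (Q A K S St : 'M[C]_2) (c z : C) k :
  Q *m A *m St = K *m A ->
  (z *: Q + z *: K) *m (c *: A) + z *: Q *m (c *: (A *m (k%:R%:M + S))) =
  (c * z) *: (Q *m A *m (k.+1%:R%:M + (S + St))).
Proof.
move=> h; rewrite -scalerDr -!scalemxAl -!scalemxAr !scalerA (mulrC z c) -scalerDr.
congr (_ *: _); rewrite !mulmxDr h -natr1 raddfD/= mulmxDr mulmxDl !mulmxA mulmx1.
move: (Q *m A) => B; move: (K *m A) (B *m S) (B *m _) => x y t.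
by apply/matrixP => i j; rewrite !mxE; ring.
Qed.

Lemma dmx_Wpoly n z : z != 0 -> z *: dmx (Wpoly n) z =
  z ^+ uphalf n *: (Z n z *m ((uphalf n)%:R%:M + Rsum n z)).
Proof.
move=> z0; elim: n => [|n IH].
  rewrite expr0 scale1r mul1mx /Rsum big_ord0 addr0.
  apply/matrixP => i j; rewrite !mxE mul0rn.
  by case: (i == j); rewrite ?mulr1n ?mulr0n ?derivC ?deriv0 ?horner0 ?mulr0.
have hu : uphalf n.+1 = if odd n then uphalf n else (uphalf n).+1.
  by rewrite !uphalf_half /=; have := odd_double_half n; case: (odd n) => /=; lia.
rewrite hu.
change (Wpoly n.+1) with ((if odd n then map_mx polyC (Pmx (alpha n) (lambda n))
            else Qpoly (alpha n) (lambda n)) *m Wpoly n).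
change (Z n.+1 z) with ((if odd n then Pmx (alpha n) (lambda n)
   else Qmx (alpha n) (lambda n) z) *m Z n z).
rewrite /Rsum big_ord_recr /= -/(Rsum n z).
rewrite dmxM scalerDr hmx_Wpoly//; case: ifP => hn.
- rewrite dmx_polyC mul0mx scaler0 add0r addr0 hmx_polyC.
  by rewrite scalemxAr IH -scalemxAr mulmxA.
- rewrite (scalemxAr _ _ (dmx (Wpoly n) z)) IH hmx_Qpoly// (scalemxAl z (dmx _ z)) dmx_Qpoly//.
  set Q := Qmx _ _ _; set u := uphalf n.
  have hstep : Q *m Z n z *m Rstep n z = Pi2 *m (Q *m Z n z) - Q *m Pi2 *m Z n z.
    have hQ : Z n.+1 z = Q *m Z n z by rewrite /= /Ymx hn.
    by rewrite -hQ; exact: (mul_conj_step Pi2 (mulZV n z0) (mulZV n.+1 z0) hQ).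
  rewrite exprSr; apply: mul_step_sum.
  by rewrite hstep mulmxBl mulmxA.
Qed.

End PolyMatrix.

Section TruncCharPoly.
Variable R : realType.
Local Notation C := R[i].
Variables alpha lambda : nat -> C.
Hypothesis Ha : forall n, `|alpha n| < 1.
Hypothesis Hl : forall n, `|lambda n| = 1.
Local Notation Z := (Zmx alpha lambda).
Local Notation L := (Lmx alpha lambda).
Local Notation M := (Mmx alpha lambda).

Lemma sum_trunc (f : nat -> C) m n : (m <= n)%N ->
  (forall a, (m <= a)%N -> f a = 0) -> \sum_(a < n) f a = \sum_(a < m) f a.
Proof.
move=> /subnKC <- h; elim: (n - m)%N => [|k IH]; first by rewrite addn0.
by rewrite addnS big_ord_recr /= IH h ?leq_addr// addr0.
Qed.

Lemma apply_M_delta (j a : nat) : apply_mx M (delta R j) a = M a j.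
Proof.
rewrite /apply_mx /delta.
have e k : \sum_(b < k) M a b * ((b : nat) == j)%:R = if (j < k)%N then M a j else 0.
  elim: k => [|k IH]; first by rewrite big_ord0.
  rewrite big_ord_recr /= IH ltnS (leq_eqVlt j k).
  case: (eqVneq j k) => [->|jk]; first by rewrite ltnn /= ?eqxx mulr1 add0r.
  by rewrite mulr0 addr0.
rewrite e; case: ltnP => // h; rewrite M_off//; lia.
Qed.

Section Fixed.
Variable n : nat.
Local Notation N := (2 * n).+2.
Definition Lfin : 'M[C]_N := \matrix_(i, j) L i j.
Definition Mfin : 'M[C]_N := \matrix_(i, j) M i j.
Definition Ladj : 'M[C]_N := \matrix_(i, j) (L j i)^*.

(** The even size [N] keeps the blocks of L whole, so truncation commutes with the product and
    [Lfin] stays unitary, although the last block of M is cut. *)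
Lemma cmv_truncE : cmv_trunc alpha lambda (2 * n).+1 = Lfin *m Mfin.
Proof.
apply/matrixP => i j; rewrite !mxE /cmv {1}/apply_mx.
under eq_bigr do rewrite apply_M_delta.
under [RHS]eq_bigr do rewrite !mxE.
have hi := ltn_ord i.
have hoff a : (i.+2 <= a)%N || (N <= a)%N -> L i a * M a j = 0.
  by move=> h; rewrite Lmx_off ?mul0r//; lia.
case: (leqP i.+2 N) => h.
- rewrite (@sum_trunc (fun a => L i a * M a j) i.+2 N)// => a ha.
  by rewrite hoff ?ha.
- rewrite (@sum_trunc (fun a => L i a * M a j) N i.+2)//; first lia.
  by move=> a ha; rewrite hoff ?ha ?orbT.
Qed.

Lemma Theta_entries a l : [/\ Theta a l 0 0 = l * a^*, Theta a l 0 1 = l * rho a,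
   Theta a l 1 0 = l * rho a & Theta a l 1 1 = l * - a :> C].
Proof. by split; rewrite !mxE. Qed.

Lemma adjL_mul i j : apply_mx (conj_trmx L) (L ^~ j) i = (i == j)%:R.
Proof.
have [m [hm|hm]] : exists m, i = (2 * m)%N \/ i = (2 * m).+1.
  by exists i./2; have := odd_double_half i; rewrite -mul2n; case: (odd i); lia.
all: have [r0 r2 rJ] := rho_facts (Ha (2 * m)); have [l0 lJ] := unitcJ (Hl (2 * m)).
all: have [t00 t01 t10 t11] := Theta_entries (alpha (2 * m)) (lambda (2 * m)).
all: have h00 := Lmx_block alpha lambda m 0 0; have h01 := Lmx_block alpha lambda m 0 1.
all: have h10 := Lmx_block alpha lambda m 1 0; have h11 := Lmx_block alpha lambda m 1 1.
all: move: h00 h01 h10 h11; rewrite /= addn0 addn1 t00 t01 t10 t11 => h00 h01 h10 h11.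
all: have e : alpha (2 * m) * (alpha (2 * m))^* = 1 - rho (alpha (2 * m)) ^+ 2
  by rewrite r2; ring.
all: rewrite hm ?apply_adjL_even ?apply_adjL_odd//.
- have [->|j0] := eqVneq j (2 * m)%N.
    rewrite h00 h10 lJ; move: (rho _) e r0 {r2 rJ h00 h01 h10 h11 t00 t01 t10 t11} => r e r0.
    by rewrite /= mulr1n; field: e.
  have [->|j1] := eqVneq j (2 * m).+1.
    by rewrite h01 h11 /= ?mulr0n; ring.
  rewrite !Lmx_off; [|lia..].
  by rewrite !mulr0 addr0 mulr0.
- have [->|j0] := eqVneq j (2 * m)%N.
    rewrite h00 h10 (_ : _ == _ = false); last by apply/eqP; lia.
    by rewrite mulr0n; ring.
  have [->|j1] := eqVneq j (2 * m).+1.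
    rewrite h01 h11 lJ; move: (rho _) e r0 {r2 rJ h00 h01 h10 h11 t00 t01 t10 t11} => r e r0.
    by rewrite /= mulr1n; field: e.
  rewrite !Lmx_off; [|lia..].
  by rewrite !mulr0 subr0 mulr0.
Qed.

Lemma Ladj_mul : Ladj *m Lfin = 1%:M.
Proof.
apply/matrixP => i j; rewrite !mxE -(inj_eq val_inj) /= -adjL_mul /apply_mx.
under eq_bigr do rewrite !mxE.
have hi := ltn_ord i; rewrite /conj_trmx.
have hoff a : (i.+2 <= a)%N || (N <= a)%N -> (L a i)^* * L a j = 0.
  by move=> h; rewrite Lmx_off ?rmorph0 ?mul0r//; lia.
case: (leqP i.+2 N) => h.
- rewrite (@sum_trunc (fun a => (L a i)^* * L a j) i.+2 N)// => a ha.
  by rewrite hoff ?ha.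
- rewrite [RHS](@sum_trunc (fun a => (L a i)^* * L a j) N i.+2)//; first lia.
  by move=> a ha; rewrite hoff ?ha ?orbT.
Qed.

(** Only the n + 1 even rows contribute a factor z; this is the power of z that turns the entries of
    Z N into those of [Wpoly]. *)
Lemma prod_pencil : exists2 c : C, c != 0 & forall z,
  \prod_(i < N) pencil alpha lambda z i i.+1 = c * z ^+ n.+1.
Proof.
rewrite (_ : N = 2 * n.+1)%N; last by lia.
elim: n.+1 => [|k [c c0 IH]].
  by exists 1; rewrite ?oner_neq0// => w; rewrite big_ord0 mul1r expr0.
pose a := alpha (2 * k); pose b := alpha (2 * k).+1.
exists (c * ((lambda (2 * k))^* * rho a * - (lambda (2 * k).+1 * rho b))).
  have [ra _ _] := rho_facts (Ha (2 * k)); have [rb _ _] := rho_facts (Ha (2 * k).+1).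
  have [la lJ] := unitcJ (Hl (2 * k)); have [lb _] := unitcJ (Hl (2 * k).+1).
  by rewrite !mulf_neq0// ?oppr_eq0 ?mulf_neq0// lJ invr_eq0.
move=> w; rewrite mulnS add2n !big_ord_recr /= IH.
have [_ -> _ _] := pencil_even lambda Ha w k; have [-> _] := pencil_odd alpha lambda w k.
by rewrite exprSr -/a -/b; ring.
Qed.

Definition char_num (k : nat) : {poly C} :=
  Wpoly alpha lambda k 0 0 + Wpoly alpha lambda k 0 1.

Lemma Wpoly_horner k z i j : z != 0 ->
  (Wpoly alpha lambda k i j).[z] = z ^+ uphalf k * Z k z i j.
Proof.
move=> z0; transitivity (hmx (Wpoly alpha lambda k) z i j); first by rewrite mxE.
by rewrite hmx_Wpoly// mxE.
Qed.

Lemma char_num_horner k z : z != 0 ->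
  (char_num k).[z] = z ^+ uphalf k * (Z k z *m ones R) 0 0.
Proof.
move=> z0; rewrite /char_num hornerD !Wpoly_horner// mulmx2E ![ones R _ _]mxE.
by rewrite !mulr1 mulrDr.
Qed.

Lemma char_poly_trunc : exists2 c : C, c != 0 &
  char_poly (cmv_trunc alpha lambda (2 * n).+1) = c *: char_num N.
Proof.
have [c c0 hc] := prod_pencil.
have hL : \det Lfin != 0.
  have : \det Ladj * \det Lfin = 1 by rewrite -det_mulmx Ladj_mul det1.
  by apply: contra_eq_neq => ->; rewrite mulr0 eq_sym oner_neq0.
exists (\det Lfin * c); first by rewrite mulf_neq0.
apply: poly_eq_nz => z z0; rewrite hornerZ char_num_horner// horner_char_poly cmv_truncE.
have -> : z%:M - Lfin *m Mfin = Lfin *m (z *: Ladj - Mfin).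
  by rewrite mulmxBr -scalemxAr (mulmx1C Ladj_mul) scalemx1.
rewrite det_mulmx.
have -> : \det (z *: Ladj - Mfin) = leading_minor (pencil alpha lambda z) N.
  congr (\det _); apply/matrixP => i j; rewrite !mxE /pencil//.
have [p0 p1 pS] := pencil_sol Ha Hl z0.
rewrite (tridiag_det_sol (pencil_off alpha lambda z) p0 p1 pS) hc.
have -> : uphalf N = n.+1 by lia.
by rewrite -signr_odd (_ : odd N = false) ?expr0 ?mul1r ?mulrA//; lia.
Qed.

End Fixed.
End TruncCharPoly.

(** * Eigenvalue averages *)

Section Commutator.
Variable F : comNzRingType.
Implicit Types A B : 'M[F]_2.

Definition com A B := A *m B - B *m A.

Lemma comB A B D : com A (B - D) = com A B - com A D.
Proof. by rewrite /com mulmxBr mulmxBl !opprB addrACA [in RHS]addrACA (addrC (- _)). Qed.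

Lemma comZ A B (s : F) : com A (s *: B) = s *: com A B.
Proof. by rewrite /com -scalemxAr -scalemxAl scalerBr. Qed.

Lemma comE A B :
  (com A B 0 0 = A 0 1 * B 1 0 - B 0 1 * A 1 0) *
  (com A B 0 1 = A 0 0 * B 0 1 + A 0 1 * B 1 1 - B 0 0 * A 0 1 - B 0 1 * A 1 1) *
  (com A B 1 0 = A 1 0 * B 0 0 + A 1 1 * B 1 0 - B 1 0 * A 0 0 - B 1 1 * A 1 0) *
  (com A B 1 1 = A 1 0 * B 0 1 - B 1 0 * A 0 1).
Proof.
have e i j : com A B i j = A i 0 * B 0 j + A i 1 * B 1 j - (B i 0 * A 0 j + B i 1 * A 1 j).
  by rewrite !mxE !big_ord_recl !big_ord0 !lift01 !addr0.
by split; [split; [split|]|]; rewrite e; ring.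
Qed.

Lemma eig_step A (P P' : 'M[F]_2) (a b c d : F) : A *m P = c *: P -> A *m P' = d *: P' ->
  A *m (a *: P + b *: P') = (a * c) *: P + (b * d) *: P'.
Proof. by move=> h h'; rewrite mulmxDr -!scalemxAr h h' !scalerA. Qed.

Lemma duhamel_step A (G D S Y : 'M[F]_2) (v : 'cV[F]_2) n :
  G = D + com A S -> D *m (A *m Y) = A *m Y *m D ->
  A *m (n%:R *: (Y *m D *m v) + (A *m Y *m S - S *m (A *m Y)) *m v)
    + G *m (A *m Y *m v) =
  n.+1%:R *: (A *m Y *m D *m v) +
    (A *m (A *m Y) *m S - S *m (A *m (A *m Y))) *m v.
Proof.
move=> -> hD; rewrite mulmxDr -scalemxAr -[in RHS]natr1 scalerDl scale1r /com.
rewrite !mulmxDl (mulmxA D (A *m Y)) hD !mulNmx !mulmxDr !mulmxN !mulmxA.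
move: (A *m Y *m D *m v) (A *m A *m Y *m S *m v) (A *m S *m A *m Y *m v)
  (S *m A *m A *m Y *m v) => a b c e.
by apply/matrixP => i j; rewrite !mxE; ring.
Qed.

(** Commutation with A has the eigenvalues 0 and plus or minus the difference of the eigenvalues of
    A; the scalar is the square of that difference, the discriminant of the characteristic
    polynomial. *)
Lemma com3 A B : com A (com A (com A B)) =
  ((A 0 0 + A 1 1) ^+ 2 - 4 * (A 0 0 * A 1 1 - A 0 1 * A 1 0)) *: com A B.
Proof.
have [[[b00 b01] b10] b11] := comE A B.
have [[[c00 c01] c10] c11] := comE A (com A B).
have [[[d00 d01] d10] d11] := comE A (com A (com A B)).
apply/matrixP => i j; rewrite [RHS]mxE; case: (ord2P i) => ->; case: (ord2P j) => ->.
- rewrite d00 c10 c01 b00 b01 b10 b11; ring.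
- rewrite d01 c00 c01 c11 b00 b01 b10 b11; ring.
- rewrite d10 c00 c10 c11 b00 b01 b10 b11; ring.
- rewrite d11 c10 c01 b00 b01 b10 b11; ring.
Qed.

End Commutator.

(** * Powers of a hyperbolic matrix and their derivatives *)

Section PowerAsymptotics.
Variable R : realType.
Local Notation C := R[i].
Local Notation "x %:C" := (real_complex R x).
Variables (A G : 'M[C]_2) (w : C).
Hypothesis w1 : 1 < `|w|.
Hypothesis hd : \det A = 1.
Hypothesis ht : \tr A = w + w^-1.
Let d := w - w^-1.

Lemma expanding_neq0 : w != 0.
Proof. by rewrite -normr_gt0 (lt_trans ltr01). Qed.

Lemma eigen_gap_neq0 : d != 0.
Proof.
rewrite subr_eq0; apply/eqP => e.
have : `|w| ^+ 2 = 1.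
  by rewrite -normrX expr2 {1}e mulVf ?expanding_neq0// normr1.
by apply/eqP; rewrite sqrp_eq1// gt_eqF.
Qed.

Definition specproj : 'M[C]_2 := d^-1 *: (A - w^-1 *: 1%:M).
Definition specproj' : 'M[C]_2 := d^-1 *: (w *: 1%:M - A).
(** Not the off-diagonal part of G itself but its preimage under commutation with A: on off-diagonal
    matrices in an eigenbasis of A, commuting twice multiplies by d^2. *)
Definition offdiag : 'M[C]_2 := d^-1 ^+ 2 *: (A *m G - G *m A).
Definition diagpart : 'M[C]_2 := G - (A *m offdiag - offdiag *m A).

Lemma diagpart_comm : A *m diagpart = diagpart *m A.
Proof.
have w0 := expanding_neq0; have d0 := eigen_gap_neq0.
have K3 : com A (com A (com A G)) = d ^+ 2 *: com A G.
  rewrite com3 -tr2E -det2E ht hd mulr1; congr (_ *: _).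
  by rewrite /d; field.
apply/eqP; rewrite -subr_eq0 -/(com A diagpart) /diagpart -/(com A offdiag).
rewrite comB /offdiag -/(com A G) !comZ K3 scalerA exprVn mulVf ?expf_neq0//.
by rewrite scale1r subrr.
Qed.

Lemma specproj_id : specproj + specproj' = 1%:M.
Proof.
rewrite /specproj /specproj' -scalerDr.
have -> : A - w^-1 *: 1%:M + (w *: 1%:M - A) = d *: 1%:M.
  by rewrite /d; apply/matrixP => i j; rewrite !mxE; ring.
by rewrite scalerA mulVf ?eigen_gap_neq0// scale1r.
Qed.

Lemma mul_specproj : A *m specproj = w *: specproj.
Proof.
have w0 := expanding_neq0.
rewrite /specproj -scalemxAr mulmxBr cayley2 ht hd -scalemxAr mulmx1 scalerA mulrC -scalerA.
congr (_ *: _); apply/matrixP => i j; rewrite !mxE; by field.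
Qed.

Lemma mul_specproj' : A *m specproj' = w^-1 *: specproj'.
Proof.
have w0 := expanding_neq0.
rewrite /specproj' -scalemxAr mulmxBr cayley2 ht hd -scalemxAr mulmx1 scalerA mulrC -scalerA.
congr (_ *: _); apply/matrixP => i j; rewrite !mxE; by field.
Qed.

Lemma specproj_comm : specproj *m A = A *m specproj.
Proof. by rewrite /specproj -scalemxAl -scalemxAr mulmxBl mulmxBr -scalemxAl -scalemxAr mulmx1 mul1mx. Qed.

Lemma specproj_gap : d *: specproj' = w *: 1%:M - A.
Proof. by rewrite /specproj' scalerA divff ?eigen_gap_neq0// scale1r. Qed.

Lemma specproj'_idem : specproj' *m specproj' = specproj'.
Proof.
rewrite {1}/specproj' -scalemxAl mulmxBl mul_specproj' -scalemxAl mul1mx -scalerBl.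
by rewrite scalerA mulVf ?eigen_gap_neq0// scale1r.
Qed.

Lemma det_specproj : \det specproj = 0.
Proof.
rewrite /specproj detZ; apply/eqP; rewrite mulf_eq0; apply/orP; right; apply/eqP.
rewrite det2E !mxE /= !mulr1n !mulr0n !mulr0 !subr0 !mulr1.
have w0 := expanding_neq0.
transitivity (A 0 0 * A 1 1 - A 0 1 * A 1 0 - w^-1 * (A 0 0 + A 1 1) + w^-1 * w^-1).
  by ring.
by rewrite -det2E -tr2E hd ht; field.
Qed.

(** For arbitrary P the two sides differ by det P times the adjugate of G, so the rank one case
    needs no factorization of P. *)
Lemma mulmx_sandwich (P : 'M[C]_2) : \det P = 0 ->
  P *m G *m P = \tr (P *m G) *: P.
Proof.
move=> h; apply/matrixP => i j; rewrite [RHS]mxE; apply/eqP; rewrite -subr_eq0; apply/eqP.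
transitivity (- \det P * adj2 G i j); last by rewrite h oppr0 mul0r.
rewrite tr2E det2E !mulmx2E /adj2 mxE.
by case: (ord2P i) => ->; case: (ord2P j) => -> /=; ring.
Qed.

Lemma specproj_diagpart : specproj *m diagpart = \tr (specproj *m G) *: specproj.
Proof.
have d0 := eigen_gap_neq0.
rewrite -mulmx_sandwich ?det_specproj//.
have PA : specproj *m A = w *: specproj by rewrite specproj_comm mul_specproj.
have PK : specproj *m (A *m G - G *m A) = d *: (specproj *m G *m specproj').
  rewrite scalemxAr specproj_gap mulmxBr [in RHS]mulmxBr -scalemxAr mulmx1.
  by rewrite !mulmxA PA -(scalemxAl w).
have PS : specproj *m offdiag = d^-1 *: (specproj *m G *m specproj').
  by rewrite /offdiag -scalemxAr PK scalerA expr2 mulfVK.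
have PC : specproj *m (A *m offdiag - offdiag *m A) = specproj *m G *m specproj'.
  rewrite mulmxBr !mulmxA PA -(scalemxAl w) PS.
  have -> (X : 'M[C]_2) : w *: X - X *m A = X *m (w *: 1%:M - A).
    by rewrite mulmxBr -scalemxAr mulmx1.
  rewrite -specproj_gap -(scalemxAl d^-1) -(scalemxAr d) scalerA mulVf// scale1r.
  by rewrite -(mulmxA _ specproj') specproj'_idem.
rewrite /diagpart mulmxBr PC; apply/eqP; rewrite subr_eq -mulmxDr specproj_id.
by rewrite mulmx1.
Qed.

Variable X : nat -> 'M[C]_2.
Hypothesis X0 : X 0 = 1%:M.
Hypothesis XS : forall m, X m.+1 = A *m X m.
Variable v : 'cV[C]_2.
Variable y : nat -> 'cV[C]_2.
Hypothesis y0 : y 0 = 0.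
Hypothesis yS : forall m, y m.+1 = A *m y m + G *m (X m *m v).

Lemma powerE m : X m = w ^+ m *: specproj + w ^- m *: specproj'.
Proof.
elim: m => [|m IH]; first by rewrite X0 expr0 invr1 !scale1r specproj_id.
rewrite XS IH (eig_step _ _ mul_specproj mul_specproj') -exprSr.
by rewrite -invfM -exprSr.
Qed.

Lemma power_diagpart m : diagpart *m X m = X m *m diagpart.
Proof.
elim: m => [|m IH]; first by rewrite X0 mulmx1 mul1mx.
by rewrite XS mulmxA -diagpart_comm -mulmxA IH mulmxA.
Qed.

(* The off-diagonal part of G is a commutator with A, so its contribution
   telescopes; the diagonal part commutes with A and contributes linearly. *)
Lemma duhamelE m : y m.+1 = m.+1%:R *: (X m *m diagpart *m v) +
  (X m.+1 *m offdiag - offdiag *m X m.+1) *m v.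
Proof.
have eG : G = diagpart + com A offdiag by rewrite subrK.
elim: m => [|m IH].
  by rewrite yS y0 mulmx0 add0r XS X0 mulmx1 !mul1mx scale1r {1}eG [in LHS]mulmxDl.
rewrite yS IH (XS m.+1) [in X in _ + G *m X](XS m).
have cD := power_diagpart m.+1.
move: eG cD; rewrite (XS m); move: diagpart offdiag (X m) => D S Y eG cD.
exact: duhamel_step.
Qed.

End PowerAsymptotics.

Section MatrixLimits.
Variable R : realType.
Local Notation C := R[i].
Local Notation "x %:C" := (real_complex R x).

Lemma lin_entry (B D : 'M[C]_2) (a b : C) i j :
  (a *: B + b *: D) i j = a * B i j + b * D i j.
Proof. by rewrite !mxE. Qed.

Lemma duhamel_entry (Xm X1 D S : 'M[C]_2) (v : 'cV[C]_2) (k a w : C) :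
  k != 0 -> a != 0 -> w != 0 -> (X1 *m v) 0 0 != 0 ->
  ((a *: Xm *m D *m v) 0 0 +
    k^-1 * (w * (((a / w) *: X1 *m S - S *m ((a / w) *: X1)) *m v) 0 0)) /
    (w * ((a / w) *: X1 *m v) 0 0) =
  (k *: (Xm *m D *m v) + (X1 *m S - S *m X1) *m v) 0 0 / (k * (X1 *m v) 0 0).
Proof.
move=> k0 a0 w0 h.
rewrite -!scalemxAr -!scalemxAl -scalerBr -scalemxAl.
move: ((X1 *m S - S *m X1) *m v) (Xm *m D *m v) (X1 *m v) h => p q r r0.
rewrite !mxE; by field; rewrite k0 a0 w0 r0.
Qed.

Lemma cvg_invn : (m.+1%:R)^-1 @[m --> \oo] --> (0 : C^o).
Proof.
have h := @cvg_harmonic R.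
have : ((@harmonic R m)%:C : C^o) @[m --> \oo] --> ((0 : R)%:C : C^o).
  exact: cvg_realC.
rewrite (_ : (fun m : nat => _) = (fun m : nat => (m.+1%:R)^-1 : C^o))//.
by apply/funext => m; rewrite /harmonic fmorphV rmorph_nat.
Qed.

Lemma cvgC_geom (k : C) : `|k| < 1 -> k ^+ m @[m --> \oo] --> (0 : C^o).
Proof.
move=> hk; apply/cvgcP => e e0.
have hX n : normc (k ^+ n) = normc k ^+ n.
  by elim: n => [|n IH]; rewrite ?expr0 ?normc1// !exprS normcM IH.
have : normc k ^+ n @[n --> \oo] --> (0 : R).
  by apply: expr_cvg0; rewrite normc_ge0 -ltcR -normC_normc.
move/cvgrPdist_lt => /(_ e e0); apply: filterS => n.
by rewrite sub0r normrN subr0 hX ger0_norm// exprn_ge0// normc_ge0.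
Qed.

Variables (A G : 'M[C]_2) (w : C).
Hypothesis w1 : 1 < `|w|.
Hypothesis hd : \det A = 1.
Hypothesis ht : \tr A = w + w^-1.
Variable X : nat -> 'M[C]_2.
Hypothesis X0 : X 0 = 1%:M.
Hypothesis XS : forall m, X m.+1 = A *m X m.
Variable v : 'cV[C]_2.
Variable y : nat -> 'cV[C]_2.
Hypothesis y0 : y 0 = 0.
Hypothesis yS : forall m, y m.+1 = A *m y m + G *m (X m *m v).
Local Notation P := (specproj A w).
Hypothesis Pv : (P *m v) 0 0 != 0.

Lemma cvg_power : mxcvg \oo (fun m => w ^- m *: X m) P.
Proof.
move=> i j; have w0 := expanding_neq0 w1.
have -> : (fun m => (w ^- m *: X m) i j) =
    fun m => P i j + (w^-1 * w^-1) ^+ m * specproj' A w i j.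
  apply/funext => m; rewrite mxE (powerE w1 hd ht X0 XS).
  rewrite lin_entry; move: (P i j) (specproj' A w i j) => a b.
  by rewrite mulrDr mulrA mulVf ?expf_neq0// mul1r mulrA exprMn exprVn.
rewrite -[X in _ --> X]addr0 -[X in _ + X](mul0r (specproj' A w i j)).
apply: cvgC_D; first exact: cvgC_cst.
apply: cvgC_M; last exact: cvgC_cst.
apply: cvgC_geom; rewrite normrM normfV.
by rewrite -invfM invf_lt1 ?mulr_gt0 ?normr_gt0// mulr_egt1.
Qed.

(** After division by (m + 1) w^m the telescoped commutator of [duhamelE] disappears, X m becomes P,
    and P D is the scalar tr (P G) times P, so that the initial vector cancels from the quotient. *)
Lemma duhamel_limit :
  y m.+1 0 0 / (m.+1%:R * (X m.+1 *m v) 0 0) @[m --> \oo] -->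
  (\tr (P *m G) / w : C^o).
Proof.
have w0 := expanding_neq0 w1.
pose S := offdiag A G w; pose D := diagpart A G w.
pose t m := w ^- m *: X m.
(* [num] and [den] are the numerator and denominator of the statement, both divided by (m + 1)
   w^m. *)
pose num m := (t m *m D *m v) 0 0 +
  m.+1%:R^-1 * (w * ((t m.+1 *m S - S *m t m.+1) *m v) 0 0).
pose den m := w * (t m.+1 *m v) 0 0.
have ht1 : mxcvg \oo (fun m => t m.+1) P.
  by move=> i j; apply: (cvgC_shift (fun m => t m i j) _).2; exact: cvg_power.
have hnum : num m @[m --> \oo] --> ((P *m D *m v) 0 0 : C^o).
  rewrite -[X in _ --> X]addr0 -[X in _ + X](mul0r (w * ((P *m S - S *m P) *m v) 0 0)).
  apply: cvgC_D.
    have hh : mxcvg \oo (fun m => t m *m D *m v) (P *m D *m v).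
      apply: mxcvgM; last exact: mxcvg_cst.
      by apply: mxcvgM; [exact: cvg_power|exact: mxcvg_cst].
    exact: (hh 0 0).
  apply: cvgC_M; first exact: cvg_invn.
  apply: cvgC_M; first exact: cvgC_cst.
  have hh : mxcvg \oo (fun m => (t m.+1 *m S - S *m t m.+1) *m v) ((P *m S - S *m P) *m v).
    apply: mxcvgM; last exact: mxcvg_cst.
    by apply: mxcvgB; apply: mxcvgM; [exact: ht1|exact: mxcvg_cst|exact: mxcvg_cst|exact: ht1].
  exact: (hh 0 0).
have hden : den m @[m --> \oo] --> (w * (P *m v) 0 0 : C^o).
  apply: cvgC_M; first exact: cvgC_cst.
  have hh : mxcvg \oo (fun m => t m.+1 *m v) (P *m v) by apply: mxcvgM; [exact: ht1|exact: mxcvg_cst].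
  exact: (hh 0 0).
have hlim : num m / den m @[m --> \oo] --> ((P *m D *m v) 0 0 / (w * (P *m v) 0 0) : C^o).
  apply: cvgC_M; first exact: hnum.
  by apply: cvgC_V; [rewrite mulf_neq0|exact: hden].
have e : (P *m D *m v) 0 0 / (w * (P *m v) 0 0) = \tr (P *m G) / w.
  rewrite (specproj_diagpart G w1 hd ht) -scalemxAl mxE.
  by field; rewrite w0 Pv.
have hden0 : \forall m \near \oo, den m != 0.
  have p0 : 0 < normc (w * (P *m v) 0 0).
    by rewrite -ltcR -normC_normc normr_gt0 mulf_neq0.
  move/cvgcP: hden => /(_ _ p0); apply: filterS => m; apply: contraTneq => ->.
  by rewrite sub0r normcN ltxx.
rewrite -e; apply/cvgcP => eps e0; move/cvgcP: hlim => /(_ _ e0).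
apply: (filterS2 _ _ hden0) => m dm.
suff -> : num m / den m = y m.+1 0 0 / (m.+1%:R * (X m.+1 *m v) 0 0) by [].
have hy := duhamelE w1 hd ht X0 XS y0 yS m.
have et : t m.+1 = (w ^- m / w) *: X m.+1 by rewrite /t exprSr invfM.
have dm' : (X m.+1 *m v) 0 0 != 0.
  apply: contra dm => /eqP h; rewrite /den et -(scalemxAl (w ^- m / w)) mxE h.
  by rewrite !mulr0.
have k0 : m.+1%:R != 0 :> C by rewrite pnatr_eq0.
have a0 : w ^- m != 0 by rewrite invr_eq0 expf_neq0.
have et0 : t m = w ^- m *: X m by [].
rewrite hy /num /den et et0 -/S -/D.
exact: (duhamel_entry (X m) D S k0 a0 w0 dm').
Qed.

End MatrixLimits.

(** * Logarithmic derivatives and the density of states outside the disk *)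

Section LogDerivative.
Variable R : realType.
Local Notation C := R[i].
Local Notation "x %:C" := (real_complex R x).

Lemma logderiv_prod (s : seq C) z : (forall x, x \in s -> z != x) ->
  (\prod_(x <- s) ('X - x%:P)).[z] != 0 /\
  ((\prod_(x <- s) ('X - x%:P))^`()).[z] =
    (\prod_(x <- s) ('X - x%:P)).[z] * \sum_(x <- s) (z - x)^-1.
Proof.
elim: s => [|x s IH] hs.
  by rewrite !big_nil derivC horner0 mulr0 hornerC oner_neq0.
have [|h1 h2] := IH; first by move=> t ht; apply: hs; rewrite inE ht orbT.
have zx : z - x != 0 by rewrite subr_eq0 hs// inE eqxx.
rewrite !big_cons derivM derivXsubC mul1r hornerM hornerXsubC; split.
  by rewrite mulf_neq0.
by rewrite hornerD hornerM hornerXsubC h2; field.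
Qed.

Lemma char_poly_eigenvalues n (A : 'M[C]_n) :
  char_poly A = \prod_(x <- eigenvalues A) ('X - x%:P).
Proof.
rewrite /eigenvalues; case: closed_field_poly_normal => s /= ->.
by rewrite (monicP (char_poly_monic A)) scale1r.
Qed.

Lemma size_eigenvalues n (A : 'M[C]_n) : size (eigenvalues A) = n.
Proof.
have := size_char_poly A; rewrite char_poly_eigenvalues.
by rewrite size_prod_XsubC => -[].
Qed.

(* The Poisson kernel at z, continued to the whole plane: on the closed unit
   disk the denominator is |z - x|^2, and the quotient is Re ((z+x)/(z-x)). *)
Definition plane_kernel (z x : C) : R :=
  (normc z ^+ 2 - normc x ^+ 2) /
  Num.max (normc (z - x) ^+ 2) ((normc z - 1) ^+ 2).

Lemma normc_triangle (a b : C) : normc a <= normc (a - b) + normc b.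
Proof.
rewrite -[X in normc X <= _](subrK b); exact: le_normcD.
Qed.

Lemma normc_sub_ge (x y : C) : `|normc x - normc y| <= normc (x - y).
Proof.
rewrite ler_norml lerBlDr normc_triangle andbT lerNl opprB lerBlDr.
have -> : normc (x - y) = normc (y - x) by rewrite -normcN opprB.
exact: normc_triangle.
Qed.

Lemma cvg_normc {T : Type} {F : set_system T} {FF : Filter F} (f : T -> C^o) (l : C) :
  f @ F --> (l : C^o) -> normc (f x) @[x --> F] --> normc l.
Proof.
move=> /cvgcP hf; apply/cvgrPdist_lt => e e0; near=> x.
rewrite distrC; apply: le_lt_trans (normc_sub_ge _ _) _.
by near: x; exact: hf.
Unshelve. all: by end_near.
Qed.

Lemma dist_max (a b c : R) : `|Num.max a c - Num.max b c| <= `|a - b|.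
Proof.
have h1 := ler_norm (a - b); have h2 := ler_norm (b - a); rewrite distrC in h2.
by rewrite ler_norml; case: (leP a c) => ac; case: (leP b c) => bc; apply/andP; split; lra.
Qed.

(** The maximum keeps the denominator at least (|z| - 1)^2 even near x = z, which makes the kernel
    an admissible test function for the weak* limit. *)
Lemma plane_kernel_cont z : 1 < normc z -> continuous (plane_kernel z : C^o -> R).
Proof.
move=> z1 x; rewrite /plane_kernel.
have hid : (fun y : C^o => y) @ nbhs (x : C^o) --> (x : C^o) by exact: cvg_id.
have hx : normc y @[y --> nbhs (x : C^o)] --> normc x by exact: (cvg_normc hid).
have hzx : normc (z - y) @[y --> nbhs (x : C^o)] --> normc (z - x).
  have h2 := cvgC_N hid.
  have h3 : (fun y : C^o => z + - y : C^o) @ nbhs (x : C^o) --> (z + - x : C^o).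
    by apply: cvgC_D; [exact: cvgC_cst|exact: h2].
  exact: (cvg_normc h3).
have c1 : normc z ^+ 2 - normc y ^+ 2 @[y --> nbhs (x : C^o)] -->
    normc z ^+ 2 - normc x ^+ 2.
  by apply: cvgB; [exact: cvg_cst|exact: (cvgM hx hx)].
have c2 : Num.max (normc (z - y) ^+ 2) ((normc z - 1) ^+ 2) @[y --> nbhs (x : C^o)]
    --> Num.max (normc (z - x) ^+ 2) ((normc z - 1) ^+ 2).
  have h4 : normc (z - y) ^+ 2 @[y --> nbhs (x : C^o)] --> normc (z - x) ^+ 2.
    exact: (cvgM hzx hzx).
  apply/cvgrPdist_lt => e e0; move/cvgrPdist_lt: h4 => /(_ e e0).
  by apply: filterS => y; apply: le_lt_trans; exact: dist_max.
apply: (cvgM c1); apply: cvgV c2.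
rewrite gt_eqF// lt_max; apply/orP; right.
by rewrite exprn_gt0// subr_gt0.
Qed.

Lemma Re_div (u v : C) : v != 0 -> complex.Re (u / v) =
  (complex.Re u * complex.Re v + complex.Im u * complex.Im v) / normc v ^+ 2.
Proof.
case: u v => a b [c d]; rewrite eq_complex /= => h.
have h2 : c ^+ 2 + d ^+ 2 != 0.
  by apply: contra h; rewrite paddr_eq0 ?sqr_ge0// !sqrf_eq0.
rewrite sqr_sqrtr ?addr_ge0 ?sqr_ge0//; by field.
Qed.

Lemma sqr_normcE (u : C) : normc u ^+ 2 = complex.Re u ^+ 2 + complex.Im u ^+ 2.
Proof. by case: u => a b /=; rewrite sqr_sqrtr ?addr_ge0 ?sqr_ge0. Qed.

(** In the form 2 z / (z - x) - 1 the sum over the eigenvalues is 2 z times a logarithmic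
    derivative, minus the number of eigenvalues. *)
Lemma plane_kernel_disk z x : 1 < normc z -> normc x <= 1 ->
  z - x != 0 /\ plane_kernel z x = complex.Re (2 * z / (z - x) - 1).
Proof.
move=> z1 x1.
have hzx : normc z - 1 <= normc (z - x).
  by have := normc_triangle z x; lra.
have zx : z - x != 0.
  apply/eqP => h; move: hzx; rewrite h normc0; lra.
split=> //; rewrite /plane_kernel max_l; last first.
  by rewrite ler_pXn2r// nnegrE ?normc_ge0// subr_ge0 ltW.
have -> : 2 * z / (z - x) - 1 = (z + x) / (z - x) by field.
rewrite Re_div// !sqr_normcE; congr (_ / _).
by case: (z) (x) => a b [c d] /=; ring.
Qed.

Lemma plane_kernel_cis z t : 1 < normc z ->
  plane_kernel z (cis t) = (normc z ^+ 2 - 1) / normc (z - cis t) ^+ 2.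
Proof.
move=> z1; rewrite /plane_kernel normc_cis expr1n max_l//.
have := normc_triangle z (cis t); rewrite normc_cis => h.
have h1 : 0 <= normc z - 1 by lra.
by rewrite ler_pXn2r ?nnegrE ?normc_ge0//; lra.
Qed.

Section Average.
Variables alpha lambda : nat -> C.
Hypothesis Ha : forall n, `|alpha n| < 1.
Hypothesis Hl : forall n, `|lambda n| = 1.
Local Notation Z := (Zmx alpha lambda).
Local Notation ones := (ones R).

Lemma ones_neq0 : ones != 0.
Proof. by apply/eqP => /matrixP/(_ 0 0)/eqP; rewrite !mxE oner_eq0. Qed.

Lemma jform_ones : jform ones = 0.
Proof. by rewrite /jform !mxE subrr. Qed.

Lemma jform_gt0_top (U : 'cV[C]_2) : 0 < jform U -> U 0 0 != 0.
Proof.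
rewrite /jform => h; apply/eqP => e; move: h.
by rewrite e normr0 expr0n sub0r oppr_gt0 le_gtF// exprn_ge0.
Qed.

(** The orbit of (1, 1) starts with [.] = 0, and [.] becomes positive for |z| > 1. This locates the
    eigenvalues of the truncations in the closed disk without any operator norm. *)
Lemma char_top_neq0 k z : (0 < k)%N -> 1 < `|z| -> (Z k.*2 z *m ones) 0 0 != 0.
Proof.
move=> k0 z1; have z0 : z != 0 by rewrite -normr_gt0 (lt_trans ltr01).
have [S [_ Sp e]] := jform_Z2 Ha Hl k ones z0.
apply: jform_gt0_top; rewrite e jform_ones sub0r -mulNr mulr_gt0//.
  by rewrite oppr_gt0 subr_lt0 expr_gt1.
exact: (Sp k0 ones_neq0).
Qed.

Lemma eigenvalues_disk n x : x \in eigenvalues (cmv_trunc alpha lambda (2 * n).+1) ->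
  normc x <= 1.
Proof.
move=> hx; rewrite leNgt; apply/negP => x1.
have x1' : 1 < `|x| by rewrite normC_normc -[1]/(1%:C) ltcR.
have x0 : x != 0 by rewrite -normr_gt0 (lt_trans ltr01).
have [c c0 hc] := char_poly_trunc Ha Hl n.
have : (char_poly (cmv_trunc alpha lambda (2 * n).+1)).[x] = 0.
  rewrite char_poly_eigenvalues; apply/eqP.
  by rewrite -/(root _ _) root_prod_XsubC.
rewrite hc hornerZ char_num_horner// => /eqP; rewrite !mulf_eq0 (negbTE c0) /=.
rewrite expf_eq0 (negbTE x0) andbF /=.
by have := char_top_neq0 (ltn0Sn n) x1'; rewrite (_ : n.+1.*2 = (2 * n).+2) => [/negbTE ->|]//; lia.
Qed.

Lemma char_num_logderiv k z : z != 0 -> z * ((char_num alpha lambda k)^`()).[z] =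
  z ^+ uphalf k * ((uphalf k)%:R * (Z k z *m ones) 0 0 +
    (Z k z *m Rsum alpha lambda k z *m ones) 0 0).
Proof.
move=> z0; transitivity ((z *: dmx (Wpoly alpha lambda k) z *m ones) 0 0).
  by rewrite mulmx2E !mxE /char_num derivD hornerD; ring.
rewrite dmx_Wpoly// -scalemxAl mxE mulmxDr mulmxDl mxE; congr (_ * (_ + _)).
by rewrite -scalemx1 -scalemxAr mulmx1 -scalemxAl mxE.
Qed.

Lemma average_kernel n z (N := (2 * n).+2) : 1 < normc z ->
  eigen_average alpha lambda (2 * n).+1 (plane_kernel z) =
  complex.Re (2 / N%:R * ((Z N z *m Rsum alpha lambda N z *m ones) 0 0 /
     (Z N z *m ones) 0 0)).
Proof.
move=> z1; have z1' : 1 < `|z| by rewrite normC_normc -[1]/(1%:C) ltcR.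
have z0 : z != 0 by rewrite -normr_gt0 (lt_trans ltr01).
rewrite /eigen_average; set A := cmv_trunc _ _ _; set s := eigenvalues A.
have hs x : x \in s -> normc x <= 1 := @eigenvalues_disk n x.
have -> : \sum_(x <- s) plane_kernel z x =
    complex.Re (2 * z * \sum_(x <- s) (z - x)^-1 - N%:R).
  have -> : (N%:R : C) = \sum_(x <- s) 1.
    by rewrite big_const_seq count_predT iter_addr_0 size_eigenvalues.
  rewrite mulr_sumr -sumrB raddf_sum/= !big_seq; apply: eq_bigr => x /hs hx.
  by have [_ ->] := plane_kernel_disk z1 hx.
have top0 : (Z N z *m ones) 0 0 != 0.
  have := char_top_neq0 (ltn0Sn n) z1'.
  by rewrite (_ : n.+1.*2 = N)//; rewrite /N; lia.
have [c c0 hc] := char_poly_trunc Ha Hl n.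
have hsum : z * \sum_(x <- s) (z - x)^-1 =
    n.+1%:R + (Z N z *m Rsum alpha lambda N z *m ones) 0 0 / (Z N z *m ones) 0 0.
  have [|h1 h2] := @logderiv_prod s z.
    move=> x /hs hx; apply: contraTneq z1 => ->; by rewrite -leNgt.
  move: h1 h2; rewrite -char_poly_eigenvalues -/A hc derivZ !hornerZ => h1 h2.
  have p0 : (char_num alpha lambda N).[z] != 0.
    by apply: contra h1 => /eqP ->; rewrite mulr0.
  have -> : \sum_(x <- s) (z - x)^-1 =
      ((char_num alpha lambda N)^`()).[z] / (char_num alpha lambda N).[z].
    by apply: (mulfI p0); apply: (mulfI c0); rewrite mulrA -h2; field.
  rewrite mulrA char_num_logderiv// char_num_horner//.
  have -> : uphalf N = n.+1 by rewrite /N; lia.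
  by field; rewrite top0 expf_neq0.
move: hsum; set t := ((_ *m ones) 0 0 / (_ *m ones) 0 0); set S := \sum_(x <- s) (z - x)^-1 => hsum.
(* The power z^(n+1) in the characteristic polynomial contributes 2 (n + 1) = N, which cancels the
   number of eigenvalues. *)
have -> : 2 * z * S - N%:R = 2 * t.
  rewrite -mulrA hsum (_ : (N%:R : C) = 2 * n.+1%:R). by ring.
  by rewrite -natrM; congr (_%:R); rewrite /N; lia.
have Re_real (r : R) (u : C) : complex.Re (r%:C * u) = r * complex.Re u.
  by case: u => a b /=; rewrite mul0r subr0.
have -> : 2 / N%:R * t = (N%:R^-1 : R)%:C * (2 * t).
  by rewrite fmorphV rmorph_nat; ring.
by rewrite Re_real mulrC.
Qed.

End Average.

Section Dos.
Variables alpha lambda : nat -> C.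
Hypothesis Ha : forall n, `|alpha n| < 1.
Hypothesis Hl : forall n, `|lambda n| = 1.
Variable h : nat.
Hypothesis h0 : (0 < h)%N.
Hypothesis Hp : cmv_periodic h.*2 alpha lambda.
Local Notation q := h.*2.
Local Notation Z := (Zmx alpha lambda).
Local Notation Rs := (Rsum alpha lambda).
Local Notation Zi := (Zinv alpha lambda).
Local Notation ones := (ones R).
Variable z : C.
Hypothesis z1 : 1 < normc z.

Let z1' : 1 < `|z|.
Proof. by rewrite normC_normc -[1]/(1%:C) ltcR. Qed.
Let z0 : z != 0.
Proof. by rewrite -normr_gt0 (lt_trans ltr01 z1'). Qed.

Lemma Z_periodM m k : Z (m * q + k) z = Z k z *m Z (m * q) z.
Proof.
have e u : (forall n, u (n + q)%N = u n) -> shift (m * q) u = u.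
  move=> hu; apply/funext => j; rewrite /shift.
  by elim: m => [|l IH]; rewrite ?mul0n// mulSn -addnA addnC hu.
rewrite -(Zmx_shift alpha lambda); last by rewrite -doubleMr odd_double.
by rewrite !e// => j; [exact: (Hp j).2|exact: (Hp j).1].
Qed.

Lemma Zinv_uniq n (B : 'M[C]_2) : Z n z *m B = 1%:M -> B = Zi n z.
Proof. by move=> e; rewrite -[LHS]mul1mx -(mulVZ Ha Hl n z0) -mulmxA e mulmx1. Qed.

Lemma Zinv_periodM m k : Zi (m * q + k) z = Zi (m * q) z *m Zi k z.
Proof.
apply/esym/Zinv_uniq; rewrite Z_periodM mulmxA -(mulmxA (Z k z)) mulZV// mulmx1.
by rewrite mulZV.
Qed.

Lemma Rsum_periodM m k : Rs (m * q + k) z =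
  Rs (m * q) z + Zi (m * q) z *m Rs k z *m Z (m * q) z.
Proof.
elim: k => [|k IH].
  by rewrite addn0 {3}/Rsum big_ord0 mulmx0 mul0mx addr0.
rewrite addnS {1}/Rsum big_ord_recr /= -/(Rs (m * q + k) z) IH.
rewrite {4}/Rsum big_ord_recr /= -/(Rs k z) mulmxDr mulmxDl addrA; congr (_ + _).
have ho : odd (m * q) = false by rewrite -doubleMr odd_double.
rewrite oddD ho /=; case: ifP => _; first by rewrite mulmx0 mul0mx.
rewrite /Rstep -(addnS (m * q) k) (Zinv_periodM m k.+1) (Zinv_periodM m k).
rewrite (Z_periodM m k.+1) (Z_periodM m k).
move: (Z (m * q) z) (Zi (m * q) z) (Z k.+1 z) (Zi k.+1 z) (Z k z) (Zi k z).
by move=> B B' D D' E E'; rewrite mulmxBr mulmxBl !mulmxA.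
Qed.

Let A := Z q z.
Let y m := Z (m * q) z *m Rs (m * q) z *m ones.

(** Leibniz rule for z d/dz of A^m (1, 1), with [A *m Rs q z] in the role of z dA/dz. *)
Lemma y_rec m : y m.+1 = A *m y m + (A *m Rs q z) *m (Z (m * q) z *m ones).
Proof.
rewrite /y /A mulSn addnC Z_periodM Rsum_periodM mulmxDr mulmxDl.
have := mulZV Ha Hl (m * q) z0.
move: (Z q z) (Z (m * q) z) (Zi (m * q) z) (Rs (m * q) z) (Rs q z) => B D D' S S' e.
by rewrite !mulmxA; congr (_ + _); rewrite -(mulmxA B D) e mulmx1.
Qed.

(** If the expanding component of (1, 1) vanished, (1, 1) would be an eigenvector with [.] = 0,
    which [Z_eig_jform] excludes off the circle. Being nonzero, that component has [.] > 0, hence a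
    nonzero top entry. *)
Lemma specproj_top w : 1 < `|w| -> \tr A = w + w^-1 -> (specproj A w *m ones) 0 0 != 0.
Proof.
move=> w1 ht; have w0 := expanding_neq0 w1; have d0 := eigen_gap_neq0 w1.
have hd : \det A = 1 by rewrite /A (det_Z Ha Hl)// -signr_odd odd_double.
have e : A *m (A *m ones - w^-1 *: ones) = w *: (A *m ones - w^-1 *: ones).
  exact: expanding_part.
have nz : A *m ones - w^-1 *: ones != 0.
  apply/eqP => /eqP; rewrite subr_eq0 => /eqP e'.
  have [S S0] := Z_eig_jform Ha Hl h0 z0 (ones_neq0) e'.
  rewrite jform_ones mulr0 => /eqP; rewrite eq_sym mulf_eq0 (gt_eqF S0) orbF.
  by rewrite subr_eq0 eq_sym sqrp_eq1// gt_eqF.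
have := eig_jform_gt0 Ha Hl h0 z0 nz e (or_intror (conj z1' w1)).
move/jform_gt0_top => hne.
rewrite /specproj -scalemxAl mxE mulf_neq0 ?invr_eq0// mulmxBl -scalemxAl mul1mx.
exact: hne.
Qed.

Lemma dos_poisson (nu : probability (measurableTypeR R) R) w :
  is_dos alpha lambda nu -> 1 < `|w| -> \tr A = w + w^-1 ->
  Rintegral nu (angles R) (fun t => (normc z ^+ 2 - 1) / normc (z - cis t) ^+ 2) =
  complex.Re (\tr (specproj A w *m Rs q z)) / h%:R.
Proof.
move=> [_ hnu] w1 ht; have w0 := expanding_neq0 w1.
have hd : \det A = 1 by rewrite /A (det_Z Ha Hl)// -signr_odd odd_double.
have y0 : y 0 = 0 by rewrite /y mul0n /Rsum big_ord0 mulmx0 mul0mx.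
have XS m : Z (m.+1 * q) z = A *m Z (m * q) z by rewrite mulSn addnC Z_periodM.
have hlim := @duhamel_limit R A (A *m Rs q z) w w1 hd ht (fun m => Z (m * q) z)
  erefl XS ones y y0 y_rec (specproj_top w1 ht).
(* P A = w P removes the factor 1/w from the limit. *)
have etr : \tr (specproj A w *m (A *m Rs q z)) / w = \tr (specproj A w *m Rs q z).
  rewrite mulmxA (specproj_comm A w) (mul_specproj w1 hd ht).
  by rewrite -scalemxAl mxtraceZ mulrC mulKf.
rewrite etr in hlim.
(* Along these indices the truncations have size (m + 1) q, a whole number of periods. A subsequence
   suffices, since [is_dos] supplies convergence of the full sequence. *)
pose idx m := (2 * (m.+1 * h).-1).+1.
have hidx m : (2 * (m.+1 * h).-1).+2 = (m.+1 * q)%N.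
  rewrite -doubleMr; have : (0 < m.+1 * h)%N by rewrite muln_gt0.
  by move: (m.+1 * h)%N => k; lia.
have h1 : eigen_average alpha lambda (idx m) (plane_kernel z) @[m --> \oo] -->
    Rintegral nu (angles R) (fun t => plane_kernel z (cis t)).
  apply: (@cvg_comp _ _ _ idx (fun n => eigen_average alpha lambda n (plane_kernel z)) _ \oo).
    apply/cvgnyPge => M; near=> m; rewrite /idx.
    have : (M <= m)%N by near: m; exact: nbhs_infty_ge.
    have : (m <= m.+1 * h)%N by rewrite (leq_trans (leqnSn m))// leq_pmulr.
    lia.
  exact: (hnu _ (plane_kernel_cont z1)).
have h2 : eigen_average alpha lambda (idx m) (plane_kernel z) @[m --> \oo] -->
    complex.Re (\tr (specproj A w *m Rs q z)) / h%:R.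
  have -> : (fun m => eigen_average alpha lambda (idx m) (plane_kernel z)) =
      fun m => complex.Re (y m.+1 0 0 / (m.+1%:R * (Z (m.+1 * q) z *m ones) 0 0)) / h%:R.
    apply/funext => m; rewrite /idx average_kernel// hidx.
    have Re_real (r : R) (u : C) : complex.Re (r%:C * u) = r * complex.Re u.
      by case: u => a b /=; rewrite mul0r subr0.
    rewrite -/(y m.+1) mulrC [RHS]mulrC -Re_real; congr complex.Re.
    have hh : h%:R != 0 :> C by rewrite pnatr_eq0 -lt0n.
    have -> : (m.+1 * q)%:R = 2 * m.+1%:R * h%:R :> C.
      by rewrite -doubleMr -mul2n natrM natrM mulrA.
    have t0 : (Z (m.+1 * q) z *m ones) 0 0 != 0.
      rewrite -doubleMr; apply: char_top_neq0 => //; by rewrite muln_gt0.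
    have m0 : m.+1%:R != 0 :> C by rewrite pnatr_eq0.
    rewrite fmorphV rmorph_nat; move: (m.+1%:R) (h%:R) m0 hh => M H m0 hh.
    by field; rewrite m0 hh t0.
  by apply: cvgM; [exact: (cvg_Re hlim)|exact: cvg_cst].
have h3 := cvg_unique _ h1 h2.
rewrite -h3 //; apply: eq_Rintegral => t _; by rewrite plane_kernel_cis.
Unshelve. all: by end_near.
Qed.

End Dos.
End LogDerivative.

(** * Inversion of the Poisson integral *)

Section PoissonKernel.
Variable R : realType.
Local Notation C := R[i].
Local Notation "x %:C" := (real_complex R x).
Local Notation pi := (@trigo.pi R).
Implicit Types (r x d t : R).

Definition pkernel (r x : R) : R := (r ^+ 2 - 1) / (r ^+ 2 + 1 - 2 * r * cos x).

Lemma pkernel_den r x : 1 < r -> (r - 1) ^+ 2 <= r ^+ 2 + 1 - 2 * r * cos x.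
Proof.
move=> r1; have := cos_le1 x => h.
have : r * cos x <= r * 1 by rewrite ler_pM2l//; lra.
by rewrite sqrrB; lra.
Qed.

Lemma pkernel_den_gt0 r x : 1 < r -> 0 < r ^+ 2 + 1 - 2 * r * cos x.
Proof.
by move=> r1; apply: lt_le_trans (pkernel_den x r1); rewrite exprn_gt0// subr_gt0.
Qed.

Lemma sqr_gt1 (r : R) : 1 < r -> 0 < r ^+ 2 - 1.
Proof. by move=> r1; rewrite subr_gt0 expr_gt1// ltW// (lt_trans ltr01). Qed.

Lemma pkernel_ge0 r x : 1 < r -> 0 <= pkernel r x.
Proof.
by move=> r1; rewrite /pkernel divr_ge0// ltW//; [exact: sqr_gt1|exact: pkernel_den_gt0].
Qed.

Lemma pkernel_cont r : 1 < r -> continuous (pkernel r).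
Proof.
move=> r1 x; rewrite /pkernel; apply: cvgM; first exact: cvg_cst.
apply: cvgV; first by rewrite gt_eqF// pkernel_den_gt0.
apply: cvgB; first exact: cvg_cst.
by apply: cvgM; [exact: cvg_cst|exact: continuous_cos].
Qed.

Lemma cos_le_far d x : 0 < d -> d <= pi -> d <= `|x| <= 2 * pi - d -> cos x <= cos d.
Proof.
move=> d0 dpi /andP[h1 h2].
have hx : cos x = cos `|x| by case: (ler0P x) => // _; rewrite cosN.
have key y : d <= y <= pi -> cos y <= cos d.
  move=> /andP[dy ypi]; rewrite leNgt; apply/negP; rewrite ltr_cos; first by rewrite ltNge dy.
  - by rewrite in_itv/=; apply/andP; split; lra.
  - by rewrite in_itv/=; apply/andP; split; lra.
rewrite hx; case: (leP `|x| pi) => h; first by apply: key; rewrite h1 h.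
have -> : cos `|x| = cos (2 * pi - `|x|).
  by rewrite cosB mulr_natl cos2pi sin2pi mul1r mul0r addr0.
by apply: key; apply/andP; split; lra.
Qed.

Lemma pkernel_far r d x : 1 < r -> 0 < d -> d <= pi -> d <= `|x| <= 2 * pi - d ->
  cos d < 1 -> pkernel r x <= (r ^+ 2 - 1) / (2 * (1 - cos d)).
Proof.
move=> r1 d0 dpi hx cd; have hc := cos_le_far d0 dpi hx.
rewrite /pkernel ler_pM2l ?sqr_gt1// lef_pV2 ?posrE ?pkernel_den_gt0//; last first.
  by rewrite mulr_gt0// subr_gt0.
have h : r * cos x <= r * cos d by rewrite ler_pM2l//; lra.
have h2 : 0 <= (r - 1) * (1 - cos d) by rewrite mulr_ge0//; lra.
have h3 := sqr_ge0 (r - 1); rewrite sqrrB in h3.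
by lra.
Qed.

Lemma cos_lt1 d : 0 < d -> d <= pi -> cos d < 1.
Proof.
move=> d0 dpi; rewrite -cos0 ltr_cos// in_itv/= ?lexx ?pi_ge0 ?(ltW d0) ?dpi//.
Qed.

Lemma pkernel_half r x : 1 < r ->
  pkernel r (x *+ 2) = (r ^+ 2 - 1) / ((r - 1) ^+ 2 * cos x ^+ 2 + (r + 1) ^+ 2 * sin x ^+ 2).
Proof.
move=> r1; rewrite /pkernel; congr (_ / _).
by rewrite cos_mulr2n sin2cos2; ring.
Qed.

(** The half-angle primitive of the Poisson kernel. It is valid only for |x - t| < pi, which is why
    the arcs below are short. *)
Definition pprim (r t x : R) : R := 2 * atan ((r + 1) / (r - 1) * tan ((x - t) / 2)).

Lemma is_derive_half x t : is_derive x (1 : R) (fun y => (y - t) / 2) (1 / 2).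
Proof.
have h := is_deriveZ (2^-1) (is_deriveB (is_derive_id x (1:R)) (is_derive_cst t x (1:R))).
rewrite (_ : (fun y => _) = 2^-1 \*: (id - cst t)); last by apply/funext => y; rewrite /= mulrC.
rewrite (_ : 1 / 2 = 2^-1 *: (1 - 0)) //; by rewrite subr0 mulrC.
Qed.

Lemma is_derive_pprim r t x : 1 < r -> - pi < x - t < pi ->
  is_derive x (1 : R) (pprim r t) (pkernel r (x - t)).
Proof.
move=> r1 /andP[h1 h2]; set k := (r + 1) / (r - 1); set u := (x - t) / 2.
have hc : 0 < cos u by apply: cos_gt0_pihalf; apply/andP; split; rewrite /u; lra.
have d2 : is_derive u (1 : R) tan (cos u ^- 2) := is_derive_tan (lt0r_neq0 hc).
have d3 := is_deriveZ k (@is_derive1_comp _ tan (fun y => (y - t) / 2) x _ _ d2 (is_derive_half x t)).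
have d4 := is_deriveZ 2 (@is_derive1_comp _ atan (k \*: (tan \o (fun y => (y - t) / 2))) x _ _
  (is_derive1_atan (k * tan u)) d3).
have e1 : pprim r t = 2 \*: (atan \o (k \*: (tan \o (fun y => (y - t) / 2)))) by [].
rewrite e1; suff <- : 2 *: ((1 + (k * tan u) ^+ 2)^-1 * (k *: (cos u ^- 2 * (1 / 2)))) =
   pkernel r (x - t) by exact: d4.
have -> : x - t = u *+ 2 by rewrite /u mulr2n; lra.
rewrite pkernel_half// /tan /k /GRing.scale /=.
have hcs := cos2Dsin2 u; move: (cos u) (sin u) hc hcs => c s c0 hcs.
have r0 : 0 < r - 1 by lra.
have den : 0 < (r - 1) ^+ 2 * c ^+ 2 + (r + 1) ^+ 2 * s ^+ 2.
  by apply: ltr_pwDl; [rewrite mulr_gt0 ?exprn_gt0|rewrite mulr_ge0 ?sqr_ge0].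
by field; rewrite !exprMn !gt_eqF.
Qed.

Lemma integral_pkernel r t a b : 1 < r -> a < b -> - pi < a - t -> b - t < pi ->
  (\int[lebesgue_measure]_(x in `[a, b]) (pkernel r (x - t))%:E)%E =
  (pprim r t b - pprim r t a)%:E.
Proof.
move=> r1 ab ha hb.
have cp (x : R) : a <= x <= b -> {for x, continuous (pprim r t)}.
  move=> /andP[ax xb]; have d : derivable (pprim r t) x 1.
    by have [] := @is_derive_pprim r t x r1 ltac:(apply/andP; split; lra).
  by apply/differentiable_continuous/derivable1_diffP.
rewrite EFinB; apply: continuous_FTC2 => //.
- apply: continuous_subspaceT => x.
  apply: (@continuous_comp _ _ _ (fun y => y - t) (pkernel r)); last exact: pkernel_cont.
  by apply: cvgB; [exact: cvg_id|exact: cvg_cst].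
- split.
  + move=> x; rewrite in_itv/= => /andP[ax xb].
    by have [] := @is_derive_pprim r t x r1 ltac:(apply/andP; split; lra).
  + by apply: cvg_at_right_filter; apply: cp; rewrite lexx ltW.
  + by apply: cvg_at_left_filter; apply: cp; rewrite lexx andbT ltW.
- move=> x; rewrite in_itv/= => /andP[ax xb].
  have [_ <-] := @is_derive_pprim r t x r1 ltac:(apply/andP; split; lra).
  by rewrite derive1E.
Qed.

Lemma pprim_lt r t x : - pi < pprim r t x < pi.
Proof.
rewrite /pprim; set y := atan _.
have := atan_ltpi2 ((r + 1) / (r - 1) * tan ((x - t) / 2)).
have := atan_gtNpi2 ((r + 1) / (r - 1) * tan ((x - t) / 2)).
by rewrite -/y => h1 h2; apply/andP; split; lra.
Qed.

Definition rad (n : nat) : R := 1 + n.+1%:R^-1.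

Lemma rad_gt1 n : 1 < rad n.
Proof. by rewrite ltrDl invr_gt0. Qed.

Lemma rad_le2 n : rad n <= 2.
Proof. by rewrite -[2]/(1 + 1) lerD2l invf_le1// ler1n. Qed.

Lemma cvg_rad : rad n @[n --> \oo] --> (1 : R).
Proof.
rewrite -[X in _ --> X]addr0; apply: cvgD; first exact: cvg_cst.
exact: cvg_harmonic.
Qed.

Lemma cvg_pprim_pos t x : 0 < x - t < pi -> pprim (rad n) t x @[n --> \oo] --> pi.
Proof.
move=> /andP[h1 h2].
have -> : pi = 2 * (pi / 2) by lra.
rewrite /pprim; apply: cvgM; first exact: cvg_cst.
apply: (cvg_comp _ _ _ (@cvgy_atan R)).
have tp : 0 < tan ((x - t) / 2).
  have u1 : 0 < (x - t) / 2 < pi by apply/andP; split; lra.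
  have u2 : - (pi / 2) < (x - t) / 2 < pi / 2 by apply/andP; split; lra.
  by rewrite /tan divr_gt0// ?sin_gt0_pi// cos_gt0_pihalf.
apply/cvgryPge => M; near=> n.
have -> : (rad n + 1) / (rad n - 1) = 2 * n.+1%:R + 1.
  have N0 : n.+1%:R != 0 :> R by rewrite pnatr_eq0.
  rewrite /rad (addrC 1) addrK invrK; move: (n.+1%:R) N0 => N N0; by field.
rewrite -ler_pdivrMr//; have : M / tan ((x - t) / 2) <= n%:R.
  by near: n; exact: nbhs_infty_ger.
by rewrite -natr1 => ?; have : 0 <= n%:R :> R by []; lra.
Unshelve. all: by end_near.
Qed.

Lemma pprimN r t x : pprim r x t = - pprim r t x.
Proof.
rewrite /pprim -[t - x]opprB mulNr tanN mulrN atanN mulrN//.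
Qed.

End PoissonKernel.

Section PoissonInversion.
Variable R : realType.
Local Notation pi := (@trigo.pi R).
Implicit Types (r x d t a b : R).
Local Notation leb := (@lebesgue_measure R).

Lemma norm_leI x y : - y <= x -> x <= y -> `|x| <= y.
Proof. by move=> h1 h2; rewrite ler_norml h1 h2. Qed.

Lemma lebesgue_itvcc a b : a < b -> leb `[a, b] = (b - a)%:E.
Proof. by move=> ab; rewrite lebesgue_measure_itv/= lte_fin ab. Qed.

Lemma integral_le_cst (f : R -> \bar R) a b c : a < b -> 0 <= c ->
  measurable_fun `[a, b] f -> (forall x, a <= x <= b -> (0 <= f x <= c%:E)%E) ->
  (\int[leb]_(x in `[a, b]) f x <= (c * (b - a))%:E)%E.
Proof.
move=> ab c0 mf h; rewrite EFinM -lebesgue_itvcc//.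
rewrite -[leRHS](integral_cst leb)//; apply: ge0_le_integral => //.
- by move=> x; rewrite /= in_itv/= => /h/andP[].
- by move=> x; rewrite /= in_itv/= => /h/andP[].
Qed.

Lemma integral_ge_cst (f : R -> \bar R) a b c : a < b ->
  measurable_fun `[a, b] f -> (forall x, a <= x <= b -> (0 <= f x)%E) ->
  (forall x, a <= x <= b -> (c%:E <= f x)%E) ->
  ((c * (b - a))%:E <= \int[leb]_(x in `[a, b]) f x)%E.
Proof.
move=> ab mf h0 h; case: (leP 0 c) => c0.
  rewrite EFinM -lebesgue_itvcc// -[leLHS](integral_cst leb)//.
  apply: ge0_le_integral => //; try by move=> x; rewrite /= in_itv/= => /h0.
apply: (@le_trans _ _ 0%E); first by rewrite lee_fin nmulr_rle0// subr_ge0 ltW.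
by apply: integral_ge0 => x; rewrite /= in_itv/= => /h0.
Qed.

Lemma measurable_pkernel r t (D : set R) : 1 < r -> measurable D ->
  measurable_fun D (fun x => (pkernel r (x - t))%:E).
Proof.
move=> r1 mD; apply/measurable_EFinP; apply: measurable_funS (continuous_measurable_fun _) => //.
move=> x; apply: (@continuous_comp _ _ _ (fun y => y - t) (pkernel r)); last exact: pkernel_cont.
by apply: cvgB; [exact: cvg_id|exact: cvg_cst].
Qed.

Definition arcmass r a b t : \bar R := (\int[leb]_(x in `[a, b]) (pkernel r (x - t))%:E)%E.

Lemma arcmass_ge0 r a b t : 1 < r -> (0 <= arcmass r a b t)%E.
Proof. by move=> r1; apply: integral_ge0 => x _; rewrite lee_fin pkernel_ge0. Qed.

Lemma arcmass_far r a b t d : 1 < r -> a < b -> 0 < d -> d <= pi ->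
  (forall x, a <= x <= b -> d <= `|x - t| <= 2 * pi - d) ->
  (arcmass r a b t <= ((r ^+ 2 - 1) / (2 * (1 - cos d)) * (b - a))%:E)%E.
Proof.
move=> r1 ab d0 dpi h; have cd := cos_lt1 d0 dpi.
apply: integral_le_cst => //.
- apply: divr_ge0; apply: ltW; first exact: sqr_gt1.
  by rewrite mulr_gt0// subr_gt0.
- exact: measurable_pkernel.
- move=> x hx; rewrite !lee_fin pkernel_ge0//=; apply: pkernel_far => //; exact: h.
Qed.

Lemma arc_near a b t : a < b -> b - a <= pi / 4 -> `|t - (a + b) / 2| <= pi / 2 -> - pi < a - t /\ b - t < pi.
Proof.
have p := @pi_gt0 R; rewrite ler_norml => h1 h2 /andP[h3 h4].
by split; lra.
Qed.

(** The margin guards against wrapping around: for t in [0, 2 pi[ and x in the arc it gives |x - t|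
    <= 2 pi - d. *)
Lemma arc_room a b : 0 < a -> b < 2 * pi -> exists d, [/\ 0 < d, d <= pi / 4, d <= a & d <= 2 * pi - b].
Proof.
move=> a0 b2; have p := @pi_gt0 R; exists (Num.min (pi / 4) (Num.min a (2 * pi - b))).
split; rewrite ?lt_min ?ge_min ?lexx ?orbT//.
by rewrite a0 divr_gt0//= subr_gt0.
Qed.

(** The dominating constant for the passage to the limit. For t near the arc the mass is a
    difference of two values of [pprim], each in ]-pi, pi[; for t far from it the kernel itself is
    bounded. *)
Lemma arcmass_bound a b : 0 < a -> a < b -> b < 2 * pi -> b - a <= pi / 4 -> exists B, forall n t, 0 <= t < 2 * pi ->
  (arcmass (rad R n) a b t <= B%:E)%E.
Proof.
move=> a0 ab b2 bapi; have p := @pi_gt0 R; have [d0 [h1 h2 h3 h4]] := arc_room a0 b2.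
have cd := cos_lt1 h1 ltac:(lra).
(* The 3 bounds r^2 - 1 for r <= 2. *)
pose B1 := 3 / (2 * (1 - cos d0)) * (b - a).
have B10 : 0 <= B1.
  by rewrite mulr_ge0 ?divr_ge0 ?mulr_ge0 ?subr_ge0 ?ltW.
exists (2 * pi + B1) => n t /andP[t0 t2].
have r1 := rad_gt1 R n; have r2 := rad_le2 R n.
case: (leP `|t - (a + b) / 2| (pi / 2)) => ht.
  have [q1 q2] := arc_near ab bapi ht.
  rewrite /arcmass integral_pkernel//.
  rewrite lee_fin; have /andP[g1 g2] := pprim_lt (rad R n) t a.
  have /andP[g3 g4] := pprim_lt (rad R n) t b; lra.
apply: le_trans (@arcmass_far _ _ _ _ d0 r1 ab h1 ltac:(lra) _) _.
  move=> x /andP[ax xb]; move: ht; rewrite ltr_normr => /orP ht.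
  have hl : `|x - t| <= 2 * pi - d0 by clear ht B1 B10; apply: norm_leI; lra.
  rewrite hl andbT ler_normr; apply/orP; clear hl B1 B10; case: ht => ht; [right|left]; lra.
rewrite lee_fin; apply: (@le_trans _ _ B1); last lra.
apply: ler_wpM2r; first by rewrite subr_ge0 ltW.
apply: ler_wpM2r; first by rewrite invr_ge0 mulr_ge0// subr_ge0 ltW.
have : rad R n ^+ 2 <= 2 ^+ 2 by rewrite ler_pXn2r ?nnegrE//; lra.
lra.
Qed.

Lemma arcmass_cvg_in a b t : a < b -> b - a <= pi / 4 -> a < t < b ->
  arcmass (rad R n) a b t @[n --> \oo] --> (2 * pi)%:E.
Proof.
have p := @pi_gt0 R; move=> ab bapi /andP[at_ tb].
have -> : (fun n => arcmass (rad R n) a b t) =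
   fun n => (pprim (rad R n) t b + pprim (rad R n) a t)%:E.
  have [q1 q2] : - pi < a - t /\ b - t < pi by apply: (arc_near ab bapi); apply: norm_leI; lra.
  apply/funext => n; rewrite /arcmass integral_pkernel ?rad_gt1//.
  by rewrite (pprimN _ t a).
apply: cvg_EFin; first by near=> n.
have -> : 2 * pi = pi + pi by lra.
by apply: cvgD; apply: cvg_pprim_pos; apply/andP; split; lra.
Unshelve. all: by end_near.
Qed.

Lemma arcmass_cvg_out a b t : 0 < a -> a < b -> b < 2 * pi -> b - a <= pi / 4 -> 0 <= t < 2 * pi -> (t < a) || (b < t) ->
  arcmass (rad R n) a b t @[n --> \oo] --> 0%E.
Proof.
have p := @pi_gt0 R; move=> a0 ab b2 bapi; have [d0 [h1 h2 h3 h4]] := arc_room a0 b2.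
move=> /andP[t0 t2] hab.
pose e := if t < a then a - t else t - b.
have e0 : 0 < e by rewrite /e; case: ifP hab => [h _|h /= h']; rewrite subr_gt0.
pose d := Num.min e d0.
have dd : 0 < d by rewrite lt_min e0.
have de : d <= e by rewrite ge_min lexx.
have dd0 : d <= d0 by rewrite ge_min lexx orbT.
have hx x : a <= x <= b -> d <= `|x - t| <= 2 * pi - d.
  move=> /andP[ax xb]; apply/andP; split; last by apply: norm_leI; lra.
  move: de; rewrite /e ler_normr; case: ifP hab => [h _|h /= h'] he; apply/orP; [left|right]; lra.
have cd := cos_lt1 dd ltac:(lra).
apply: (@squeeze_cvge _ _ _ _ (fun=> 0%E) _
  (fun n => ((rad R n ^+ 2 - 1) / (2 * (1 - cos d)) * (b - a))%:E)).
- near=> n; rewrite arcmass_ge0 ?rad_gt1//=.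
  by apply: arcmass_far; rewrite ?rad_gt1//; lra.
- exact: cvg_cst.
- apply: cvg_EFin; first by near=> n.
  rewrite -(mul0r (b - a)); apply: cvgM; last exact: cvg_cst.
  rewrite -(mul0r (2 * (1 - cos d))^-1); apply: cvgM; last exact: cvg_cst.
  rewrite -[X in _ --> X](subrr (1 : R)); apply: cvgB; last exact: cvg_cst.
  rewrite -[X in _ --> X](mulr1 1) (_ : (fun n => rad R n ^+ 2) = rad R \* rad R).
    exact: (cvgM (@cvg_rad R) (@cvg_rad R)).
  by apply/funext => n; rewrite expr2.
Unshelve. all: by end_near.
Qed.

End PoissonInversion.

Section Inversion.
Variable R : realType.
Local Notation pi := (@trigo.pi R).
Local Notation leb := (@lebesgue_measure R).
Variable nu : probability (measurableTypeR R) R.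
Implicit Types (r x d t a b : R).

Definition poisson r x : R := Rintegral nu (angles R) (fun t => pkernel r (x - t)).

Lemma pkernel_le r x : 1 < r -> pkernel r x <= (r ^+ 2 - 1) / (r - 1) ^+ 2.
Proof.
move=> r1; rewrite /pkernel ler_pM2l ?sqr_gt1// lef_pV2 ?posrE ?pkernel_den_gt0//.
  exact: pkernel_den.
by rewrite exprn_gt0// subr_gt0.
Qed.

Lemma poissonE r x : 1 < r ->
  (poisson r x)%:E = (\int[nu]_(t in angles R) (pkernel r (x - t))%:E)%E.
Proof.
move=> r1; rewrite /poisson /Rintegral fineK//.
apply: integrable_fin_num; first exact: measurable_angles.
apply: (@Rintegrable_bounded _ nu (fun t => pkernel r (x - t)) ((r ^+ 2 - 1) / (r - 1) ^+ 2)).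
  move=> t; apply: (@continuous_comp _ _ _ (fun y => x - y) (pkernel r)); last exact: pkernel_cont.
  by apply: cvgB; [exact: cvg_cst|exact: cvg_id].
by move=> t; rewrite ger0_norm ?pkernel_ge0// pkernel_le.
Qed.

Definition joint r a b : R * R -> \bar R :=
  (fun p => (pkernel r (p.2 - p.1))%:E) \_ (angles R `*` `[a, b]).

Lemma joint_ge0 r a b p : 1 < r -> (0 <= joint r a b p)%E.
Proof. by move=> r1; rewrite /joint patchE; case: ifP => // _; rewrite lee_fin pkernel_ge0. Qed.

Lemma measurable_joint r a b : 1 < r ->
  measurable_fun [set: measurableTypeR R * measurableTypeR R] (joint r a b).
Proof.
move=> r1; have mD : measurable (angles R `*` `[a, b] : set (measurableTypeR R * measurableTypeR R)).
  by apply: measurableX; [exact: measurable_angles|exact: measurable_itv].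
apply: (measurable_restrictT _ mD).1.
apply: (@measurable_funS _ _ _ _ setT) => //.
apply/measurable_EFinP; apply: measurableT_comp.
  exact: continuous_measurable_fun (pkernel_cont r1).
by apply: measurable_funB; [exact: measurable_snd|exact: measurable_fst].
Qed.

Lemma joint_F r a b t :
  fubini_F leb (joint r a b) t = ((fun t => arcmass r a b t) \_ (angles R)) t.
Proof.
rewrite /fubini_F /joint [RHS]patchE; case: ifPn => ht.
  rewrite /arcmass [RHS]integral_mkcond; apply: eq_integral => x _.
  rewrite !patchE; congr (if _ then _ else _).
  by apply/idP/idP; rewrite !inE/= => h; [case: h|split=> //; rewrite inE in ht].
rewrite -[RHS](integral0 leb setT); apply: eq_integral => x _.
rewrite patchE; case: ifPn => //; rewrite inE => -[/= h _].
by case/negP: ht; rewrite inE.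
Qed.

Lemma joint_G r a b x : 1 < r ->
  fubini_G nu (joint r a b) x = ((fun x => (poisson r x)%:E) \_ `[a, b]) x.
Proof.
move=> r1; rewrite /fubini_G /joint [RHS]patchE; case: ifPn => hx.
  rewrite poissonE// [RHS]integral_mkcond; apply: eq_integral => t _.
  rewrite !patchE; congr (if _ then _ else _).
  by apply/idP/idP; rewrite !inE/= => h; [case: h|split=> //; rewrite inE in hx].
rewrite -[RHS](integral0 nu setT); apply: eq_integral => t _.
rewrite patchE; case: ifPn => //; rewrite inE => -[/= _ h].
by case/negP: hx; rewrite inE.
Qed.

Lemma measurable_arcmass r a b : 1 < r ->
  measurable_fun (angles R : set (measurableTypeR R)) (arcmass r a b).
Proof.
move=> r1; apply: (@measurable_restrictT _ _ (measurableTypeR R) _ _ (arcmass r a b) (@measurable_angles R)).2.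
rewrite (_ : _ \_ _ = fubini_F leb (joint r a b)); last by apply/funext => t; rewrite joint_F.
apply: measurable_fun_fubini_tonelli_F; first exact: measurable_joint.
by move=> p; apply: joint_ge0.
Qed.

Lemma measurable_poisson r a b : 1 < r ->
  measurable_fun (`[a, b] : set (measurableTypeR R)) (fun x => (poisson r x)%:E).
Proof.
move=> r1; apply: (@measurable_restrictT _ _ (measurableTypeR R) _ _ (fun x => (poisson r x)%:E) (measurable_itv `[a, b])).2.
rewrite (_ : _ \_ _ = fubini_G nu (joint r a b)); last by apply/funext => t; rewrite joint_G.
apply: measurable_fun_fubini_tonelli_G; first exact: measurable_joint.
by move=> p; apply: joint_ge0.
Qed.

Lemma poisson_fubini r a b : 1 < r ->
  (\int[leb]_(x in `[a, b]) (poisson r x)%:E)%E =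
  (\int[nu]_(t in angles R) arcmass r a b t)%E.
Proof.
move=> r1; rewrite integral_mkcond [RHS]integral_mkcond.
have h := @fubini_tonelli _ _ _ _ R nu leb (joint r a b) (measurable_joint a b r1)
  (fun p => joint_ge0 a b p r1).
transitivity (\int[leb]_x fubini_G nu (joint r a b) x)%E.
  by apply: eq_integral => x _; rewrite joint_G.
rewrite -[LHS]h; apply: eq_integral => x _; exact: joint_F.
Qed.

Hypothesis nul : nu `<< leb.

Lemma nu_set1 a : nu [set a] = 0%E.
Proof.
by apply: (null_content_dominatesP nu leb).1 => //; exact: lebesgue_measure_set1.
Qed.

(** The arc masses tend to 2 pi inside the arc and to 0 outside. At the two end points the limit is
    neither, but absolute continuity makes these points null for [nu]. *)
Lemma cvg_arcmass_integral a b : 0 < a -> a < b -> b < 2 * pi -> b - a <= pi / 4 ->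
  (\int[nu]_(t in angles R) arcmass (rad R n) a b t)%E @[n --> \oo] -->
  ((2 * pi)%:E * nu `]a, b[%classic)%E.
Proof.
move=> a0 ab b2 bapi; have p := @pi_gt0 R.
have [B hB] := arcmass_bound a0 ab b2 bapi.
pose g (t : R) : \bar R := ((2 * pi)%:E * (\1_(`]a, b[%classic) t)%:E)%E.
have mg : measurable_fun (angles R : set (measurableTypeR R)) g.
  apply: emeasurable_funM; first exact: measurable_cst.
  by apply/measurable_EFinP; exact: measurable_indic.
have -> : ((2 * pi)%:E * nu `]a, b[%classic)%E = (\int[nu]_(t in angles R) g t)%E.
  rewrite ge0_integralZl//; first last.
  - by rewrite lee_fin; lra.
  - by apply/measurable_EFinP; exact: measurable_indic.
  - exact: measurable_angles.
  rewrite integral_indic//; last exact: measurable_angles.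
  congr (_ * nu _)%E; apply/seteqP; split => [t|t []//].
  rewrite /= /angles /= !in_itv/= => /andP[h1 h2]; split; rewrite ?h1//.
  by apply/andP; split; lra.
have [] // := @dominated_convergence _ _ R nu (angles R) (@measurable_angles R)
  (fun n t => arcmass (rad R n) a b t) g (cst B%:E).
- by move=> n; apply: measurable_arcmass; exact: rad_gt1.
- exists [set a; b]; split.
  + by apply: measurableU; exact: measurable_set1.
  + apply/eqP; rewrite eq_le measure_ge0 andbT.
    have : (nu ([set a] `|` [set b]) <= nu [set a] + nu [set b])%E.
      by apply: measureU2; exact: measurable_set1.
    by rewrite !nu_set1 adde0.
  move=> t /= ht; apply: contrapT => /not_orP[ta tb]; apply: ht => ht.
  move: ht; rewrite /angles /= in_itv/= => ht.
  case: (ltP a t) => at_; last first.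
    have -> : g t = 0%E.
      rewrite /g indicE memNset ?mule0// /= in_itv/= => /andP[]; lra.
    apply: arcmass_cvg_out => //; apply/orP; left.
    by rewrite lt_neqAle at_ andbT; apply/eqP.
  case: (ltP t b) => tb'; last first.
    have -> : g t = 0%E.
      rewrite /g indicE memNset ?mule0// /= in_itv/= => /andP[]; lra.
    apply: arcmass_cvg_out => //; apply/orP; right.
    by rewrite lt_neqAle tb' andbT; apply/eqP => h; apply: tb.
  have -> : g t = (2 * pi)%:E.
    by rewrite /g indicE mem_set ?mule1//= in_itv/= at_ tb'.
  by apply: arcmass_cvg_in => //; rewrite at_.
- exact: (finite_measure_integrable_cst nu B (@measurable_angles R)).
- apply: aeW => t n ht; rewrite gee0_abs ?arcmass_ge0 ?rad_gt1//.
  by apply: hB; move: ht; rewrite /angles /= in_itv.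
Qed.

(** Integrating the bound on the Poisson integral over the arc and exchanging the integrals leaves
    the arc masses, whose limit as r decreases to 1 gives 2 pi times the measure of the arc. *)
Lemma interval_estimate a b K e d :
  0 < a -> a < b -> b < 2 * pi -> b - a <= pi / 4 -> 0 < d ->
  (forall r x, 1 < r < 1 + d -> a <= x <= b -> `|poisson r x - K| <= e) ->
  `|2 * pi * fine (nu `]a, b[%classic) - K * (b - a)| <= e * (b - a).
Proof.
move=> a0 ab b2 bapi d0 h.
have hc := cvg_arcmass_integral a0 ab b2 bapi.
have nuf : nu `]a, b[%classic \is a fin_num by exact: fin_num_measure.
rewrite -[nu _](fineK nuf) -EFinM in hc.
have near_d : \forall n \near \oo, 1 < rad R n < 1 + d.
  near=> n; rewrite rad_gt1 /rad/= ltrD2l.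
  by near: n; exact: near_infty_natSinv_lt (PosNum d0).
have P0 r x : 1 < r -> 0 <= poisson r x.
  by move=> r1; apply: Rintegral_ge0 => t _; exact: pkernel_ge0.
have up : (((2 * pi) * fine (nu `]a, b[%classic))%:E <= ((K + e) * (b - a))%:E)%E.
  rewrite -(cvg_lim _ hc)//; apply: lime_le; first by apply/cvg_ex; eexists; exact: hc.
  near=> n.
  have hn : 1 < rad R n < 1 + d by near: n.
  have /andP[r1 _] := hn.
  rewrite -poisson_fubini//.
  have hx x : a <= x <= b -> poisson (rad R n) x <= K + e.
    by move=> hx; have := h _ _ hn hx; rewrite ler_norml => /andP[_]; rewrite lerBlDl.
  apply: integral_le_cst => //.
  - by apply: le_trans (hx a _); [exact: P0|rewrite lexx ltW].
  - exact: measurable_poisson.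
  - by move=> x ax; rewrite !lee_fin P0//= hx.
have lo : (((K - e) * (b - a))%:E <= ((2 * pi) * fine (nu `]a, b[%classic))%:E)%E.
  rewrite -(cvg_lim _ hc)//; apply: lime_ge; first by apply/cvg_ex; eexists; exact: hc.
  near=> n.
  have hn : 1 < rad R n < 1 + d by near: n.
  have /andP[r1 _] := hn.
  rewrite -poisson_fubini//.
  apply: integral_ge_cst => //.
  - exact: measurable_poisson.
  - by move=> x ax; rewrite lee_fin P0.
  - move=> x ax; rewrite lee_fin.
    by have := h _ _ hn ax; rewrite ler_norml => /andP[+ _]; rewrite lerBrDl.
rewrite !lee_fin in up lo.
by apply: norm_leI; lra.
Unshelve. all: by end_near.
Qed.

End Inversion.

(** * Boundary values on the bands *)

Section BandLimit.
Variable R : realType.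
Local Notation C := R[i].
Local Notation "x %:C" := (real_complex R x).
Local Notation pi := (@trigo.pi R).

Section Filter.
Context {T : Type} {F : set_system T} {FF : Filter F}.
Implicit Types (f g : T -> 'M[C]_2) (B D : 'M[C]_2).

Lemma mxcvg_scale_adj2 f B (c : C) : mxcvg F f B ->
  mxcvg F (fun x => c *: adj2 (f x)) (c *: adj2 B).
Proof.
move=> hf i j; rewrite mxE; have -> : (fun x => (c *: adj2 (f x)) i j) =
    fun x => c * adj2 (f x) i j by apply/funext => x; rewrite mxE.
apply: cvgC_M; first exact: cvgC_cst.
case: (ord2P i) => ->; case: (ord2P j) => ->; rewrite /adj2 mxE /=.
- rewrite (_ : (fun x => _) = fun x => f x 1 1); first exact: hf.
  by apply/funext => x; rewrite mxE.
- rewrite (_ : (fun x => _) = fun x => - f x 0 1); first by apply: cvgC_N; exact: hf.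
  by apply/funext => x; rewrite mxE.
- rewrite (_ : (fun x => _) = fun x => - f x 1 0); first by apply: cvgC_N; exact: hf.
  by apply/funext => x; rewrite mxE.
- rewrite (_ : (fun x => _) = fun x => f x 0 0); first exact: hf.
  by apply/funext => x; rewrite mxE.
Qed.

Lemma cvg_mxtrace f B : mxcvg F f B -> \tr (f x) @[x --> F] --> (\tr B : C^o).
Proof.
move=> hf; rewrite tr2E (_ : (fun x => \tr (f x)) = fun x => f x 0 0 + f x 1 1).
  by apply: cvgC_D; exact: hf.
by apply/funext => x; rewrite tr2E.
Qed.

End Filter.

(* [\tr (P *m B)] for the spectral projection [P] of [A] at the eigenvector
   [(1, m)], whose eigenvalue is [A 0 0 + A 0 1 * m]. *)
Definition slopeproj_tr (A B : 'M[C]_2) (m : C) : C :=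
  (\tr (A *m B) - (A 1 1 - A 0 1 * m) * \tr B) / (A 0 0 - A 1 1 + 2 * (A 0 1 * m)).

(** The second eigenvalue w' is 1/w off the circle and conj w on a band; [slopeproj_tr] mentions
    neither, so it is continuous across the circle. *)
Lemma slopeproj_trE (A B : 'M[C]_2) (m w w' : C) :
  \tr A = w + w' -> A 0 0 + A 0 1 * m = w ->
  slopeproj_tr A B m = (\tr (A *m B) - w' * \tr B) / (w - w').
Proof.
rewrite tr2E => ht hm; have e : w' = A 1 1 - A 0 1 * m.
  have : A 0 0 + A 1 1 - (A 0 0 + A 0 1 * m) = w' by rewrite ht hm; ring.
  by move=> <-; ring.
by rewrite /slopeproj_tr -hm e; congr (_ / _); ring.
Qed.

Lemma tr_specproj (A B : 'M[C]_2) w :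
  \tr (specproj A w *m B) = (\tr (A *m B) - w^-1 * \tr B) / (w - w^-1).
Proof.
by rewrite /specproj -scalemxAl mxtraceZ mulmxBl -scalemxAl mul1mx raddfB /= mxtraceZ mulrC.
Qed.

Lemma cvg_slopeproj_tr {T : Type} {F : set_system T} {FF : Filter F}
    (f g : T -> 'M[C]_2) (m : T -> C^o) (A B : 'M[C]_2) (m0 : C) :
  A 0 0 - A 1 1 + 2 * (A 0 1 * m0) != 0 ->
  mxcvg F f A -> mxcvg F g B -> m @ F --> (m0 : C^o) ->
  slopeproj_tr (f x) (g x) (m x) @[x --> F] --> (slopeproj_tr A B m0 : C^o).
Proof.
move=> h0 hf hg hm.
have h01 : f x 0 1 * m x @[x --> F] --> (A 0 1 * m0 : C^o).
  by apply: cvgC_M; [exact: hf|exact: hm].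
apply: cvgC_M.
  apply: cvgC_D; first by apply: cvg_mxtrace; exact: mxcvgM.
  apply: cvgC_N; apply: cvgC_M; last exact: cvg_mxtrace.
  by apply: cvgC_D; [exact: hf|apply: cvgC_N; exact: h01].
apply: cvgC_V; first exact: h0.
apply: cvgC_D; first by apply: cvgC_D; [exact: hf|apply: cvgC_N; exact: hf].
by apply: cvgC_M; [exact: cvgC_cst|exact: h01].
Qed.

Variables alpha lambda : nat -> C.
Hypothesis Ha : forall n, `|alpha n| < 1.
Hypothesis Hl : forall n, `|lambda n| = 1.
Variable h : nat.
Hypothesis h0 : (0 < h)%N.
Hypothesis Hp : cmv_periodic h.*2 alpha lambda.
Local Notation q := h.*2.
Local Notation Z := (Zmx alpha lambda).
Local Notation Rs := (Rsum alpha lambda).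

Lemma mxcvg_Z {T : Type} {F : set_system T} {FF : Filter F} (f : T -> C^o) (z : C) n :
  z != 0 -> f @ F --> (z : C^o) -> mxcvg F (fun x => Z n (f x)) (Z n z).
Proof. by move=> z0 hf i j; exact: cvg_Zmx. Qed.

Lemma mxcvg_Rsum {T : Type} {F : set_system T} {FF : Filter F} (f : T -> C^o) (z : C) n :
  z != 0 -> f @ F --> (z : C^o) -> mxcvg F (fun x => Rs n (f x)) (Rs n z).
Proof.
move=> z0 hf; have hZ k : mxcvg F (fun x => Z k (f x)) (Z k z) by exact: mxcvg_Z.
have hV k : mxcvg F (fun x => Zinv alpha lambda k (f x)) (Zinv alpha lambda k z).
  exact: mxcvg_scale_adj2.
have hc k : mxcvg F (fun x => Zinv alpha lambda k (f x) *m Pi2 R *m Z k (f x))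
    (Zinv alpha lambda k z *m Pi2 R *m Z k z).
  apply: mxcvgM; last exact: hZ.
  by apply: mxcvgM; [exact: hV|exact: mxcvg_cst].
pose step k x := if odd k then 0 else Rstep alpha lambda k x.
have hs k : mxcvg F (fun x => step k (f x)) (step k z).
  rewrite /step; case: (odd k); first exact: (@mxcvg_cst R T F FF 2 0).
  by apply: mxcvgB; exact: hc.
have e0 x : Rs 0 x = 0 by rewrite /Rsum big_ord0.
have eS k x : Rs k.+1 x = Rs k x + step k x by rewrite /Rsum big_ord_recr.
elim: n => [|n IH].
  have -> : (fun x => Rs 0 (f x)) = fun=> 0 by apply/funext => x; exact: e0.
  by rewrite e0; exact: mxcvg_cst.
have -> : (fun x => Rs n.+1 (f x)) = fun x => Rs n (f x) + step n (f x).
  by apply/funext => x; exact: eS.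
by rewrite eS; apply: mxcvgD; [exact: IH|exact: hs].
Qed.

(** For |z| > 1 and the expanding slope this is the Poisson integral of the density of states; on a
    band it is the limit of that integral. The factor 1 / h is 2 / q. *)
Definition kval (z m : C) : R :=
  complex.Re (slopeproj_tr (Z q z) (Rs q z) m) / h%:R.

Definition band_slope (z m : C) : Prop := `|m| < 1 /\ exists w,
  [/\ \tr (Z q z) = w + w^*, w != w^*, Z q z 0 0 + Z q z 0 1 * m = w &
      Z q z 1 0 + Z q z 1 1 * m = w * m].

Lemma band_slope_is_slope z m : band_slope z m -> is_slope (Z q z) m.
Proof. by move=> [m1 [w [_ _ e0 e1]]]; split; [exact: ltW|exists w]. Qed.

Lemma cvg_kval {T : Type} {F : set_system T} {FF : Filter F} (f : T -> C^o)
    (m : T -> C^o) z0 m0 : `|z0| = 1 -> band_slope z0 m0 ->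
  f @ F --> (z0 : C^o) -> (\forall x \near F, is_slope (Z q (f x)) (m x)) ->
  kval (f x) (m x) @[x --> F] --> kval z0 m0.
Proof.
move=> z1 [m1 [w [ht wne e0 e1]]] hf hm; have [z00 _] := unitcJ z1.
have mc : m @ F --> (m0 : C^o) by exact: (slope_cvg Ha Hl z1 hf ht wne e0 e1 m1 hm).
apply: cvgM; last exact: cvg_cst.
apply: cvg_Re; apply: cvg_slopeproj_tr; [|exact: mxcvg_Z|exact: mxcvg_Rsum|exact: mc].
have -> : Z q z0 0 0 - Z q z0 1 1 + 2 * (Z q z0 0 1 * m0) = w - w^*.
  have -> : w - w^* = w + w - (w + w^*) by ring.
  by rewrite -ht tr2E -e0; ring.
by rewrite subr_eq0.
Qed.

Lemma outer_slope (nu : probability (measurableTypeR R) R) z :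
  is_dos alpha lambda nu -> 1 < normc z -> exists m, is_slope (Z q z) m /\
  Rintegral nu (angles R) (fun t => (normc z ^+ 2 - 1) / normc (z - cis t) ^+ 2) = kval z m.
Proof.
move=> hnu z1; have z1' : 1 < `|z| by rewrite normC_normc ltcR.
have z0 : z != 0 by rewrite -normr_gt0 (lt_trans ltr01).
have zn : `|z| != 1 by rewrite gt_eqF.
have [w w1 ht] := monodromy_eigenvalues Ha Hl h0 z0 zn.
have hd : \det (Z q z) = 1 by rewrite (det_Z Ha Hl)// -signr_odd odd_double.
have w0 : w != 0 by rewrite -normr_gt0 (lt_trans ltr01).
have [|U U0 hU] := @eigvec_exists _ (Z q z) w w^-1 _ ht; first by rewrite hd divff.
have hj := eig_jform_gt0 Ha Hl h0 z0 U0 hU (or_intror (conj z1' w1)).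
have [_ m1 e0 e1] := jform_gt0_slope hj hU.
exists (U 1 0 / U 0 0); split; first by split; [exact: ltW|exists w].
rewrite (dos_poisson Ha Hl h0 Hp z1 hnu w1 ht) /kval tr_specproj.
by rewrite (slopeproj_trE _ ht e0).
Qed.

Lemma poisson_kernelE r x t : 1 < r ->
  pkernel r (x - t) = (normc (r%:C * cis x) ^+ 2 - 1) / normc (r%:C * cis x - cis t) ^+ 2.
Proof.
move=> r1; rewrite /pkernel normcM normc_cis mulr1 /= expr0n /= addr0 sqrtr_sqr.
rewrite real_normK ?num_real//; congr (_ / _).
rewrite sqr_sqrtr ?addr_ge0 ?sqr_ge0// cosB.
have h1 := cos2Dsin2 x; have h2 := cos2Dsin2 t.
move: (cos x) (sin x) (cos t) (sin t) h1 h2 => c s c' s' h1 h2.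
have -> : r ^+ 2 + 1 = r ^+ 2 * (c ^+ 2 + s ^+ 2) + (c' ^+ 2 + s' ^+ 2).
  by rewrite h1 h2 mulr1.
ring.
Qed.

Lemma poisson_kval (nu : probability (measurableTypeR R) R) r x :
  is_dos alpha lambda nu -> 1 < r ->
  exists m, is_slope (Z q (r%:C * cis x)) m /\ poisson nu r x = kval (r%:C * cis x) m.
Proof.
move=> hnu r1; have hz : 1 < normc (r%:C * cis x).
  rewrite normcM normc_cis mulr1 /= expr0n /= addr0 sqrtr_sqr.
  by rewrite ger0_norm// ltW// (lt_trans ltr01).
have [m [hm e]] := outer_slope hnu hz; exists m; split => //.
by rewrite -e /poisson; apply: eq_Rintegral => t _; exact: poisson_kernelE.
Qed.

(** The limit is taken jointly in (r, x), not along one radius, because [interval_estimate] needs a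
    bound uniform over an arc. *)
Lemma poisson_limit (nu : probability (measurableTypeR R) R) t0 m0 e :
  is_dos alpha lambda nu -> band_slope (cis t0) m0 -> 0 < e ->
  exists2 d, 0 < d & forall r x, 1 < r < 1 + d -> `|x - t0| < d ->
    `|poisson nu r x - kval (cis t0) m0| <= e.
Proof.
move=> hnu hb e0.
pose F : set_system (R * R) := within (fun p => 1 < p.1) (filter_prod (nbhs (1 : R)) (nbhs t0)).
pose f (p : R * R) : C^o := p.1%:C * cis p.2.
have hfst : p.1 @[p --> F] --> (1 : R).
  by move=> A hA; exact: (@cvg_within _ _ _ _ (fst @^-1` A) (@cvg_fst _ _ (nbhs (1 : R)) (nbhs t0) _ A hA)).
have hsnd : p.2 @[p --> F] --> t0.
  by move=> A hA; exact: (@cvg_within _ _ _ _ (snd @^-1` A) (@cvg_snd _ _ (nbhs (1 : R)) (nbhs t0) _ A hA)).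
have hf : f @ F --> (cis t0 : C^o).
  rewrite -[X in _ --> X]mul1r; apply: cvgC_M; last exact: (cvg_cis hsnd).
  exact: (cvg_realC hfst).
(* The slopes are picked point by point with no regularity; the stability estimate makes any such
   choice converge. *)
have /choice[m hm] : forall p : R * R, exists m, 1 < p.1 ->
    is_slope (Z q (f p)) m /\ poisson nu p.1 p.2 = kval (f p) m.
  move=> p; case: (ltP 1 p.1) => p1; last by exists 0.
  by have [m hm] := poisson_kval p.2 hnu p1; exists m.
have ms : \forall p \near F, is_slope (Z q (f p)) (m p).
  by apply: filterS (@withinT _ _ _ _) => p /= p1; exact: (hm p p1).1.
have hlim : kval (f p) (m p) @[p --> F] --> kval (cis t0) m0.
  exact: (cvg_kval (norm_cis t0) hb hf ms).
move/cvgrPdist_lt : hlim => /(_ e e0).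
rewrite /F near_withinE => -[[A B] /= [/nbhs_ballP[d1 /= d10 hA] /nbhs_ballP[d2 /= d20 hB]] hAB].
exists (Num.min d1 d2); first by rewrite lt_min d10.
move=> r x /andP[r1 rd] xd.
have [_ hk] := hm (r, x) r1.
have := hAB (r, x) _ r1; rewrite /= distrC => hlt.
rewrite /= in hk; rewrite hk ltW//; apply: hlt; split=> /=.
- apply: hA; rewrite /ball/= ltr_norml; move: rd; rewrite -ltrBlDl lt_min => /andP[rd _].
  by apply/andP; split; lra.
- apply: hB; rewrite /ball/= distrC; apply: lt_le_trans xd _.
  by rewrite ge_min lexx orbT.
Qed.

End BandLimit.

(** * The Radon-Nikodym density at Lebesgue points *)

Section Density.
Variable R : realType.
Local Notation pi := (@trigo.pi R).
Local Notation leb := (@lebesgue_measure R).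
Variable nu : probability (measurableTypeR R) R.
Hypothesis nul : nu `<< leb.

Definition rnd (t : R) : R := fine (Radon_Nikodym_SigmaFinite.f nu leb t).

Lemma rndE t : (rnd t)%:E = Radon_Nikodym_SigmaFinite.f nu leb t.
Proof. by rewrite fineK// Radon_Nikodym_SigmaFinite.f_fin_num. Qed.

Lemma rnd_ge0 t : 0 <= rnd t.
Proof. by rewrite fine_ge0// Radon_Nikodym_SigmaFinite.f_ge0. Qed.

Lemma rnd_integrable : leb.-integrable setT (EFin \o rnd).
Proof.
rewrite (_ : _ \o _ = Radon_Nikodym_SigmaFinite.f nu leb).
  exact: Radon_Nikodym_SigmaFinite.f_integrable.
by apply/funext => t; rewrite /= rndE.
Qed.

Lemma rnd_integral A : measurable A -> nu A = (\int[leb]_(t in A) (rnd t)%:E)%E.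
Proof.
move=> mA; rewrite (Radon_Nikodym_SigmaFinite.f_integral nul mA).
by apply: eq_integral => t _; rewrite rndE.
Qed.

Let shrink (x : R) n : set R := ball x (n.+1%:R^-1).

Lemma shrink_nicely x : nicely_shrinking x (shrink x).
Proof.
split=> [n|]; first exact: measurable_ball.
have p n : 0 < n.+1%:R^-1 :> R by rewrite invr_gt0.
exists (1, fun n => PosNum (p n)); split => //=.
- exact: cvg_harmonic.
- by move=> n t.
- by move=> n; rewrite mul1e.
Qed.

(** The averages of [nu] over shrinking balls have two limits: [rnd t0] by Lebesgue differentiation,
    and K / (2 pi) by the interval estimate. *)
Lemma rnd_at_lebesgue_pt t0 K : lebesgue_pt rnd t0 -> 0 < t0 < 2 * pi ->
  (forall e, 0 < e -> exists2 d, 0 < d & forall r x, 1 < r < 1 + d ->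
     `|x - t0| < d -> `|poisson nu r x - K| <= e) ->
  rnd t0 = K / (2 * pi).
Proof.
move=> hL /andP[t0p t02] hK; have p := @pi_gt0 R.
pose u (n : nat) : R := n.+1%:R / 2 * fine (nu (shrink t0 n)).
have hloc : locally_integrable setT rnd.
  by apply: open_integrable_locally; [exact: openT|exact: rnd_integrable].
have hu : u n @[n --> \oo] --> rnd t0.
  have := nice_lebesgue_differentiation shrink_nicely hloc hL.
  rewrite (_ : (fun n => _) = EFin \o u).
    by move=> /fine_cvg.
  apply/funext => n; rewrite -rnd_integral; last exact: measurable_ball.
  rewrite lebesgue_measure_ball ?invr_ge0// inver mulrn_eq0 invr_eq0 pnatr_eq0 /=.
  rewrite /u EFinM fineK; last by apply: fin_num_measure; exact: measurable_ball.
  by congr (_%:E * _)%E; rewrite -[_ *+ 2]mulr_natr invfM invrK.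
have hu2 : 2 * pi * u n @[n --> \oo] --> 2 * pi * rnd t0.
  by apply: cvgM; [exact: cvg_cst|exact: hu].
have hu3 : 2 * pi * u n @[n --> \oo] --> K.
  apply/cvgrPdist_le => e e0; have [d d0 hd] := hK e e0.
  (* A radius below [m] keeps the arc within distance d of t0, inside ]0, 2 pi[, and of length at
     most pi / 4. *)
  pose m := Num.min (Num.min d t0) (Num.min (2 * pi - t0) (pi / 8)).
  have m0 : 0 < m by rewrite /m !lt_min d0 t0p subr_gt0 t02 divr_gt0.
  have [md mt m2 m8] : [/\ m <= d, m <= t0, m <= 2 * pi - t0 & m <= pi / 8].
    by split; rewrite /m !ge_min lexx ?orbT.
  move: m m0 md mt m2 m8 => m m0 md mt m2 m8.
  near=> n.
  have rm : n.+1%:R^-1 < m by near: n; exact: near_infty_natSinv_lt (PosNum m0).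
  pose r : R := n.+1%:R^-1; rewrite -/r in rm.
  have r0 : 0 < r by rewrite invr_gt0.
  rewrite distrC /u /shrink ball_itv -/r.
  have nr : n.+1%:R = r^-1 by rewrite /r invrK.
  rewrite nr; move: r rm r0 nr => r rm r0 _.
  have := @interval_estimate R nu nul (t0 - r) (t0 + r) K e d ltac:(lra) ltac:(lra)
    ltac:(lra) ltac:(lra) d0.
  have -> : t0 + r - (t0 - r) = 2 * r by ring.
  move: (fine _) => N hN.
  have {}hN : `|2 * pi * N - K * (2 * r)| <= e * (2 * r).
    apply: hN => r' x hr' /andP[x1 x2]; apply: hd => //.
    by apply: le_lt_trans (lt_le_trans rm md); apply: norm_leI; lra.
  have -> : 2 * pi * (r^-1 / 2 * N) - K = (2 * pi * N - K * (2 * r)) / (2 * r).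
    by field; rewrite gt_eqF.
  rewrite normrM normfV (gtr0_norm (mulr_gt0 _ r0))//.
  by rewrite ler_pdivrMr// mulr_gt0.
have e : 2 * pi * rnd t0 = K by exact: (cvg_unique _ hu2 hu3).
by rewrite -e [X in X / _]mulrC mulfK// gt_eqF// mulr_gt0.
Unshelve. all: by end_near.
Qed.

(** On [B] the new function differs from [rnd] only at points that are not Lebesgue points and
    possibly at 0, the end of the parameter interval, hence on a null set. *)
Lemma density_of_limit (B : set R) (k : R -> R) : open B ->
  {in B, continuous k} ->
  (forall t, B t -> 0 < t < 2 * pi -> forall e, 0 < e -> exists2 d, 0 < d &
    forall r x, 1 < r < 1 + d -> `|x - t| < d -> `|poisson nu r x - k t| <= e) ->
  (forall t, B t -> 0 <= k t) ->
  is_density nu (fun t => if t \in B then k t / (2 * pi) else rnd t).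
Proof.
move=> oB ck hk k0; set g := fun t => _; have p := @pi_gt0 R.
have mB : measurable B by exact: open_measurable.
have mg : measurable_fun setT g.
  apply: measurable_fun_if => //.
  - apply: (@measurable_fun_bool _ _ _ _ true).
    rewrite setTI (_ : _ @^-1` _ = B)//; apply/seteqP; split => t /=.
      by move=> /set_mem.
    by move=> /mem_set.
  - rewrite setTI (_ : _ @^-1` _ = B); last first.
      by apply/seteqP; split => t /=; [move=> /set_mem|move=> /mem_set].
    apply: open_continuous_measurable_fun => // t /ck h.
    by apply: cvgM; [exact: h|exact: cvg_cst].
  - apply: measurable_funTS; apply/measurable_EFinP.
    exact: measurable_int rnd_integrable.
split.
- exact: measurable_funTS.
- move=> t _; rewrite /g; case: ifPn => [/set_mem/k0 h|_]; last exact: rnd_ge0.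
  by rewrite divr_ge0// mulr_ge0// ltW.
- move=> A mA AS; rewrite rnd_integral//; apply: ae_eq_integral => //.
  + apply: measurable_funTS; exact: measurable_int rnd_integrable.
  + by apply: measurable_funTS; apply/measurable_EFinP.
  have hloc : locally_integrable setT rnd.
    by apply: open_integrable_locally; [exact: openT|exact: rnd_integrable].
  have h1 := lebesgue_differentiation hloc.
  have h2 : {ae leb, forall t, t != 0}.
    exists [set 0]; split; [exact: measurable_set1|exact: lebesgue_measure_set1|].
    by move=> t /= /negP; rewrite negbK => /eqP.
  apply: (@filterS2 _ _ (ae_filter_ringOfSetsType leb) _ _ _ _ h1 h2) => t hL tn At; rewrite /g; case: ifPn => // /set_mem hB.
  have := AS t At; rewrite /angles /= in_itv/= => /andP[ta tb].
  have t2 : 0 < t < 2 * pi by rewrite tb andbT lt_neqAle eq_sym tn.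
  by congr EFin; apply: rnd_at_lebesgue_pt => //; exact: hk.
Qed.

End Density.

(** * Bands, orbits of the stable slope, and the inequality *)

Section Band.
Variable R : realType.
Local Notation C := R[i].
Local Notation "x %:C" := (real_complex R x).
Local Notation pi := (@trigo.pi R).

Definition slope_vector (m : C) : 'cV[C]_2 := \col_i (if i == 0 then 1 else m).

Lemma slope_vectorE m : slope_vector m 0 0 = 1 /\ slope_vector m 1 0 = m.
Proof. by rewrite !mxE. Qed.

Lemma slope_vector_eig (A : 'M[C]_2) w m : A 0 0 + A 0 1 * m = w ->
  A 1 0 + A 1 1 * m = w * m -> A *m slope_vector m = w *: slope_vector m.
Proof.
move=> e0 e1; have [v0 v1] := slope_vectorE m.
by apply: mx2P => j; rewrite (ord1 j) mulmx2E [RHS]mxE v0 v1 !mulr1.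
Qed.

Lemma jform_slope_vector m : `|m| < 1 -> 0 < jform (slope_vector m).
Proof.
by move=> m1; rewrite /jform !mxE /= normr1 expr1n subr_gt0 expr_lt1.
Qed.

Lemma Re_le (x y : C) : x <= y -> complex.Re x <= complex.Re y.
Proof. by case: x => a b; case: y => c d; rewrite lecE => /andP[]. Qed.

Lemma Re_inv_defect (m : C) : complex.Re (1 - `|m| ^+ 2)^-1 = (1 - normc m ^+ 2)^-1.
Proof.
rewrite normC_normc -rmorphXn -(rmorph1 (real_complex R)) -rmorphB.
by rewrite -(fmorphV (real_complex R)).
Qed.

(** Here a, b and d, e stand for the squared moduli of the entries of the orbit vectors u_{2j} and
    u_{2j+1}, and c for [u_{2j}]. The right side equals (a + d) / c and the left side a / c, so
    exactly d / c is discarded. *)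
Lemma defect_step (a b c d e : C) : 0 < c -> 0 <= b -> 0 <= d ->
  a - b = c -> d - e = - c -> (1 - b / a)^-1 <= e / c + b / c.
Proof.
move=> c0 b0 d0 ha he.
have aE : a = c + b by rewrite -ha subrK.
have a0 : 0 < a by rewrite aE ltr_wpDr.
have eE : e = d + c by rewrite -[c]opprK -he; ring.
have -> : (1 - b / a)^-1 = a / c.
  have -> : 1 - b / a = c / a by rewrite -ha mulrBl divff ?gt_eqF.
  by rewrite invf_div.
by rewrite aE eE -mulrDl ler_pM2r ?invr_gt0// lerD2r lerDr.
Qed.

Variables alpha lambda : nat -> C.
Hypothesis Ha : forall n, `|alpha n| < 1.
Hypothesis Hl : forall n, `|lambda n| = 1.
Variable h : nat.
Hypothesis h0 : (0 < h)%N.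
Hypothesis Hp : cmv_periodic h.*2 alpha lambda.
Local Notation q := h.*2.
Local Notation Z := (Zmx alpha lambda).
Local Notation Zi := (Zinv alpha lambda).

Lemma shift_norm j : (forall n, `|shift j alpha n| < 1) /\
  (forall n, `|shift j lambda n| = 1).
Proof. by split=> n; rewrite /shift. Qed.

Lemma shift_periodic j : cmv_periodic q (shift j alpha) (shift j lambda).
Proof. by move=> n; rewrite /shift addnA; exact: Hp. Qed.

Definition orbit m j z := Z j z *m slope_vector m.

Lemma shifted_monodromy j z :
  Zmx (shift j.*2 alpha) (shift j.*2 lambda) q z *m Z j.*2 z = Z j.*2 z *m Z q z.
Proof. by rewrite Zmx_shift ?odd_double// Z_period// addnC. Qed.

(** The shifted monodromy matrix is conjugate to the original one by Z(2j), which carries the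
    eigenvector along; an even number of steps preserves [.] > 0. This identifies the modulus of
    s_{2j} with that of the slope of the orbit at 2j. *)
Lemma shifted_band_slope j z m : `|z| = 1 -> band_slope alpha lambda h z m ->
  band_slope (shift j.*2 alpha) (shift j.*2 lambda) h z
    (orbit m j.*2 z 1 0 / orbit m j.*2 z 0 0).
Proof.
move=> z1 [m1 [w [ht wne e0 e1]]]; have [z0 _] := unitcJ z1.
have hU := slope_vector_eig e0 e1.
have hJ : 0 < jform (orbit m j.*2 z).
  by rewrite /orbit jform_Z_unit// -signr_odd odd_double mul1r jform_slope_vector.
have hS := shifted_monodromy j z.
have hE : Zmx (shift j.*2 alpha) (shift j.*2 lambda) q z *m orbit m j.*2 z =
    w *: orbit m j.*2 z.
  by rewrite /orbit mulmxA hS -mulmxA hU scalemxAr.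
have [_ k1 k2 k3] := jform_gt0_slope hJ hE.
split=> //; exists w; split => //.
rewrite -ht -[X in \tr X]mulmx1 -(mulZV Ha Hl j.*2 z0) mulmxA hS.
by rewrite mxtrace_mulC mulmxA (mulVZ Ha Hl j.*2 z0) mul1mx.
Qed.

(** Moving Z(n) around the trace turns the left side into the lower right entry of the spectral
    projection of Z(n) Phi Z(n)^(-1), whose eigenvector is the orbit at n; [conjsym_entry] evaluates
    it. *)
Lemma spectral_entry n z m w : `|z| = 1 -> \tr (Z q z) = w + w^* -> w != w^* ->
  Z q z *m slope_vector m = w *: slope_vector m -> `|m| < 1 ->
  (\tr (Z q z *m (Zi n z *m Pi2 R *m Z n z)) -
    w^* * \tr (Zi n z *m Pi2 R *m Z n z)) / (w - w^*) =
  - `|orbit m n z 1 0| ^+ 2 / ((-1) ^+ n * jform (slope_vector m)).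
Proof.
move=> z1 ht wne hU m1; have [z0 _] := unitcJ z1.
have PiE (B : 'M[C]_2) : \tr (B *m Pi2 R) = B 1 1.
  by rewrite tr2E !mulmx2E !mxE /=; ring.
have -> : \tr (Zi n z *m Pi2 R *m Z n z) = 1.
  by rewrite mxtrace_mulC mulmxA (mulZV Ha Hl n z0) mul1mx tr2E !mxE /= add0r.
set B := Z n z *m Z q z *m Zi n z.
have -> : \tr (Z q z *m (Zi n z *m Pi2 R *m Z n z)) = B 1 1.
  by rewrite -PiE mulmxA mxtrace_mulC /B !mulmxA.
have hB : conjsym B.
  apply: conjsymM; first by apply: conjsymM; exact: conjsym_Z.
  have := conjsym_adj2 (conjsym_Z Ha Hl n z1); rewrite /Zinv.
  move: (adj2 _) => D [d1 d2]; split; rewrite !mxE ?d1 ?d2 conjM; congr (_ * _);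
  by rewrite rmorphXn /= rmorphN rmorph1.
have tB : \tr B = w + w^*.
  by rewrite /B mxtrace_mulC mulmxA (mulVZ Ha Hl n z0) mul1mx.
have eB : B *m orbit m n z = w *: orbit m n z.
  rewrite /B /orbit -!mulmxA (mulmxA (Zi n z)) (mulVZ Ha Hl n z0) mul1mx hU.
  by rewrite scalemxAr.
have := conjsym_entry hB tB eB; rewrite {1}/orbit jform_Z_unit// => e.
have d0 : w - w^* != 0 by rewrite subr_eq0.
have j0 : (-1) ^+ n * jform (slope_vector m) != 0.
  by rewrite mulf_neq0 ?signr_eq0// gt_eqF// jform_slope_vector.
rewrite mulr1; apply/eqP; rewrite eqr_div//; apply/eqP.
by rewrite e; ring.
Qed.

Lemma kval_ge z m : `|z| = 1 -> band_slope alpha lambda h z m ->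
  kval alpha lambda h z m >= h%:R^-1 *
    \sum_(j < h) (1 - normc (orbit m j.*2 z 1 0 / orbit m j.*2 z 0 0) ^+ 2)^-1.
Proof.
move=> z1 [m1 [w [ht wne e0 e1]]].
have hU := slope_vector_eig e0 e1; have hJ := jform_slope_vector m1.
(* [psi X] is tr (P X) for the spectral projection P on (1, m); [Rsum] is a signed sum of conjugates
   of [Pi2], to which linearity of [psi] is applied. *)
pose psi X : C := (\tr (Z q z *m X) - w^* * \tr X) / (w - w^*).
pose X n := Zi n z *m Pi2 R *m Z n z.
have psiD (V W : 'M[C]_2) : psi (V + W) = psi V + psi W.
  by rewrite /psi mulmxDr !mxtraceD; ring.
have psiB (V W : 'M[C]_2) : psi (V - W) = psi V - psi W.
  by rewrite /psi mulmxBr !raddfB /=; ring.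
have psi0 : psi 0 = 0 by rewrite /psi mulmx0 !mxtrace0 mulr0 subrr mul0r.
have psiR k : psi (Rsum alpha lambda k.*2 z) = \sum_(j < k) (psi (X j.*2.+1) - psi (X j.*2)).
  elim: k => [|k IH]; first by rewrite /Rsum !big_ord0.
  rewrite /Rsum doubleS !big_ord_recr /= odd_double /= addr0 psiD -psiB.
  by rewrite -/(Rsum alpha lambda k.*2 z) IH.
have step j : (1 - `|orbit m j.*2 z 1 0 / orbit m j.*2 z 0 0| ^+ 2)^-1 <=
    psi (X j.*2.+1) - psi (X j.*2).
  rewrite /psi /X !(spectral_entry _ z1 ht wne hU m1).
  have s0 : (-1) ^+ j.*2 = 1 :> C by rewrite -signr_odd odd_double.
  have s1 : (-1) ^+ j.*2.+1 = -1 :> C by rewrite exprS s0 mulr1.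
  rewrite s0 s1 mul1r mulN1r invrN mulrNN mulNr opprK.
  have c0 : jform (orbit m j.*2 z) = jform (slope_vector m).
    by rewrite /orbit jform_Z_unit// s0 mul1r.
  have c1 : jform (orbit m j.*2.+1 z) = - jform (slope_vector m).
    by rewrite /orbit jform_Z_unit// s1 mulN1r.
  rewrite normrM normfV exprMn exprVn; move: c0 c1 hJ.
  move: (jform (slope_vector m)) => c c0 c1 cp.
  by apply: (defect_step cp _ _ c0 c1); rewrite exprn_ge0.
rewrite /kval (slopeproj_trE _ ht e0) -/(psi _) psiR [leRHS]mulrC.
apply: ler_wpM2l; first by rewrite invr_ge0.
rewrite raddf_sum; apply: ler_sum => j _; rewrite -Re_inv_defect.
by apply: Re_le; exact: step.
Qed.

Definition band : set R := [set t | -2 < \tr (Z q (cis t)) < 2].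

Lemma band_real t : \tr (Z q (cis t)) = (complex.Re (\tr (Z q (cis t))))%:C.
Proof.
have [a1 a2] := conjsym_Z Ha Hl q (norm_cis t).
rewrite tr2E a1; case: (Z q (cis t) 0 0) => x y.
by rewrite -conjcC /=; apply/eqP; rewrite eq_complex /= subrr !eqxx.
Qed.

Lemma bandE t : band t <-> -2 < complex.Re (\tr (Z q (cis t))) < 2.
Proof.
rewrite /band /= band_real /=.
have -> : 2 = (2%:R : R)%:C by rewrite rmorph_nat.
by rewrite -rmorphN !ltcR.
Qed.

Lemma open_band : open band.
Proof.
have hc : continuous (fun t : R => complex.Re (\tr (Z q (cis t)))).
  move=> t; apply: cvg_Re; apply: cvg_mxtrace; apply: mxcvg_Z; first exact: cis_neq0.
  exact: (@cvg_cis _ _ (nbhs t) _ (fun t => t) t).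
have -> : band = (fun t : R => complex.Re (\tr (Z q (cis t)))) @^-1` `]-2, 2[%classic.
  by apply/seteqP; split => t /=; rewrite in_itv/=; move/bandE.
by apply: open_comp; [move=> t _; exact: hc|exact: interval_open].
Qed.

Lemma band_slope_ex t : band t -> exists m, band_slope alpha lambda h (cis t) m.
Proof.
move=> ht; have hd : \det (Z q (cis t)) = 1.
  by rewrite (det_Z Ha Hl _ (cis_neq0 t)) -signr_odd odd_double.
have [w [_ wne tr [U hJ hU]]] := elliptic_eig (conjsym_Z Ha Hl q (norm_cis t)) hd ht.
have [_ m1 e0 e1] := jform_gt0_slope hJ hU.
by exists (U 1 0 / U 0 0); split=> //; exists w.
Qed.

Definition slope t : C := xget 0 [set m | band_slope alpha lambda h (cis t) m].

Lemma slopeP t : band t -> band_slope alpha lambda h (cis t) (slope t).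
Proof. by move=> /band_slope_ex[m hm]; exact: (@xgetPex _ _ _ (ex_intro _ m hm)). Qed.

Definition kband t : R := kval alpha lambda h (cis t) (slope t).

(** [slope] is an arbitrary pointwise choice; on the band its continuity comes from the stability
    estimate along the circle itself. *)
Lemma kband_continuous : {in band, continuous kband}.
Proof.
move=> t /set_mem ht.
have hb := slopeP ht.
apply: (@cvg_kval R alpha lambda Ha Hl h _ (nbhs t) _ (fun t => cis t) slope _ _ (norm_cis t) hb).
  exact: (@cvg_cis _ _ (nbhs t) _ (fun t => t) t).
apply: (filterS _ (open_nbhs_nbhs (conj open_band ht))) => s hs.
exact: (band_slope_is_slope (slopeP hs)).
Qed.

Lemma schur_band (m : probability (measurableTypeR R) R) t m0 :
  is_spectral_measure alpha lambda m -> band_slope alpha lambda h (cis t) m0 ->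
  cvg (radial (schur m) t r @[r --> 1^'-]) /\
  normc (boundary_value (schur m) t) = normc m0.
Proof.
move=> Hm [m1 [w [ht wne e0 e1]]].
have hr : radial (schur m) t r @[r --> 1^'-] --> (m0 / cis t : C^o).
  exact: (schur_radial Ha Hl h0 Hp Hm ht wne e0 e1 m1).
split; first by apply/cvg_ex; exists (m0 / cis t : C^o); exact: hr.
have -> : boundary_value (schur m) t = m0 / cis t.
  by rewrite /boundary_value; exact: (cvg_lim (@norm_hausdorff _ _) hr).
by rewrite normcM normcV normc_cis invr1 mulr1.
Qed.

End Band.

Local Open Scope complex_scope.

Theorem theorem9p2 (R : realType) (q : nat) (alpha lambda : nat -> R[i])
    (mu : nat -> probability (measurableTypeR R) R)
    (nu : probability (measurableTypeR R) R) :
  (0 < q)%N -> ~~ odd q ->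
  (forall n, `|alpha n| < 1) ->
  (forall n, `|lambda n| = 1) ->
  cmv_periodic q alpha lambda ->
  (forall j, is_spectral_measure (shift j alpha) (shift j lambda) (mu j)) ->
  is_dos alpha lambda nu ->
  nu `<< (@lebesgue_measure R) ->
  exists g : R -> R,
    is_density nu g /\
    forall tau : R, 0 <= tau < 2 * pi ->
      -2 < discriminant q alpha lambda (cis tau) < 2 ->
      [/\ g t @[t --> within (angles R) (nbhs tau)] --> g tau,
          (forall j, (j < q./2)%N ->
             cvg (radial (schur (mu (2 * j)%N)) tau r @[r --> 1^'-]) /\
             normc (boundary_value (schur (mu (2 * j)%N)) tau) < 1) &
          g tau >= (pi * q%:R)^-1 *
            \sum_(j < q./2)
              (1 - normc (boundary_value (schur (mu (2 * j)%N)) tau) ^+ 2)^-1].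
Proof.
move=> q0 qeven Ha Hl; have := odd_double_half q; rewrite (negbTE qeven) add0n.
move: (q./2) => h hq; rewrite -{}hq in q0 *; rewrite double_gt0 in q0.
move=> Hp Hmu Hnu nul; have p := @pi_gt0 R.
have schurP j t : band alpha lambda h t ->
    cvg (radial (schur (mu (2 * j)%N)) t r @[r --> 1^'-]) /\
    normc (boundary_value (schur (mu (2 * j)%N)) t) =
    normc (orbit alpha lambda (slope alpha lambda h t) j.*2 (cis t) 1 0 /
      orbit alpha lambda (slope alpha lambda h t) j.*2 (cis t) 0 0).
  move=> ht; rewrite mul2n; have [Ha' Hl'] := shift_norm Ha Hl j.*2.
  apply: (schur_band Ha' Hl' q0 (shift_periodic Hp _) (Hmu _)).
  exact: (shifted_band_slope Ha Hl Hp j (norm_cis t) (slopeP Ha Hl ht)).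
have slope_lt1 j t : band alpha lambda h t ->
    normc (boundary_value (schur (mu (2 * j)%N)) t) < 1.
  move=> ht; rewrite (schurP j t ht).2 -ltcR -normC_normc.
  by have [] := shifted_band_slope Ha Hl Hp j (norm_cis t) (slopeP Ha Hl ht).
have kge t : band alpha lambda h t -> h%:R^-1 *
    \sum_(j < h) (1 - normc (boundary_value (schur (mu (2 * j)%N)) t) ^+ 2)^-1 <=
    kband alpha lambda h t.
  move=> ht; have := kval_ge Ha Hl (norm_cis t) (slopeP Ha Hl ht).
  rewrite /kband => hk; apply: le_trans hk; apply: ler_wpM2l; first by rewrite invr_ge0.
  by apply: ler_sum => j _; rewrite (schurP j t ht).2.
have oB : open (band alpha lambda h) by exact: open_band.
have cB : {in band alpha lambda h, continuous (kband alpha lambda h)}.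
  exact: kband_continuous.
(* The factor 1 / (2 pi) reflects that [pkernel] has integral 2 pi over the circle. Off the band any
   version of the density serves. *)
exists (fun t => if t \in band alpha lambda h then kband alpha lambda h t / (2 * pi)
  else rnd nu t); split.
  apply: density_of_limit => //.
  - move=> t ht _ e e0.
    exact: (poisson_limit Ha Hl q0 Hp Hnu (slopeP Ha Hl ht) e0).
  - move=> t ht; apply: le_trans (kge t ht); rewrite mulr_ge0 ?invr_ge0// sumr_ge0// => j _.
    rewrite invr_ge0 subr_ge0 expr_le1 ?normc_ge0// ltW//; exact: slope_lt1.
move=> tau _ ht; have hB : band alpha lambda h tau by [].
split.
- rewrite (mem_set hB).
  have hc : kband alpha lambda h t / (2 * pi) @[t --> tau] -->
      kband alpha lambda h tau / (2 * pi).
    by apply: cvgM; [exact: (cB tau (mem_set hB))|exact: cvg_cst].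
  apply: cvg_within_filter; apply: cvg_trans hc; apply: near_eq_cvg.
  apply: (filterS _ (open_nbhs_nbhs (conj oB hB))) => t /mem_set ->.
  by [].
- by move=> j _; split; [exact: (schurP j tau hB).1|exact: slope_lt1].
(* With q = 2h, the constant 1 / (pi q) splits into 1 / (2 pi) and the factor 1 / h of [kge]. *)
- rewrite (mem_set hB) -muln2 natrM [h%:R * _]mulrC mulrA invfM mulrAC.
  rewrite -mulrA (mulrC pi) [leRHS]mulrC; apply: ler_wpM2l.
    by rewrite invr_ge0 mulr_ge0// ltW.
  by rewrite [leLHS]mulrC; exact: kge.
Qed.
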